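(* For any real $a$ sufficiently small, there exists $\ell_a^2 = \frac{1}{12}a^2+O(a^4)$ (as $a\to 0$) such that, for $\ell\in\mathbb{R}$, $\ell\neq 0$: (i) for any $\ell$ with $\ell^2\geq \ell_a^2$, the spectrum of $\mathcal{A}_a(\ell)$ is purely imaginary; (ii) for any $\ell$ with $\ell^2<\ell_a^2$, the spectrum of $\mathcal{A}_a(\ell)$ is purely imaginary, except for a pair of simple real eigenvalues, with opposite signs.
   Context: Periodic waves (KP-I equation). For real $a$ sufficiently small, $(P_a,k_a)$ denotes the one-parameter family of small solutions, $P_a$ being $2\pi$-periodic and even and $k_a>0$, of $k_a^2P_a''=-P_a-\frac12P_a^2$ parameterized by $a=\frac1\pi\int_0^{2\pi}P_a(z)\cos(z)\,dz$, with expansions $P_a(z)=a\cos(z)+\frac14\left(\frac13\cos(2z)-1\right)a^2+O(|a|^3)$ and $k_a^2=1-\frac{5}{24}a^2+O(a^4)$; it satisfies $P_a(z+\pi)=P_{-a}(z)$, $k_a=k_{-a}$. $L^2_0(0,2\pi)=\{f\in L^2(0,2\pi): \int_0^{2\pi}f(z)\,dz=0\}$ (complex-valued functions), $H^m_{\mathrm{per}}(0,2\pi)$ is the space of $2\pi$-periodic functions in $H^m_{\mathrm{loc}}(\mathbb{R})$, and $\partial_z^{-1}$ is the inverse of the restriction of $\partial_z$ to $L^2_0(0,2\pi)$. $\mathcal{A}_a(\ell)=\partial_z^3+\frac1{k_a^2}\partial_z\big((1+P_a)\,\cdot\,\big)+\ell^2\partial_z^{-1}$, acting in $L^2_0(0,2\pi)$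 with domain $H^3_{\mathrm{per}}(0,2\pi)\cap L^2_0(0,2\pi)$. ''Purely imaginary'' means contained in $i\mathbb{R}$. *)

(* Defs.v *)
From HB Require Import structures.
From mathcomp Require Import all_boot all_order all_algebra.
From mathcomp Require Import complex.
From mathcomp Require Import all_classical all_reals all_analysis.
Import Order.TTheory GRing.Theory Num.Theory.
Import numFieldNormedType.Exports.

Set Implicit Arguments.
Unset Strict Implicit.
Unset Printing Implicit Defensive.

Local Open Scope classical_set_scope.
Local Open Scope ring_scope.
Local Open Scope complex_scope.

(* Elements of L^2(0, 2 pi) are represented by their 2 pi-periodic extensions
   to the whole line, two functions being identified when they agree almost
   everywhere; unbounded operators are represented by their graphs. *)

Section Defs.
Context {R : realType}.
Implicit Types (f g u v w : R -> R[i]) (phi : R -> R) (lam : R[i]).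

Let mu := @lebesgue_measure R.

Definition cmeasurable f :=
  measurable_fun setT (fun z => complex.Re (f z)) /\
  measurable_fun setT (fun z => complex.Im (f z)).

Definition cintegral (D : set R) f : R[i] :=
  (\int[mu]_(z in D) complex.Re (f z)) +i* (\int[mu]_(z in D) complex.Im (f z)).

Definition L1_loc f :=
  locally_integrable setT (fun z => complex.Re (f z)) /\
  locally_integrable setT (fun z => complex.Im (f z)).

Definition L2_loc f := cmeasurable f /\
  forall K : set R, compact K ->
    (\int[mu]_(z in K) (Normc.normc (f z) ^+ 2)%:E < +oo)%E.

Definition L2_per f := [/\ periodic f (pi *+ 2), cmeasurable f &
  (\int[mu]_(z in `[0%R, (pi *+ 2)%R])
     (Normc.normc (f z) ^+ 2)%:E < +oo)%E].

Definition L2_0 f := L2_per f /\ cintegral `[0, pi *+ 2] f = 0.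

Definition L2norm f : R :=
  Num.sqrt (\int[mu]_(z in `[0, pi *+ 2]) Normc.normc (f z) ^+ 2).

Definition test_function phi :=
  (forall n x, derivable (phi^`(n))%classic x 1) /\
  compact (closure [set x | phi x != 0]).

(* v is the n-th distributional derivative of u; real-valued test functions
   suffice, by linearity. *)
Definition weak_deriv (n : nat) u v := [/\ L1_loc u, L1_loc v &
  forall phi, test_function phi ->
    cintegral setT (fun z => ((phi^`(n))%classic z)%:C * u z) =
    (-1) ^+ n * cintegral setT (fun z => (phi z)%:C * v z)].

Definition H_loc (m : nat) u := L2_loc u /\
  forall j, (1 <= j <= m)%N -> exists2 v, L2_loc v & weak_deriv j u v.

Definition H_per (m : nat) u := periodic u (pi *+ 2) /\ H_loc m u.

(* w = \partial_z^{-1} u *)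
Definition inv_dz u w := [/\ L2_0 u, H_per 1 w, L2_0 w & weak_deriv 1 w u].

Definition ae_equal f g := {ae mu, forall z, f z = g z}.

(* Graph of the operator
     d_z^3 + k^{-2} d_z ((1 + p) .) + l^2 d_z^{-1}
   in L^2_0 with domain H^3_per \cap L^2_0. *)
Definition KP_operator (p : R -> R) (k l : R) u f :=
  [/\ H_per 3 u, L2_0 u, L2_0 f &
    exists u3 q w,
      [/\ weak_deriv 3 u u3,
          weak_deriv 1 (fun z => (1 + p z)%:C * u z) q,
          inv_dz u w &
          ae_equal f
            (fun z => u3 z + ((k ^+ 2)^-1)%:C * q z + (l ^+ 2)%:C * w z)]].

Section SpectralNotions.
Variable A : (R -> R[i]) -> (R -> R[i]) -> Prop.

(* lam - A is a bijection from the domain of A onto L^2_0, with bounded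
   inverse. *)
Definition in_resolvent_set lam :=
  [/\ forall f, L2_0 f ->
        exists u g, A u g /\ ae_equal (fun z => lam * u z - g z) f,
      forall u g, A u g -> ae_equal (fun z => lam * u z - g z) (fun=> 0) ->
        ae_equal u (fun=> 0) &
      exists M : R, forall u g, A u g ->
        L2norm u <= M * L2norm (fun z => lam * u z - g z)].

Definition spectrum : set R[i] := [set lam | ~ in_resolvent_set lam].

(* u belongs to the kernel of (A - lam)^n. *)
Fixpoint gen_kernel lam (n : nat) u : Prop :=
  if n is n'.+1 then
    exists2 g, A u g & gen_kernel lam n' (fun z => g z - lam * u z)
  else ae_equal u (fun=> 0).

(* Algebraic multiplicity one: the generalized eigenspace is a line, spanned
   by an eigenvector. *)
Definition simple_eigenvalue lam :=
  exists u, [/\ A u (fun z => lam * u z),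
    ~ ae_equal u (fun=> 0) &
    forall n v, gen_kernel lam n v ->
      exists c : R[i], ae_equal v (fun z => c * u z)].

End SpectralNotions.

Definition imaginary_axis : set R[i] := [set lam | complex.Re lam = 0].

Definition periodic_wave (p : R -> R) (k : R) :=
  [/\ periodic p (pi *+ 2),
      forall z, p (- z) = p z,
      0 < k,
      forall z, derivable p z 1 /\ derivable (p^`())%classic z 1 &
      forall z, k ^+ 2 * (p^`(2))%classic z = - p z - p z ^+ 2 / 2].

(* The remainder in the expansion of P a is uniform in z. *)
Definition small_periodic_waves (P : R -> R -> R) (k : R -> R) :=
  [/\ \forall a \near (0 : R),
        periodic_wave (P a) (k a) /\
        a = pi^-1 * \int[mu]_(z in `[0, pi *+ 2]) (P a z * cos z),
      exists C : R, \forall a \near (0 : R), forall z,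
        `|P a z - (a * cos z + 4^-1 * (3^-1 * cos (2 * z) - 1) * a ^+ 2)|
          <= C * `|a| ^+ 3,
      (fun a : R => k a ^+ 2) =
        (fun a : R => 1 - 5 / 24 * a ^+ 2) +O_ (0 : R) (fun a : R => a ^+ 4) &
      \forall a \near (0 : R),
        (forall z, P a (z + pi) = P (- a) z) /\ k a = k (- a)].

End Defs.

(* Main.v *)
Require Import Defs.
From HB Require Import structures.
From mathcomp Require Import all_boot all_order all_algebra.
From mathcomp Require Import complex ring lra.
From mathcomp Require Import all_classical all_reals all_analysis.
From mathcomp Require Import measurable_realfun.
Import Order.TTheory GRing.Theory Num.Theory.
Import numFieldNormedType.Exports.
Set Implicit Arguments.
Unset Strict Implicit.
Unset Printing Implicit Defensive.
Local Open Scope classical_set_scope.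
Local Open Scope ring_scope.
Local Open Scope complex_scope.

(* Write [b = (1 + P_a) / k_a^2], [x = l^2], let [K] be the mean-free primitive on
   2 pi-periodic functions, and put [u = K p]. Applying [K] twice turns
   [(lam - A) u = f] into a Fredholm equation for the continuous function [p],
   whose weak form is [E_x(p, q) + lam kap(p, q) = <K f, K q>] with the symmetric
   energy [E_x(p, q) = <p, q> - <b K p, K q> + x <K^2 p, K^2 q>] and the
   antisymmetric form [kap(p, q) = <K^2 p, K q>].

   The second derivative of the wave annihilates [E_0], and [E_0] is coercive off
   the first Fourier modes; so for [x > 0] the energy is positive definite on the
   orthogonal complement of [sin], i.e. has at most one negative direction.
   An element of the kernel with [Re lam <> 0] has zero energy. If [E_x >= 0] this
   forces it to vanish; otherwise a neutral subspace on which [E_x] and [kap] are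
   zero is at most a line, which makes nonimaginary eigenvalues real, simple, and
   unique for each sign.

   Let [y_x] be the solution of the Lyapunov-Schmidt problem [y_x = sin + h.o.m.],
   [E_x(y_x, q) = 0] for [q] orthogonal to [sin] and [cos]. The increasing function
   [s(x) = E_x(y_x, sin)] vanishes at the threshold [x = l_a^2], and the trial
   function [sin z + (a / 3) sin 2z] gives [s(0) = - pi a^2 / 12 + O(a^4)]. Below
   the threshold the 2 x 2 Lyapunov-Schmidt determinant, as a function of [lam],
   is negative at [0] and positive at [+- 1/8]. *)

(** * Integrals and periodic functions *)

(** The expansion of [P_a] is given only up to O(a^3), while the threshold is wanted up to O(a^4).
    The missing order comes from exact identities: the wave equation integrated over a period and
    tested with cos 2z, and the normalisation <P_a, cos> = pi a. Working with continuous functions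
    avoids the completeness of L2: [Kop] turns L2 bounds into sup bounds, so Neumann series converge
    uniformly, and L2 data enter only through their primitives. By the Poincare inequality the high
    Fourier modes form a contraction and the low ones a finite matrix, so injectivity alone yields a
    bounded inverse. For s(0) a trial function with residual O(a^2) is enough, since the energy of
    the error is quadratic in the residual. As s has slope close to pi, its zero is a^2 / 12 up to
    O(a^4). At lam = +- 1/8 the antisymmetric form puts +- lam pi off the diagonal of the 2 x 2
    matrix, hence (lam pi)^2 into the determinant; this outweighs the rest when x <= 1/16 and b is
    close to 1. *)

Section OrientedIntegral.
Context {R : realType}.
Notation mu := (@lebesgue_measure R).
Implicit Types (f g : R -> R) (a b c z : R).

(** Signed integral without a case distinction: for [a != b] one of the two intervals is empty, and
    for [a = b] the two terms cancel. *)
Definition oint a b f : R :=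
  \int[mu]_(z in `[a, b]) f z - \int[mu]_(z in `[b, a]) f z.

Definition prim f z : R := oint 0 z f.

Lemma locally_integrable_itv f a b : locally_integrable setT f ->
  mu.-integrable `[a, b] (EFin \o f).
Proof.
move=> [mf _ lf]; apply/integrableP; split.
  by apply/measurable_EFinP; apply: measurable_funTS.
exact: (lf _ (@subsetT _ _) (@segment_compact R a b)).
Qed.

Lemma continuous_locally_integrable f : continuous f ->
  locally_integrable setT f.
Proof.
move=> cf; split; [exact: continuous_measurable_fun|exact: openT|].
move=> K _ cK; have : {within K, continuous f} by apply: continuous_subspaceT.
by move/(continuous_compact_integrable cK) => /integrableP[_ /=].
Qed.

Lemma oint_le a b f : a <= b -> oint a b f = \int[mu]_(z in `[a, b]) f z.
Proof.
move=> ab; rewrite /oint; move: ab; rewrite le_eqVlt => /orP[/eqP ->|ab].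
  by rewrite set_itv1 Rintegral_set1 subr0.
by rewrite (@set_itv_ge _ _ (BLeft b)) ?Rintegral_set0 ?subr0// bnd_simp -ltNge.
Qed.

Lemma ointC a b f : oint b a f = - oint a b f.
Proof. by rewrite /oint opprB. Qed.

Let oint_chasles_le a b c f : locally_integrable setT f -> a <= b -> b <= c ->
  oint a b f + oint b c f = oint a c f.
Proof.
move=> lf ab bc; rewrite !oint_le//; last exact: le_trans bc.
have lac := locally_integrable_itv a c lf.
apply/eqP; rewrite addrC eq_sym -subr_eq (Rintegral_itvB lac)//.
rewrite Rintegral_itv_obnd_cbnd//.
apply: integrableS (locally_integrable_itv b c lf) => //.
by apply: subset_itvr; rewrite bnd_simp.
Qed.

Lemma oint_chasles a b c f : locally_integrable setT f ->
  oint a b f + oint b c f = oint a c f.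
Proof.
move=> lf.
have [ab|/ltW ba] := leP a b; have [bc|/ltW cb] := leP b c;
  have [ac|/ltW ca] := leP a c.
- exact: oint_chasles_le.
- have := oint_chasles_le lf bc ca; rewrite (ointC a b) (ointC a c); lra.
- have := oint_chasles_le lf ac cb; rewrite (ointC b c); lra.
- have := oint_chasles_le lf ca ab; rewrite (ointC b c) (ointC a c); lra.
- have := oint_chasles_le lf ba ac; rewrite (ointC b a); lra.
- have := oint_chasles_le lf bc ca; rewrite (ointC b a) (ointC a c); lra.
- have := oint_chasles_le lf ac cb; rewrite (ointC b a) (ointC b c).
  have := oint_chasles_le lf cb ba; rewrite (ointC a c); lra.
- have := oint_chasles_le lf cb ba.
  rewrite (ointC c b) (ointC b a) (ointC c a); lra.
Qed.

Lemma oint_prim a b f : locally_integrable setT f ->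
  oint a b f = prim f b - prim f a.
Proof. by move=> lf; rewrite /prim -(oint_chasles 0 a b lf); lra. Qed.

Lemma ointD a b f g : locally_integrable setT f -> locally_integrable setT g ->
  oint a b (fun z => f z + g z) = oint a b f + oint a b g.
Proof.
move=> lf lg; rewrite /oint !RintegralD//; try exact: locally_integrable_itv.
lra.
Qed.

Lemma ointZ a b c f : locally_integrable setT f ->
  oint a b (fun z => c * f z) = c * oint a b f.
Proof.
move=> lf; rewrite /oint !RintegralZl//; try exact: locally_integrable_itv.
lra.
Qed.

Lemma prim0 f : prim f 0 = 0.
Proof. by rewrite /prim /oint subrr. Qed.

Lemma is_derive_prim f z : continuous f -> is_derive z 1 (prim f) (f z).
Proof.
move=> cf; have lf := continuous_locally_integrable cf.
(* With a base point below both 0 and [z], the signed integral is an ordinary one near [z], up to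
   the constant [oint a 0 f]. *)
pose a := - `|z| - 1.
have az : a < z by rewrite /a; have := ler_norm (- z); rewrite normrN; lra.
have a0 : a < 0 by rewrite /a; have := normr_ge0 z; lra.
have z1 : z < z + 1 by rewrite ltrDl.
have [dF F'] := @continuous_FTC1_closed R f a z (z + 1) z1
  (locally_integrable_itv a (z + 1) lf) az (cf z).
have E : {near z, (fun y => \int[mu]_(t in `[a, y]) f t - oint a 0 f)
    =1 prim f}.
  near=> y.
  have ay : a <= y.
    by near: y; apply: filterS (lt_nbhsr az) => y /ltW.
  by rewrite -oint_le//= /prim -(oint_chasles a 0 y lf); lra.
have D : is_derive z 1 (fun y => \int[mu]_(t in `[a, y]) f t - oint a 0 f) (f z).
  rewrite -(subr0 (f z)); apply: is_deriveB.
  by apply: DeriveDef; [exact: dF|rewrite -derive1E].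
exact: near_eq_is_derive E D.
Unshelve. all: by end_near. Qed.

End OrientedIntegral.

(** * Translation invariance of the integral *)

Section Translation.
Context {R : realType}.
Notation mu := (@lebesgue_measure R).
Implicit Types (f g F G : R -> R) (a b c z T : R).

Lemma measurable_translate T : measurable_fun [set: measurableTypeR R]
  (fun x : measurableTypeR R => (x : R) + T : measurableTypeR R).
Proof. by apply: measurable_funD. Qed.

(** The pushforward by the translation agrees with Lebesgue measure on half-open intervals, which
    determine it. *)
Lemma lebesgue_measure_translate T (A : set R) : measurable A ->
  mu A = mu [set x | A (x + T)].
Proof.
have mT := measurable_translate T.
move=> mA; apply: (@lebesgue_measure_unique R
  (measure_function_pushforward__canonical__measure_function_Measure mu mT))
  => // X [[a b] _ <-].
have E : [set x | `]a, b]%classic (x + T)] = `](a - T), (b - T)]%classic.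
  by apply/seteqP; split=> x /=; rewrite !in_itv/= ltrBlDr lerBrDr.
change (mu `]a, b]%classic = mu [set x | `]a, b]%classic (x + T)]).
rewrite E !lebesgue_measure_itv/= !lte_fin ltrD2r.
by case: ifP => // ab; rewrite -!EFinB; congr (_%:E); lra.
Qed.

Lemma ge0_integral_translate T (f : R -> \bar R) (D : set R) :
  measurable D -> measurable_fun setT f -> (forall x, 0 <= f x)%E ->
  (\int[mu]_(x in D) f x = \int[mu]_(x in [set x | D (x + T)%R]) f (x + T)%R)%E.
Proof.
move=> mD mf f0.
have mT := measurable_translate T.
rewrite -(@ge0_integral_pushforward _ _ _ _ _ _ mT mu D f)//; last first.
  exact: measurable_funTS.
by apply: eq_measure_integral => A mA _; exact: lebesgue_measure_translate.
Qed.

Lemma itv_translate a b T :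
  [set x | `[a, b]%classic (x + T)] = `[a - T, b - T]%classic.
Proof. by apply/seteqP; split=> x /=; rewrite !in_itv/= lerBlDr lerBrDr. Qed.

Lemma locally_integrable_translate f T : locally_integrable setT f ->
  locally_integrable setT (fun x => f (x + T)).
Proof.
move=> lf; have [mf _ _] := lf.
have mT := measurable_translate T.
split; [exact: (measurableT_comp mf)|exact: openT|move=> K _ cK].
have [M [_ KM]] := compact_bounded cK.
pose N := `|M| + 1.
have KN : K `<=` `[- N, N].
  move=> x Kx; have := KM N; rewrite ltr_pwDr ?ler_norm// => /(_ isT x Kx).
  by rewrite /= in_itv/= -ler_norml.
apply: (@le_lt_trans _ _ (\int[mu]_(x in `[(- N)%R, N]) `|f (x + T)|%:E)%E).
  apply: ge0_subset_integral => //; first exact: compact_measurable.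
  apply/measurable_EFinP/measurableT_comp => //; apply: measurable_funTS.
  exact: (measurableT_comp mf).
have E : `[(- N)%R, N]%classic =
    [set x | `[(- N + T)%R, N + T]%classic (x + T)].
  by rewrite itv_translate !addrK.
rewrite E -(@ge0_integral_translate T (fun x => `|f x|%:E))//.
  by have [_ _ h] := lf; apply: h => //; exact: segment_compact.
by apply/measurable_EFinP/measurableT_comp.
Qed.

Lemma oint_translate f a b T : locally_integrable setT f ->
  oint a b (fun x => f (x + T)) = oint (a + T) (b + T) f.
Proof.
move=> lf; have [mf _ _] := lf; have lfT := locally_integrable_translate T lf.
have mT := measurable_translate T.
suff E c d : \int[mu]_(x in `[c, d]) f (x + T) =
             \int[mu]_(x in `[c + T, d + T]) f x by rewrite /oint !E.
rewrite /Rintegral; congr fine.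
have := @integral_pushforward _ _ _ _ _ _ mT mu `[c + T, d + T] (EFin \o f).
have -> : (fun x => x + T) @^-1` `[c + T, d + T] = `[c, d]%classic.
  by have := itv_translate (c + T) (d + T) T; rewrite !addrK => <-.
move=> <-//.
- by apply: eq_measure_integral => A mA _; rewrite [RHS](lebesgue_measure_translate T).
- exact/measurable_EFinP.
- exact: (locally_integrable_itv c d lfT).
Qed.

Lemma oint_periodic f a T : locally_integrable setT f -> periodic f T ->
  oint a (a + T) f = oint 0 T f.
Proof.
move=> lf pf; rewrite -(oint_chasles a 0 (a + T) lf).
rewrite -(oint_chasles 0 T (a + T) lf) [X in _ + (_ + X)](_ : _ = oint 0 a f).
  by rewrite (ointC a 0); lra.
have -> : oint 0 a f = oint 0 a (fun x => f (x + T)).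
  by rewrite /oint; congr (_ - _); apply: eq_Rintegral => x _; rewrite pf.
by rewrite oint_translate// add0r addrC.
Qed.

End Translation.

(** * Fundamental theorem and integration by parts for signed integrals *)

Section Calculus.
Context {R : realType}.
Notation mu := (@lebesgue_measure R).
Implicit Types (f g F G : R -> R) (a b c z T : R).

Lemma is_derive_continuous F f : (forall z, is_derive z 1 F (f z)) ->
  continuous F.
Proof.
move=> dF z; apply/differentiable_continuous/derivable1_diffP.
by have [] := dF z.
Qed.

Lemma prim_derive F f z : continuous f -> (forall z, is_derive z 1 F (f z)) ->
  prim f z = F z - F 0.
Proof.
move=> cf dF.
have D (x : R) : is_derive x (1 : R) (fun y => prim f y - F y) 0.
  by rewrite -(subrr (f x)); apply: is_deriveB; exact: is_derive_prim.
by have := is_derive_0_is_cst z 0 D; rewrite prim0; lra.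
Qed.

Lemma oint_derive F f a b : continuous f ->
  (forall z, is_derive z 1 F (f z)) -> oint a b f = F b - F a.
Proof.
move=> cf dF; rewrite (oint_prim _ _ (continuous_locally_integrable cf)).
by rewrite !(prim_derive _ cf dF); lra.
Qed.

Lemma oint_by_parts F G f g a b : continuous f -> continuous g ->
  (forall z, is_derive z 1 F (f z)) -> (forall z, is_derive z 1 G (g z)) ->
  oint a b (fun z => f z * G z) =
  F b * G b - F a * G a - oint a b (fun z => F z * g z).
Proof.
move=> cf cg dF dG.
have cF := is_derive_continuous dF; have cG := is_derive_continuous dG.
have cfG : continuous (fun z => f z * G z).
  by move=> z; apply: continuousM; [exact: cf|exact: cG].
have cFg : continuous (fun z => F z * g z).
  by move=> z; apply: continuousM; [exact: cF|exact: cg].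
have D (z : R) : is_derive z (1 : R) (fun z => F z * G z) (f z * G z + F z * g z).
  have := is_deriveM (dF z) (dG z).
  by rewrite /GRing.scale/= addrC (mulrC (G z)).
rewrite -(@oint_derive (fun z => F z * G z) _ a b _ D); last first.
  by move=> z; apply: cvgD; [exact: cfG|exact: cFg].
by rewrite ointD; [lra|exact: continuous_locally_integrable..].
Qed.

End Calculus.

(** * Continuous periodic functions with the L2 inner product *)

Section PeriodicFunctions.
Context (R : realType).
Implicit Types (a c z : R).

(** Made boolean by [asbool], so that the subtype [cper] inherits the vector space structure of
    [R -> R]. *)
Definition cper_pred : {pred R -> R} :=
  fun f => `[< continuous f /\ periodic f (pi *+ 2) >].

Lemma cper_submod_closed : submod_closed cper_pred.
Proof.
split; first by apply/asboolP; split=> [z|z]//; exact: cvg_cst.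
move=> c u v /asboolP[cu pu] /asboolP[cv pv]; apply/asboolP; split.
  by move=> z; apply: cvgD; [apply: cvgM; [exact: cvg_cst|exact: cu]|exact: cv].
by move=> z; rewrite /= !fctE pu pv.
Qed.

HB.instance Definition _ :=
  GRing.isSubmodClosed.Build R (R -> R) cper_pred cper_submod_closed.

Record cper := Cper { cper_val :> R -> R; cper_valP : cper_val \in cper_pred }.

HB.instance Definition _ := [isSub for cper_val].
HB.instance Definition _ := [Choice of cper by <:].
HB.instance Definition _ := [SubChoice_isSubLmodule of cper by <:].

Definition mkcper (f : R -> R) (cf : continuous f)
  (pf : periodic f (pi *+ 2)) : cper := Cper (introT (asboolP _) (conj cf pf)).

Implicit Types u v w : cper.

Lemma cper_continuous u : continuous u.
Proof. by have /asboolP[] := cper_valP u. Qed.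

Lemma cper_periodic u : periodic u (pi *+ 2).
Proof. by have /asboolP[] := cper_valP u. Qed.

Lemma cper_locint u : locally_integrable setT u.
Proof. exact/continuous_locally_integrable/cper_continuous. Qed.

Lemma cperP u v : (forall z, u z = v z) -> u = v.
Proof. by move=> uv; apply: val_inj; apply/funext. Qed.

Lemma cperD u v z : (u + v) z = u z + v z. Proof. by []. Qed.
Lemma cperN u z : (- u) z = - u z. Proof. by []. Qed.
Lemma cperB u v z : (u - v) z = u z - v z. Proof. by []. Qed.
Lemma cperZ c u z : (c *: u) z = c * u z. Proof. by []. Qed.
Lemma cper0 z : (0 : cper) z = 0. Proof. by []. Qed.
Definition cperE := (cperD, cperN, cperB, cperZ, cper0).

Lemma cper_sum (I : Type) (r : seq I) (Q : pred I) (F : I -> cper) z :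
  (\sum_(i <- r | Q i) F i) z = \sum_(i <- r | Q i) F i z.
Proof.
apply: (big_morph (fun u : cper => u z)) => // u v.
Qed.

Lemma continuous_mul (f g : R -> R) : continuous f -> continuous g ->
  continuous (fun z => f z * g z).
Proof. by move=> cf cg z; apply: cvgM; [exact: cf|exact: cg]. Qed.

Lemma cmul_periodic u v : periodic (fun z => u z * v z) (pi *+ 2).
Proof. by move=> z; rewrite !cper_periodic. Qed.

Definition cmul u v : cper :=
  mkcper (continuous_mul (@cper_continuous u) (@cper_continuous v))
    (cmul_periodic u v).

Lemma cmulE u v z : cmul u v z = u z * v z. Proof. by []. Qed.

Lemma cmul_is_linear b : linear (cmul b).
Proof. by move=> c u v; apply: cperP => z; rewrite !(cmulE, cperE); ring. Qed.

HB.instance Definition _ b :=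
  GRing.isLinear.Build R cper cper *:%R (cmul b) (cmul_is_linear b).

Definition ccst c : cper.
Proof. by apply: (@mkcper (fun=> c)) => // z; exact: cvg_cst. Defined.

Lemma ccstE c z : ccst c z = c. Proof. by []. Qed.

Definition itau : cper -> R := locked (fun u => oint 0 (pi *+ 2) u).

Lemma itauE u : itau u = oint 0 (pi *+ 2) u.
Proof. by rewrite /itau -lock. Qed.

Lemma itau_is_linear : linear_for *%R itau.
Proof.
move=> c u v; rewrite !itauE -ointZ; last exact: cper_locint.
by rewrite -ointD//; [exact: cper_locint (c *: u)|exact: cper_locint].
Qed.

HB.instance Definition _ :=
  GRing.isLinear.Build R cper R *%R itau itau_is_linear.

Lemma tau_gt0 : 0 < pi *+ 2 :> R. Proof. by rewrite mulrn_wgt0// pi_gt0. Qed.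
Lemma tau_neq0 : pi *+ 2 != 0 :> R. Proof. exact: lt0r_neq0 tau_gt0. Qed.

Lemma itau_cst c : itau (ccst c) = c * (pi *+ 2).
Proof.
rewrite itauE oint_le ?(ltW tau_gt0)// Rintegral_cst//= lebesgue_measure_itv/=.
by rewrite lte_fin tau_gt0 sube0.
Qed.

Lemma itau_ge0 u : (forall z, 0 <= u z) -> 0 <= itau u.
Proof. by move=> u0; rewrite itauE oint_le ?(ltW tau_gt0)// Rintegral_ge0. Qed.

Lemma itau_le u v : (forall z, u z <= v z) -> itau u <= itau v.
Proof.
move=> uv; rewrite -subr_ge0 -raddfB; apply: itau_ge0 => z.
by rewrite cperE subr_ge0.
Qed.

(** The primitive is nondecreasing and takes the same value at [z - pi] and [z + pi], so it is
    constant near [z] and its derivative [u z] vanishes. *)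
Lemma itau_eq0 u : (forall z, 0 <= u z) -> itau u = 0 -> u = 0.
Proof.
rewrite itauE => u0 Iu; apply: cperP => z; rewrite cper0.
have pi0 := pi_gt0 R.
have lu := cper_locint u; have cu := @cper_continuous u.
have mono a b : a <= b -> prim u a <= prim u b.
  by move=> ab; rewrite -subr_ge0 -oint_prim// oint_le// Rintegral_ge0.
have E : prim u (z + pi) = prim u (z - pi).
  apply/eqP; rewrite -subr_eq0 -oint_prim//.
  have -> : z + pi = z - pi + pi *+ 2 by rewrite mulr2n; lra.
  by rewrite oint_periodic//; [exact/eqP|exact: cper_periodic].
have D0 : is_derive z 1 (prim u) 0.
  have Dc : is_derive z (1 : R) (fun=> prim u z) 0 by exact: is_derive_cst.
  apply: near_eq_is_derive Dc; near=> y.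
  have /ltW y1 : z - pi < y by near: y; apply: lt_nbhsr; lra.
  have /ltW y2 : y < z + pi by near: y; apply: lt_nbhsl; lra.
  have := mono _ _ y1; have := mono _ _ y2.
  have : prim u (z - pi) <= prim u z by apply: mono; lra.
  have : prim u z <= prim u (z + pi) by apply: mono; lra.
  by rewrite E => *; apply/eqP; rewrite eq_le; apply/andP; split; lra.
have D1 := is_derive_prim z cu.
by rewrite -(@derive_val _ _ _ _ _ _ _ D1) (@derive_val _ _ _ _ _ _ _ D0).
Unshelve. all: by end_near. Qed.

Definition dot u v : R := itau (cmul u v).

Lemma dotC u v : dot u v = dot v u.
Proof. by congr itau; apply: cperP => z; rewrite !cmulE mulrC. Qed.

Lemma dot_is_linear u : linear_for *%R (dot u).
Proof. by move=> c v w; rewrite /dot linearP linearP. Qed.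

HB.instance Definition _ u :=
  GRing.isLinear.Build R cper R *%R (dot u) (dot_is_linear u).

Lemma dotDl u v w : dot (u + v) w = dot u w + dot v w.
Proof. by rewrite dotC linearD /= !(dotC w). Qed.
Lemma dotBl u v w : dot (u - v) w = dot u w - dot v w.
Proof. by rewrite dotC linearB /= !(dotC w). Qed.
Lemma dotNl u w : dot (- u) w = - dot u w.
Proof. by rewrite dotC linearN /= !(dotC w). Qed.
Lemma dotZl c u w : dot (c *: u) w = c * dot u w.
Proof. by rewrite dotC linearZ /= !(dotC w). Qed.
Lemma dot0l w : dot 0 w = 0.
Proof. by rewrite dotC linear0. Qed.
Lemma dotDr w u v : dot w (u + v) = dot w u + dot w v.
Proof. exact: linearD. Qed.
Lemma dotBr w u v : dot w (u - v) = dot w u - dot w v.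
Proof. exact: linearB. Qed.
Lemma dotNr w u : dot w (- u) = - dot w u.
Proof. exact: linearN. Qed.
Lemma dotZr c w u : dot w (c *: u) = c * dot w u.
Proof. exact: linearZ. Qed.
Lemma dot0r w : dot w 0 = 0.
Proof. exact: linear0. Qed.
Definition dotE := (dotDl, dotDr, dotBl, dotBr, dotNl, dotNr, dotZl, dotZr,
  dot0l, dot0r).

Lemma dot_ge0 u : 0 <= dot u u.
Proof. by apply: itau_ge0 => z; rewrite cmulE -expr2 sqr_ge0. Qed.

Lemma dot_eq0 u : dot u u = 0 -> u = 0.
Proof.
move=> /itau_eq0 => E; apply: cperP => z; rewrite cper0.
have /E : forall z, 0 <= cmul u u z by move=> x; rewrite cmulE -expr2 sqr_ge0.
move=> /(congr1 (fun w : cper => w z)); rewrite cmulE cper0 => /eqP.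
by rewrite mulf_eq0 orbb => /eqP.
Qed.

Lemma dot_cmul (b u v : cper) : dot (cmul b u) v = dot u (cmul b v).
Proof. by congr itau; apply: cperP => z; rewrite !cmulE; ring. Qed.

Definition nrm u : R := Num.sqrt (dot u u).

Lemma nrm_ge0 u : 0 <= nrm u. Proof. exact: sqrtr_ge0. Qed.
Lemma nrm_sqr u : nrm u ^+ 2 = dot u u.
Proof. by rewrite sqr_sqrtr// dot_ge0. Qed.

Lemma nrm_eq0 u : nrm u = 0 -> u = 0.
Proof. by move=> u0; apply: dot_eq0; rewrite -nrm_sqr u0 expr0n. Qed.

Lemma cauchy_schwarz u v : `|dot u v| <= nrm u * nrm v.
Proof.
have [u0|u0] := eqVneq (nrm u) 0.
  by rewrite (nrm_eq0 u0) dot0l normr0 mulr_ge0// nrm_ge0.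
rewrite -(ler_pXn2r (n := 2)) ?nnegrE ?mulr_ge0 ?nrm_ge0//.
rewrite real_normK ?num_real// exprMn !nrm_sqr.
have d0 : 0 < dot u u by rewrite -nrm_sqr exprn_gt0// lt_neqAle eq_sym u0 nrm_ge0.
have := dot_ge0 (dot u u *: v - dot u v *: u).
rewrite !dotE (dotC v u) => H.
rewrite -subr_ge0 -(pmulr_rge0 _ d0); apply: le_trans H _.
by rewrite le_eqVlt; apply/orP; left; apply/eqP; ring.
Qed.

Lemma dot_le u v : dot u v <= nrm u * nrm v.
Proof. exact: le_trans (ler_norm _) (cauchy_schwarz u v). Qed.

Lemma nrmZ c u : nrm (c *: u) = `|c| * nrm u.
Proof. by rewrite /nrm !dotE mulrA -expr2 sqrtrM ?sqr_ge0// sqrtr_sqr. Qed.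

Lemma nrmN u : nrm (- u) = nrm u.
Proof. by rewrite /nrm !dotE opprK. Qed.

Lemma nrmD u v : nrm (u + v) <= nrm u + nrm v.
Proof.
rewrite -(ler_pXn2r (n := 2)) ?nnegrE ?addr_ge0 ?nrm_ge0//.
rewrite nrm_sqr !dotE sqrrD !nrm_sqr (dotC v u).
by have := dot_le u v; rewrite mulr2n; lra.
Qed.

Lemma nrmB u v : nrm (u - v) <= nrm u + nrm v.
Proof. by rewrite -[nrm v]nrmN; exact: nrmD. Qed.

Lemma nrm0 : nrm 0 = 0. Proof. by rewrite /nrm dot0l sqrtr0. Qed.

Lemma dot_le_sup u M : (forall z, `|u z| <= M) -> dot u u <= M ^+ 2 * (pi *+ 2).
Proof.
move=> uM; rewrite -itau_cst; apply: itau_le => z; rewrite cmulE ccstE -expr2.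
by rewrite -real_normK ?num_real// lerXn2r ?nnegrE// (le_trans _ (uM z)).
Qed.

Lemma nrm_le_sup u M : (forall z, `|u z| <= M) ->
  nrm u <= M * Num.sqrt (pi *+ 2).
Proof.
move=> uM; have M0 : 0 <= M by exact: le_trans (uM 0).
rewrite -(ler_pXn2r (n := 2)) ?nnegrE ?mulr_ge0 ?nrm_ge0 ?sqrtr_ge0//.
by rewrite nrm_sqr exprMn sqr_sqrtr ?(ltW tau_gt0)// dot_le_sup.
Qed.

Lemma nrm_cmul (b : cper) u M : (forall z, `|b z| <= M) -> nrm (cmul b u) <= M * nrm u.
Proof.
move=> bM; have M0 : 0 <= M by exact: le_trans (bM 0).
rewrite -(ler_pXn2r (n := 2)) ?nnegrE ?mulr_ge0 ?nrm_ge0//.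
rewrite exprMn !nrm_sqr /dot -linearZ; apply: itau_le => z.
rewrite cperE !cmulE; have := bM z; rewrite -(ler_pXn2r (n := 2)) ?nnegrE//.
rewrite real_normK ?num_real// => /(ler_wpM2r (sqr_ge0 (u z))).
by apply: le_trans; rewrite le_eqVlt; apply/orP; left; apply/eqP; ring.
Qed.

End PeriodicFunctions.

(** * The mean-free primitive *)

Section Primitive.
Context {R : realType}.
Implicit Types (a c z : R) (u v w : cper R).
Local Notation tau := (pi *+ 2 : R).

Definition mean u : R := itau u / tau.
Definition center u : cper R := u - ccst (mean u).

Lemma itau_center u : itau (center u) = 0.
Proof. by rewrite /center linearB /= itau_cst /mean divfK ?tau_neq0// subrr. Qed.

Lemma mean_is_linear : linear_for *%R mean.
Proof. by move=> c u v; rewrite /mean linearP /= mulrDl mulrA. Qed.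
HB.instance Definition _ :=
  GRing.isLinear.Build R (cper R) R *%R mean mean_is_linear.

Lemma center_is_linear : linear center.
Proof.
move=> c u v; rewrite /center linearP /=; apply: cperP => z.
by rewrite !(cperE, ccstE); ring.
Qed.
HB.instance Definition _ :=
  GRing.isLinear.Build R (cper R) (cper R) *:%R center center_is_linear.

Lemma center_id u : itau u = 0 -> center u = u.
Proof.
move=> u0; rewrite /center /mean u0 mul0r; apply: cperP => z.
by rewrite !(cperE, ccstE) subr0.
Qed.

Lemma center_cst c : center (ccst c) = 0.
Proof.
apply: cperP => z; rewrite /center /mean itau_cst mulfK ?tau_neq0//.
by rewrite !cperE subrr.
Qed.

Lemma prim_continuous u : continuous (prim u).
Proof.
apply: (@is_derive_continuous R _ u) => z.
exact: is_derive_prim (@cper_continuous _ u).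
Qed.

Lemma prim_center_periodic u : periodic (prim (center u)) tau.
Proof.
move=> z; apply/eqP; rewrite -subr_eq0 -oint_prim ?oint_periodic//;
  [apply/eqP; rewrite -itauE; exact: itau_center|exact: cper_locint|exact: cper_periodic
  |exact: cper_locint].
Qed.

(** Centring the argument first makes [Kop] a total linear map; on functions of mean zero it is the
    inverse of d/dz. *)
Definition Kop : cper R -> cper R := locked (fun u =>
  center (mkcper (prim_continuous (u := center u)) (prim_center_periodic u))).

Lemma KopE u : Kop u =
  center (mkcper (prim_continuous (u := center u)) (prim_center_periodic u)).
Proof. by rewrite /Kop -lock. Qed.

Lemma Kop_derive u z : is_derive z 1 (Kop u) (center u z).
Proof.
have D := is_derive_prim z (@cper_continuous _ (center u)).
set F := mkcper (prim_continuous (u := center u)) (prim_center_periodic u).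
have D2 : is_derive z (1 : R) (fun=> mean F) 0 by exact: is_derive_cst.
by have := is_deriveB D D2; rewrite subr0 KopE.
Qed.

Lemma itau_Kop u : itau (Kop u) = 0.
Proof. by rewrite KopE itau_center. Qed.

Lemma center_eq u v z0 : (forall z, u z - v z = z0) -> center u = center v.
Proof.
move=> uv; have -> : u = v + ccst z0.
  by apply: cperP => z; rewrite !(cperE, ccstE) -(uv z); ring.
by rewrite linearD /= center_cst addr0.
Qed.

Lemma Kop_unique (F f : cper R) : (forall z, is_derive z 1 F (f z)) ->
  Kop f = center F.
Proof.
move=> dF; have cf := @cper_continuous _ f.
have f0 : itau f = 0.
  rewrite itauE (oint_derive _ _ cf dF).
  by rewrite -[X in F X]add0r cper_periodic subrr.
rewrite KopE; apply: (center_eq (z0 := - F 0)) => z.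
change (prim (center f) z - F z = - F 0); rewrite center_id// (prim_derive z cf dF).
ring.
Qed.

Lemma Kop_center u : Kop (center u) = Kop u.
Proof.
rewrite !KopE; congr center; apply: val_inj.
change (prim (center (center u)) = prim (center u) :> (R -> R)).
by rewrite (center_id (itau_center u)).
Qed.

Lemma Kop_is_linear : linear Kop.
Proof.
move=> c u v; rewrite -Kop_center linearP.
have dF z : is_derive z (1 : R) (c *: Kop u + Kop v : cper R)
    ((c *: center u + center v : cper R) z).
  exact: is_deriveD (is_deriveZ c (Kop_derive u z)) (Kop_derive v z).
have E := @Kop_unique (c *: Kop u + Kop v) (c *: center u + center v) dF.
rewrite [LHS]E center_id// linearP.
by rewrite /= !itau_Kop mulr0 addr0.
Qed.
HB.instance Definition _ :=
  GRing.isLinear.Build R (cper R) (cper R) *:%R Kop Kop_is_linear.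

Lemma Kop_eq0 u : Kop u = 0 -> center u = 0.
Proof.
move=> K0; apply: cperP => z; have := Kop_derive u z; rewrite K0 => D.
have D0 : is_derive z (1 : R) (fun=> 0 : R) 0 by exact: is_derive_cst.
by rewrite -(@derive_val _ _ _ _ _ _ _ D) (@derive_val _ _ _ _ _ _ _ D0).
Qed.

Lemma dot_cst u c : dot u (ccst c) = c * itau u.
Proof.
by rewrite /dot -linearZ; congr itau; apply: cperP => z; rewrite cmulE cperE mulrC.
Qed.

(** Integration by parts over a period; centring the other factor changes nothing because [Kop] has
    mean zero. *)
Lemma Kop_skew u v : dot (Kop u) v = - dot u (Kop v).
Proof.
have E w x : dot (center w) (Kop x) = dot w (Kop x).
  rewrite /center dotBl (dotC (ccst _)) dot_cst itau_Kop mulr0 subr0 //.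
rewrite (dotC (Kop u)) -[LHS]E -[in RHS](E u v) /dot !itauE.
have := @oint_by_parts R (Kop v) (Kop u) (center v) (center u) 0 tau
  (@cper_continuous _ _) (@cper_continuous _ _) (Kop_derive v) (Kop_derive u).
have := cper_periodic (Kop v) 0; have := cper_periodic (Kop u) 0.
rewrite !add0r => -> -> H; rewrite [LHS]H subrr sub0r; congr (- _).
by congr oint; apply/funext => z; rewrite cmulE mulrC.
Qed.

Lemma dot_Kop2 u v : dot (Kop (Kop u)) v = dot u (Kop (Kop v)).
Proof. by rewrite !Kop_skew opprK. Qed.

Lemma dot_Kop_self u : dot (Kop u) u = 0.
Proof. by have := Kop_skew u u; rewrite (dotC u); lra. Qed.

(** Over one period starting at [z] all values of [G] lie within [B] of [G z], and their mean is
    zero. The density [f] is only locally integrable, since the bound also serves for primitives of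
    L2 functions. *)
Lemma zero_mean_bound (G : cper R) (f : R -> R) : locally_integrable setT f ->
  periodic f tau -> (forall y z, G z - G y = oint y z f) -> itau G = 0 ->
  forall z, `|G z| <= oint 0 tau (fun x => `|f x|).
Proof.
move=> lf pf Gf G0 z; set B := oint _ _ _.
have lnf : locally_integrable setT (fun x => `|f x|).
  have [mf _ hf] := lf; split; [exact: measurableT_comp|exact: openT|].
  by move=> K KT cK; under eq_integral do rewrite normr_id; exact: hf.
have pnf : periodic (fun x => `|f x|) tau by move=> x; rewrite pf.
have EB : B = oint z (z + tau) (fun x => `|f x|) by rewrite oint_periodic.
have tau0 := tau_gt0 R.
have zt : z <= z + tau by rewrite lerDl ltW.
have GB y : z <= y <= z + tau -> `|G y - G z| <= B.
  move=> /andP[zy yt]; rewrite Gf oint_le// EB -(oint_chasles z y _ lnf).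
  rewrite !oint_le//; apply: (le_trans (le_normr_Rintegral _ _)) => //.
    exact: locally_integrable_itv.
  by rewrite lerDl Rintegral_ge0.
have IG : \int[lebesgue_measure]_(x in `[z, z + tau]) G x = 0.
  rewrite -oint_le// oint_periodic//; [by rewrite -itauE|exact: cper_locint|exact: cper_periodic].
have Icst c : \int[lebesgue_measure]_(x in `[z, z + tau]) c = c * tau.
  rewrite Rintegral_cst//= lebesgue_measure_itv/= lte_fin ltrDl tau0.
  by rewrite -EFinB /= addrAC subrr add0r.
have lc c : lebesgue_measure.-integrable `[z, z + tau] (EFin \o cst c).
  by apply/locally_integrable_itv/continuous_locally_integrable => x; exact: cvg_cst.
have lG := locally_integrable_itv z (z + tau) (cper_locint G).
rewrite ler_norml; apply/andP; split.
- have : \int[lebesgue_measure]_(x in `[z, z + tau]) (G x) <=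
    \int[lebesgue_measure]_(x in `[z, z + tau]) (G z + B).
    apply: (le_Rintegral _ lG (lc (G z + B))) => // x; rewrite /= in_itv/= => /GB.
    by rewrite ler_norml => /andP[]; lra.
  by rewrite IG Icst pmulr_lge0//; lra.
- have : \int[lebesgue_measure]_(x in `[z, z + tau]) (G z - B) <=
    \int[lebesgue_measure]_(x in `[z, z + tau]) (G x).
    apply: (le_Rintegral _ (lc (G z - B)) lG) => // x; rewrite /= in_itv/= => /GB.
    by rewrite ler_norml => /andP[]; lra.
  by rewrite IG Icst pmulr_lle0//; lra.
Qed.

Definition cabs u : cper R.
Proof.
apply: (@mkcper _ (fun z => `|u z|)) => z; last by rewrite cper_periodic.
by apply: continuous_comp; [exact: cper_continuous|exact: norm_continuous].
Defined.

Lemma nrm_cabs u : nrm (cabs u) = nrm u.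
Proof.
by congr (Num.sqrt (itau _)); apply: cperP => z; rewrite !cmulE /= -normrM ger0_norm // -expr2 sqr_ge0.
Qed.

Lemma nrm_center u : nrm (center u) <= nrm u.
Proof.
rewrite -(ler_pXn2r (n := 2)) ?nnegrE ?nrm_ge0// !nrm_sqr.
have -> : dot (center u) (center u) = dot (center u) u.
  by rewrite {2}/center dotBr dot_cst itau_center mulr0 subr0.
rewrite {1}/center dotBl gerDl oppr_le0 (dotC (ccst _)) dot_cst /mean mulrAC.
by rewrite -expr2 divr_ge0 ?sqr_ge0// ltW// tau_gt0.
Qed.

Lemma nrm_cst1 : nrm (ccst (1 : R)) = Num.sqrt tau.
Proof. by rewrite /nrm dot_cst itau_cst !mul1r. Qed.

(** Smoothing from the L2 norm to the sup norm; it allows limits to be taken inside [cper]. *)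
Lemma Kop_sup u z : `|Kop u z| <= Num.sqrt tau * nrm u.
Proof.
have H := @zero_mean_bound (Kop u) (center u) (cper_locint _)
  (@cper_periodic _ _) _ (itau_Kop u) z.
apply: le_trans (H _) _ => {H}.
  move=> y x; rewrite (oint_derive y x (@cper_continuous _ _) (Kop_derive u)) //.
have -> : oint 0 tau (fun x => `|center u x|) = dot (cabs (center u)) (ccst 1).
  by rewrite dot_cst mul1r itauE.
apply: le_trans (dot_le _ _) _; rewrite nrm_cst1 nrm_cabs mulrC.
by rewrite ler_wpM2l ?sqrtr_ge0// nrm_center.
Qed.

End Primitive.

(** * Fourier modes and the Poincaré inequality *)

Section TrigonometricModes.
Context {R : realType}.
Implicit Types (a c z : R) (u v w : cper R) (n m N M : nat).
Local Notation tau := (pi *+ 2 : R).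

Lemma is_derive_cosn n z :
  is_derive z 1 (fun x : R => cos (n%:R * x)) (- (n%:R * sin (n%:R * z))).
Proof.
have D : is_derive z (1 : R) (fun x : R => n%:R * x) n%:R.
  by have := is_deriveZ n%:R (is_derive_id z (1 : R)); rewrite /GRing.scale/= mulr1.
have := is_derive1_comp (is_derive_cos (n%:R * z)) D.
by rewrite mulNr mulrC.
Qed.

Lemma is_derive_sinn n z :
  is_derive z 1 (fun x : R => sin (n%:R * x)) (n%:R * cos (n%:R * z)).
Proof.
have D : is_derive z (1 : R) (fun x : R => n%:R * x) n%:R.
  by have := is_deriveZ n%:R (is_derive_id z (1 : R)); rewrite /GRing.scale/= mulr1.
have := is_derive1_comp (is_derive_sin (n%:R * z)) D.
by rewrite mulrC.
Qed.

Lemma cosn_periodic n : periodic (fun x : R => cos (n%:R * x)) tau.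
Proof.
move=> z; rewrite mulrDr [X in cos (_ + X)]mulr_natl periodicn//.
exact: cosD2pi.
Qed.

Lemma sinn_periodic n : periodic (fun x : R => sin (n%:R * x)) tau.
Proof.
move=> z; rewrite mulrDr [X in sin (_ + X)]mulr_natl periodicn//.
exact: sinD2pi.
Qed.

Definition cosn n : cper R :=
  mkcper (is_derive_continuous (is_derive_cosn n)) (cosn_periodic n).
Definition sinn n : cper R :=
  mkcper (is_derive_continuous (is_derive_sinn n)) (sinn_periodic n).

Lemma cosnE n z : cosn n z = cos (n%:R * z). Proof. by []. Qed.
Lemma sinnE n z : sinn n z = sin (n%:R * z). Proof. by []. Qed.

Lemma itau_derive (F f : cper R) : (forall z, is_derive z 1 F (f z)) ->
  itau f = 0.
Proof.
move=> dF; rewrite itauE (oint_derive _ _ (@cper_continuous _ f) dF).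
by rewrite -[X in F X]add0r cper_periodic subrr.
Qed.

Let d_sinn n z : is_derive z 1 (n.+1%:R^-1 *: sinn n.+1 : cper R) (cosn n.+1 z).
Proof.
have := is_deriveZ n.+1%:R^-1 (is_derive_sinn n.+1 z).
by rewrite /GRing.scale/= mulrA mulVf ?mul1r// pnatr_eq0.
Qed.

Let d_cosn n z : is_derive z 1 (- n.+1%:R^-1 *: cosn n.+1 : cper R) (sinn n.+1 z).
Proof.
have := is_deriveZ (- n.+1%:R^-1) (is_derive_cosn n.+1 z).
by rewrite /GRing.scale/= mulrNN mulrA mulVf ?mul1r// pnatr_eq0.
Qed.

Lemma itau_cosn n : itau (cosn n.+1) = 0.
Proof. exact: itau_derive (d_sinn n). Qed.
Lemma itau_sinn n : itau (sinn n.+1) = 0.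
Proof. exact: itau_derive (d_cosn n). Qed.

Lemma Kop_cosn n : Kop (cosn n.+1) = n.+1%:R^-1 *: sinn n.+1.
Proof.
rewrite (Kop_unique (d_sinn n)) center_id//.
by rewrite linearZ /= itau_sinn mulr0.
Qed.

Lemma Kop_sinn n : Kop (sinn n.+1) = - n.+1%:R^-1 *: cosn n.+1.
Proof.
rewrite (Kop_unique (d_cosn n)) center_id//.
by rewrite linearZ /= itau_cosn mulr0.
Qed.

Let n1 n : n.+1%:R != 0 :> R. Proof. by rewrite pnatr_eq0. Qed.

Let K2_cosn n : Kop (Kop (cosn n.+1)) = - (n.+1%:R^-1 ^+ 2) *: cosn n.+1.
Proof.
by rewrite Kop_cosn linearZ /= Kop_sinn scalerA mulrN -expr2.
Qed.

Let K2_sinn n : Kop (Kop (sinn n.+1)) = - (n.+1%:R^-1 ^+ 2) *: sinn n.+1.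
Proof.
by rewrite Kop_sinn linearZ /= Kop_cosn scalerA mulNr -expr2.
Qed.

(** Eigenfunctions of the symmetric operator [Kop^2] for distinct eigenvalues are orthogonal, so no
    trigonometric integral has to be computed. *)
Let eig_ortho (x y : cper R) n m :
  Kop (Kop x) = - (n.+1%:R^-1 ^+ 2) *: x ->
  Kop (Kop y) = - (m.+1%:R^-1 ^+ 2) *: y -> n != m -> dot x y = 0.
Proof.
move=> hx hy nm; have := dot_Kop2 x y; rewrite hx hy !dotE => /eqP.
rewrite -subr_eq0 -mulrBl mulf_eq0 => /orP[|/eqP//].
rewrite opprK addrC subr_sqr mulf_eq0 subr_eq0 => /orP[/eqP/invr_inj/eqP|].
  by rewrite eqr_nat eqSS eq_sym (negbTE nm).
by rewrite gt_eqF// addr_gt0// invr_gt0 ltr0n.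
Qed.

Lemma dot_cosn_sinn n m : dot (cosn n.+1) (sinn m.+1) = 0.
Proof.
have [<-|nm] := eqVneq n m; last exact: eig_ortho (K2_cosn n) (K2_sinn m) nm.
have := dot_Kop_self (cosn n.+1); rewrite Kop_cosn dotZl => /eqP.
by rewrite mulf_eq0 invr_eq0 (negbTE (n1 n))/= dotC => /eqP.
Qed.

Lemma dot_sinn_cosn n m : dot (sinn n.+1) (cosn m.+1) = 0.
Proof. by rewrite dotC dot_cosn_sinn. Qed.

(** [Kop] turns the sine into a multiple of the cosine and skewness moves it across. Together with
    cos^2 + sin^2 = 1 this gives both norms. *)
Let dot_eq_cs n : dot (cosn n.+1) (cosn n.+1) = dot (sinn n.+1) (sinn n.+1).
Proof.
have -> : cosn n.+1 = - n.+1%:R *: Kop (sinn n.+1).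
  by rewrite Kop_sinn scalerA mulrNN mulfV// scale1r.
rewrite dotZl dotZr Kop_skew K2_sinn dotZr.
by have := n1 n; move=> h; field.
Qed.

Let dot_cs n : dot (cosn n.+1) (cosn n.+1) + dot (sinn n.+1) (sinn n.+1) = tau.
Proof.
rewrite -[RHS]mul1r -itau_cst /dot -linearD /=; congr itau; apply: cperP => z.
by rewrite cperD !cmulE !cosnE !sinnE ccstE -!expr2 cos2Dsin2.
Qed.

Lemma dot_cosn_cosn n m : dot (cosn n.+1) (cosn m.+1) = if n == m then pi else 0.
Proof.
case: eqVneq => [<-|nm]; last exact: eig_ortho (K2_cosn n) (K2_cosn m) nm.
by have := dot_cs n; rewrite -dot_eq_cs mulr2n; lra.
Qed.

Lemma dot_sinn_sinn n m : dot (sinn n.+1) (sinn m.+1) = if n == m then pi else 0.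
Proof.
case: eqVneq => [<-|nm]; last exact: eig_ortho (K2_sinn n) (K2_sinn m) nm.
by have := dot_cs n; rewrite dot_eq_cs mulr2n; lra.
Qed.

Let pi0 : pi != 0 :> R. Proof. exact: lt0r_neq0 (pi_gt0 R). Qed.

(** Orthogonal projection onto frequency [n.+1]; constants are left out, so [proj N] below covers
    the frequencies 1 to [N]. *)
Definition mode n u : cper R := (dot u (cosn n.+1) / pi) *: cosn n.+1 +
  (dot u (sinn n.+1) / pi) *: sinn n.+1.

Lemma mode_is_linear n : linear (mode n).
Proof.
move=> c u v; apply: cperP => z; rewrite /mode !dotE !cperE; ring.
Qed.
HB.instance Definition _ n :=
  GRing.isLinear.Build R (cper R) (cper R) *:%R (mode n) (mode_is_linear n).

Lemma dot_mode n u v : dot (mode n u) v = dot u (mode n v).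
Proof. by rewrite /mode !dotE (dotC (cosn _)) (dotC (sinn _)); ring. Qed.

Lemma mode_mode n m u : mode n (mode m u) = if n == m then mode m u else 0.
Proof.
rewrite /mode !dotE !dot_cosn_cosn !dot_sinn_sinn dot_cosn_sinn dot_sinn_cosn.
rewrite (eq_sym m); case: eqVneq => [->|_].
  by rewrite !mulr0 add0r addr0 !divfK.
by rewrite !mulr0 !addr0 !mul0r !scale0r addr0.
Qed.

Lemma Kop_mode n u : Kop (mode n u) = mode n (Kop u).
Proof.
rewrite /mode linearD !linearZ /= !Kop_skew Kop_cosn Kop_sinn !dotE.
by apply: cperP => z; rewrite !cperE; ring.
Qed.

Lemma dot_mode_self n u :
  dot (mode n u) u = (dot u (cosn n.+1) ^+ 2 + dot u (sinn n.+1) ^+ 2) / pi.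
Proof. by rewrite /mode !dotE !(dotC _ u); ring. Qed.

Lemma dot_mode_ge0 n u : 0 <= dot (mode n u) u.
Proof. by rewrite dot_mode_self divr_ge0 ?pi_ge0// addr_ge0 ?sqr_ge0. Qed.

Lemma dot_mode_Kop n u :
  dot (mode n (Kop u)) (Kop u) = n.+1%:R^-1 ^+ 2 * dot (mode n u) u.
Proof. by rewrite !dot_mode_self !Kop_skew Kop_cosn Kop_sinn !dotE; ring. Qed.

Definition proj N u : cper R := \sum_(n < N) mode n u.

Lemma projS N u : proj N.+1 u = proj N u + mode N u.
Proof. exact: big_ord_recr. Qed.

Lemma proj0 u : proj 0 u = 0. Proof. exact: big_ord0. Qed.

Lemma proj_is_linear N : linear (proj N).
Proof.
move=> c u v; elim: N => [|N IH]; first by rewrite !proj0 scaler0 addr0.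
by rewrite !projS IH linearP scalerDr addrACA.
Qed.
HB.instance Definition _ N :=
  GRing.isLinear.Build R (cper R) (cper R) *:%R (proj N) (proj_is_linear N).

Lemma dot_proj N u v : dot (proj N u) v = dot u (proj N v).
Proof.
elim: N => [|N IH]; first by rewrite !proj0 dot0l dot0r.
by rewrite !projS dotDl dotDr IH dot_mode.
Qed.

Lemma proj_mode N m u : proj N (mode m u) = if (m < N)%N then mode m u else 0.
Proof.
elim: N => [|N IH]; first by rewrite proj0.
have -> : (m < N.+1)%N = (m == N) || (m < N)%N by rewrite ltnS leq_eqVlt.
rewrite projS IH mode_mode (eq_sym m N).
case: eqVneq => [->|_] /=; first by rewrite ltnn add0r.
by rewrite addr0.
Qed.

Lemma proj_proj N M u : (M <= N)%N -> proj N (proj M u) = proj M u.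
Proof.
elim: M => [|M IH] MN; first by rewrite proj0 linear0.
by rewrite projS linearD /= IH ?(ltnW MN)// proj_mode MN.
Qed.

Lemma Kop_proj N u : Kop (proj N u) = proj N (Kop u).
Proof.
elim: N => [|N IH]; first by rewrite !proj0 linear0.
by rewrite !projS linearD /= IH Kop_mode.
Qed.

Lemma dot_proj_self N u : dot (proj N u) (proj N u) = dot (proj N u) u.
Proof. by rewrite -dot_proj proj_proj. Qed.

Lemma bessel N u : dot (proj N u) u <= dot u u.
Proof.
have := dot_ge0 (u - proj N u); rewrite !dotE dot_proj_self (dotC u); lra.
Qed.

Lemma nrm_subproj N u : nrm (u - proj N u) <= nrm u.
Proof.
rewrite -(ler_pXn2r (n := 2)) ?nnegrE ?nrm_ge0// !nrm_sqr.
rewrite !dotE dot_proj_self (dotC u).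
by have := dot_ge0 (proj N u); rewrite dot_proj_self; lra.
Qed.

Lemma dot_projB N M u : (M <= N)%N ->
  dot (proj N u - proj M u) (proj N u - proj M u) =
  dot (proj N u) u - dot (proj M u) u.
Proof.
move=> MN; rewrite !dotE !dot_proj_self.
have E : dot (proj M u) (proj N u) = dot (proj M u) u.
  by rewrite -dot_proj proj_proj.
by rewrite (dotC (proj N u) (proj M u)) E; ring.
Qed.

End TrigonometricModes.

(** * Bessel, Riemann-Lebesgue and the Dirichlet kernel *)

Section FourierConvergence.
Context {R : realType}.
Implicit Types (a c z : R) (u v w f : cper R) (n m N M : nat).
Local Notation tau := (pi *+ 2 : R).

Lemma bessel_cvg u : exists2 A, (fun N => dot (proj N u) u) @ \oo --> A &
  forall N, dot (proj N u) u <= A.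
Proof.
have nd : nondecreasing_seq (fun N => dot (proj N u) u).
  apply/nondecreasing_seqP => N.
  by rewrite projS dotDl lerDl dot_mode_ge0.
have cv : cvgn (fun N => dot (proj N u) u).
  by apply: nondecreasing_is_cvgn => //; exists (dot u u) => _ [N _ <-]; exact: bessel.
exists (limn (fun N => dot (proj N u) u)) => // N.
exact: nondecreasing_cvgn_le.
Qed.

Lemma dot_mode_cvg0 u : (fun n => dot (mode n u) u) @ \oo --> (0 : R).
Proof.
have [A cA _] := bessel_cvg u.
have cA1 : (fun N => dot (proj N.+1 u) u) @ \oo --> A.
  by move: cA; rewrite -(cvg_shiftS (fun N => dot (proj N u) u)).
have -> : (fun n => dot (mode n u) u) =
    (fun N => dot (proj N.+1 u) u - dot (proj N u) u).
  by apply/funext => N; rewrite projS dotDl addrAC subrr add0r.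
by rewrite -(subrr A); exact: cvgB.
Qed.

Lemma riemann_lebesgue u :
  (fun n => dot u (cosn n.+1)) @ \oo --> (0 : R) /\
  (fun n => dot u (sinn n.+1)) @ \oo --> (0 : R).
Proof.
have pi0 := pi_gt0 R.
have H (g : nat -> R) : (forall n, g n ^+ 2 <= pi * dot (mode n u) u) ->
    g @ \oo --> (0 : R).
  move=> hg; apply/cvgr0Pnorm_le => e e0.
  have e2 : 0 < e ^+ 2 / pi by rewrite divr_gt0// exprn_gt0.
  have /cvgr0Pnorm_le/(_ _ e2) := dot_mode_cvg0 u; apply: filterS => n.
  rewrite ger0_norm ?dot_mode_ge0// ler_pdivlMr// mulrC => h.
  have := le_trans (hg n) h; rewrite -[g n ^+ 2]real_normK ?num_real//.
  by rewrite ler_pXn2r ?nnegrE// ltW.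
by split; apply: H => n; rewrite dot_mode_self mulrC divfK ?gt_eqF//;
  [rewrite lerDl|rewrite lerDr]; exact: sqr_ge0.
Qed.

Lemma periodicz (g : R -> R) T (n : int) z : periodic g T ->
  g (z + T *~ n) = g z.
Proof.
move=> pg; case: n => n; first exact: periodicn.
by rewrite NegzE mulrNz -pmulrn -[LHS](periodicn pg n.+1) subrK.
Qed.

Lemma sin_half_eq0 z : sin (z / 2) = 0 -> exists n : int, z = tau *~ n.
Proof.
move=> s0; have tau0 := tau_gt0 R.
have cosE (x : R) : cos x = 1 - 2 * sin (x / 2) ^+ 2.
  rewrite {1}(_ : x = (x / 2) *+ 2) ?cos_mulr2n ?cos2sin2; first by ring.
  by rewrite mulr2n; lra.
pose n := Num.floor (z / tau); pose t := z - tau *~ n.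
have zE : z = t + tau *~ n by rewrite /t subrK.
exists n.
have /andP[t0 t1] : 0 <= t < tau.
  have := floor_itv (z / tau); rewrite -/n => /andP[].
  rewrite ler_pdivlMr// ltr_pdivrMr// intrD mulrDl mul1r /t mulrzl.
  by move=> *; apply/andP; split; lra.
have : cos t = 1.
  by rewrite -(periodicz n t (@cosD2pi R)) -zE cosE s0 expr0n mulr0 subr0.
rewrite cosE => c1; have {c1} : sin (t / 2) == 0.
  by rewrite -sqrf_eq0; apply/eqP; lra.
move: t0; rewrite le_eqVlt => /orP[/eqP t0 _|t0 /eqP st].
  by rewrite zE -t0 add0r.
have : 0 < sin (t / 2).
  by apply: sin_gt0_pi; move: t1; rewrite mulr2n; lra.
by rewrite st ltxx.
Qed.

(* Chernoff's trick: the quotient of [f] by [2 sin (z / 2)] is continuous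
   (the junk value [x / 0 = 0] is the right one at the zeros), so the Dirichlet
   integral of [f] is a difference of Fourier coefficients of continuous
   functions. *)
Lemma chernoff_quotient_continuous f : f 0 = 0 -> is_derive (0 : R) 1 f 0 ->
  continuous (fun z => f z * cos (z / 2) / (2 * sin (z / 2))).
Proof.
move=> f0 df0 z0.
have half_cvg (x : R) : (fun z : R => z / 2) @ x --> x / 2.
  by apply: cvgM; [exact: cvg_id|exact: cvg_cst].
have ccos (x : R) : (fun z : R => cos (z / 2)) @ x --> cos (x / 2).
  by apply: continuous_comp; [exact: half_cvg|exact: continuous_cos].
have csin (x : R) : (fun z : R => sin (z / 2)) @ x --> sin (x / 2).
  by apply: continuous_comp; [exact: half_cvg|exact: continuous_sin].
have [s0|s0] := eqVneq (sin (z0 / 2)) 0; last first.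
  apply: cvgM; first by apply: cvgM; [exact: cper_continuous|exact: ccos].
  by apply: cvgV; [rewrite mulf_neq0|apply: cvgM; [exact: cvg_cst|exact: csin]].
have [n zn] := sin_half_eq0 s0.
have fz0 : f z0 = 0 by rewrite zn -[_ *~ _]add0r periodicz//; exact: cper_periodic.
have df : is_derive z0 (1 : R) f 0.
  have fE : (f : R -> R) = f \o (fun x => x - z0).
    apply/funext => x /=; rewrite zn -mulrNz periodicz//; exact: cper_periodic.
  rewrite fE -[X in is_derive _ _ _ X]mulr1.
  have df' : is_derive (z0 - z0) (1 : R) f 0 by rewrite subrr.
  apply: (@is_derive1_comp R f (fun x => x - z0) z0 0 1 df').
  have D : is_derive z0 (1 : R) (fun=> z0) 0 by exact: is_derive_cst.
  by have := is_deriveB (is_derive_id z0 (1 : R)) D; rewrite subr0.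
have ds : is_derive z0 (1 : R) (fun z => sin (z / 2)) (cos (z0 / 2) / 2).
  apply: (@is_derive1_comp R (@sin R) (fun x => x / 2) z0 _ _ (is_derive_sin _)).
  have D := is_deriveZ 2^-1 (is_derive_id z0 (1 : R)).
  have -> : (fun x : R => x / 2) = (fun x => 2^-1 * x).
    by apply/funext => x; rewrite mulrC.
  by move: D; rewrite /GRing.scale/= mulr1.
have c0 : cos (z0 / 2) != 0.
  have := cos2Dsin2 (z0 / 2); rewrite s0 expr0n addr0 => h.
  by rewrite -sqrf_eq0 h oner_eq0.
(* In Caratheodory's form of differentiability [f] and the sine are continuous multiples of
   [z - z0], and this factor cancels in the quotient. *)
have /is_derive1_caratheodory[g [gE gC g0]] := df.
have /is_derive1_caratheodory[k [kE kC k0]] := ds.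
have kz0 : k z0 != 0 by rewrite k0 mulf_neq0.
have -> : (fun z => f z * cos (z / 2) / (2 * sin (z / 2))) =
    (fun z => g z * cos (z / 2) / (2 * k z)).
  apply/funext => z; have [->|zz0] := eqVneq z z0.
    by rewrite fz0 g0 !mul0r.
  have := gE z; rewrite fz0 subr0 => ->; have := kE z; rewrite s0 subr0 => ->.
  have zz : z - z0 != 0 by rewrite subr_eq0.
  have [->|kz] := eqVneq (k z) 0; first by rewrite mul0r mulr0 invr0 !mulr0.
  by field; rewrite kz.
apply: cvgM; first by apply: cvgM; [exact: gC|exact: ccos].
by apply: cvgV; [rewrite mulf_neq0|apply: cvgM; [exact: cvg_cst|exact: kC]].
Qed.

(** The right side is sin ((N + 1/2) z) expanded, so that each term is a Fourier mode times a
    half-angle factor. *)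
Lemma dirichlet_kernel N z :
  2 * sin (z / 2) * (2^-1 + \sum_(n < N) cos (n.+1%:R * z)) =
  sin (N%:R * z) * cos (z / 2) + cos (N%:R * z) * sin (z / 2).
Proof.
elim: N => [|N IH].
  by rewrite big_ord0 mul0r sin0 cos0; field.
rewrite big_ord_recr /= addrA mulrDr IH -!sinD.
have -> : N%:R * z + z / 2 = N.+1%:R * z - z / 2.
  by rewrite -natr1; field.
by rewrite sinB sinD; ring.
Qed.

End FourierConvergence.

(** * Fourier series of primitives and the Poincare inequality *)

Section PoincareInequality.
Context {R : realType}.
Implicit Types (a c z : R) (u v w f : cper R) (n m N M : nat).
Local Notation tau := (pi *+ 2 : R).

Definition translate a u : cper R.
Proof.
apply: (@mkcper _ (fun z => u (z + a))) => z.
  apply: (@continuous_comp _ _ _ (fun x => x + a) u z).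
    2: exact: cper_continuous.
  by apply: cvgD; [exact: cvg_id|exact: cvg_cst].
by rewrite addrAC cper_periodic.
Defined.

Lemma translateE a u z : translate a u z = u (z + a). Proof. by []. Qed.

Lemma itau_translate a u : itau (translate a u) = itau u.
Proof.
rewrite !itauE (oint_translate 0 tau a (cper_locint u)) add0r addrC.
by rewrite oint_periodic//; [exact: cper_locint|exact: cper_periodic].
Qed.

Lemma dot_translate a u v : dot (translate a u) v = dot u (translate (- a) v).
Proof.
rewrite /dot -(itau_translate a (cmul u _)); congr itau; apply: cperP => z.
by rewrite !(cmulE, translateE) addrK.
Qed.

Definition dirichlet N : cper R := ccst 2^-1 + \sum_(n < N) cosn n.+1.

Lemma dot_sinn_dirichlet N m : dot (sinn m.+1) (dirichlet N) = 0.
Proof.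
rewrite /dirichlet dotDr dot_cst itau_sinn mulr0 add0r linear_sum big1// => n _.
exact: dot_sinn_cosn.
Qed.

Lemma itau_dirichlet N : itau (dirichlet N) = pi.
Proof.
rewrite /dirichlet linearD linear_sum /= itau_cst big1 => [|n _]; last first.
  exact: itau_cosn.
by rewrite addr0 (mulr2n pi); field.
Qed.

Lemma dot_translate_dirichlet N z u : itau u = 0 ->
  dot (translate z u) (dirichlet N) = pi * proj N u z.
Proof.
move=> u0; rewrite /dirichlet dotDr dot_cst itau_translate u0 mulr0 add0r.
rewrite linear_sum /proj cper_sum mulr_sumr; apply: eq_bigr => n _.
rewrite [LHS]dot_translate /mode !(cperE, cosnE, sinnE).
have -> : translate (- z) (cosn n.+1) = cos (n.+1%:R * z) *: cosn n.+1 +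
    sin (n.+1%:R * z) *: sinn n.+1.
  apply: cperP => x; rewrite translateE !(cperE, cosnE, sinnE) mulrDr mulrN.
  by rewrite cosB; ring.
have := lt0r_neq0 (pi_gt0 R) => pi0.
by rewrite !dotE; move: pi0; generalize (@pi R) => p p0; field.
Qed.

Lemma dirichlet_cvg0 f : f 0 = 0 -> is_derive (0 : R) 1 f 0 ->
  (fun N => dot f (dirichlet N)) @ \oo --> (0 : R).
Proof.
move=> f0 df; have cg := chernoff_quotient_continuous f0 df.
have pg : periodic (fun z => f z * cos (z / 2) / (2 * sin (z / 2))) tau.
  move=> z; rewrite cper_periodic mulrDl (_ : tau / 2 = pi).
    by rewrite sinDpi cosDpi !mulrN invrN mulrNN.
  by rewrite (mulr2n pi); field.
pose g := mkcper cg pg.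
have fE z : 2 * sin (z / 2) * g z = f z * cos (z / 2).
  rewrite [g z]/=; have [s0|s0] := eqVneq (sin (z / 2)) 0; last first.
    by field; rewrite s0.
  rewrite s0 mulr0 mul0r; have [n ->] := sin_half_eq0 s0.
  by rewrite -[_ *~ _]add0r periodicz ?f0 ?mul0r//; exact: cper_periodic.
have f0s z : sin (z / 2) = 0 -> f z = 0.
  move=> s0; have [n ->] := sin_half_eq0 s0.
  by rewrite -[_ *~ _]add0r periodicz ?f0//; exact: cper_periodic.
(* Multiplying the kernel identity by [f] and replacing f cos (z / 2) by 2 sin (z / 2) g leaves two
   Fourier coefficients. Where sin (z / 2) = 0 both integrands vanish. *)
have E N : dot f (dirichlet N) = dot g (sinn N) + 2^-1 * dot f (cosn N).
  rewrite /dot -linearZ -linearD; congr itau; apply: cperP => z.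
  rewrite !(cperD, cperZ, cmulE, ccstE) cper_sum.
  rewrite (eq_bigr (fun n : 'I_N => cos (n.+1%:R * z)))//.
  have [s0|s0] := eqVneq (sin (z / 2)) 0.
    by rewrite [g z]/= (f0s _ s0) !mul0r mulr0 addr0.
  apply: (mulfI (_ : 2 * sin (z / 2) != 0)); first by rewrite mulf_neq0.
  rewrite mulrCA dirichlet_kernel cosnE sinnE.
  by rewrite [RHS]mulrDr [X in _ = X + _]mulrA fE; field.
have [c1 _] := riemann_lebesgue f; have [_ s1] := riemann_lebesgue g.
have cfN : (fun N => dot f (cosn N)) @ \oo --> (0 : R).
  by rewrite -(cvg_shiftS (fun N => dot f (cosn N))).
have sgN : (fun N => dot g (sinn N)) @ \oo --> (0 : R).
  by rewrite -(cvg_shiftS (fun N => dot g (sinn N))).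
rewrite (funext E : (fun N => dot f (dirichlet N)) = _).
rewrite -[X in _ --> X]addr0 -[X in _ --> _ + X](mulr0 2^-1).
by apply: cvgD; [exact: sgN|apply: cvgM; [exact: cvg_cst|exact: cfN]].
Qed.

Lemma fourier_pointwise u z :
  (fun N => proj N (Kop u) z) @ \oo --> Kop u z.
Proof.
have pi0 := lt0r_neq0 (pi_gt0 R).
pose U := Kop u.
(* The subtracted terms remove the value and the slope at 0. The sine is orthogonal to the kernel,
   and the constant contributes [U z]. *)
pose f := translate z U - ccst (U z) - center u z *: sinn 1.
have f0 : f 0 = 0.
  rewrite /f !cperE translateE ccstE sinnE add0r mulr0 sin0; ring.
have df : is_derive (0 : R) 1 f 0.
  have D1 : is_derive (0 : R) 1 (fun x => U (x + z)) (center u z).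
    rewrite -[center u z]mulr1.
    apply: (@is_derive1_comp R U (fun x => x + z)).
      by rewrite add0r; exact: Kop_derive.
    have D : is_derive (0 : R) (1 : R) (fun=> z) 0 by exact: is_derive_cst.
    by have := is_deriveD (is_derive_id (0 : R) (1 : R)) D; rewrite addr0.
  have D2 : is_derive (0 : R) (1 : R) (fun=> U z) 0 by exact: is_derive_cst.
  have D3 := is_deriveZ (center u z) (is_derive_sinn 1 (0 : R)).
  have := is_deriveB (is_deriveB D1 D2) D3.
  by rewrite mulr0 cos0 /GRing.scale/= !mulr1 subr0 subrr.
have E : (fun N => proj N U z) = (fun N => U z + pi^-1 * dot f (dirichlet N)).
  apply/funext => N; rewrite /f !dotBl dotZl dot_sinn_dirichlet mulr0 subr0.
  rewrite dot_translate_dirichlet ?itau_Kop// (dotC (ccst _)) dot_cst.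
  by rewrite itau_dirichlet; move: pi0; generalize (@pi R) => p p0; field.
rewrite -/U E -[X in _ --> X]addr0 -(mulr0 pi^-1).
apply: cvgD; first exact: cvg_cst.
by apply: cvgM; [exact: cvg_cst|exact: dirichlet_cvg0].
Qed.

(** A difference of partial sums of [Kop u] is [Kop] of a piece of [u], so [Kop_sup] bounds it by
    the Bessel tail of [u]; then the upper index tends to infinity. *)
Lemma fourier_uniform u : exists2 e : nat -> R, e @ \oo --> (0 : R) &
  forall N z, `|Kop u z - proj N (Kop u) z| <= e N.
Proof.
have [A cA Aub] := bessel_cvg u.
exists (fun N => Num.sqrt tau * Num.sqrt (A - dot (proj N u) u)).
  have := cvgB (cvg_cst A) cA => H.
  have {H} : (fun N => A - dot (proj N u) u) @ \oo --> (0 : R).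
    by rewrite -(subrr A); apply: cvgB; [exact: cvg_cst|exact: cA].
  move=> H; rewrite -(mulr0 (Num.sqrt tau)); apply: cvgM; first exact: cvg_cst.
  rewrite -[X in _ --> X](sqrtr0 R).
  exact: (continuous_cvg _ (@sqrt_continuous R 0) H).
move=> N z.
have H M : (N <= M)%N -> `|proj M (Kop u) z - proj N (Kop u) z| <=
    Num.sqrt tau * Num.sqrt (A - dot (proj N u) u).
  move=> NM; rewrite -!Kop_proj -cperB -linearB.
  apply: le_trans (Kop_sup _ _) _.
  rewrite ler_wpM2l ?sqrtr_ge0// ler_sqrt.
    by rewrite dot_projB// lerD2r.
  by rewrite subr_ge0.
have cv : (fun M => `|proj M (Kop u) z - proj N (Kop u) z|) @ \oo -->
    `|Kop u z - proj N (Kop u) z|.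
  by apply: cvg_norm; apply: cvgB; [exact: fourier_pointwise|exact: cvg_cst].
rewrite -(cvg_lim (@Rhausdorff R) cv).
apply: limr_le; first by apply/cvg_ex; eexists; exact: cv.
by near=> M; apply: H; near: M; exact: nbhs_infty_ge.
Unshelve. all: by end_near. Qed.

(** On each frequency n >= N + 1 [Kop] contracts by 1 / n. Uniform convergence of the Fourier series
    of [Kop u] carries the bound from the partial sums to the whole norm. *)
Lemma poincare N u : proj N u = 0 -> N.+1%:R * nrm (Kop u) <= nrm u.
Proof.
move=> pu; set U := Kop u.
have [e e0 eU] := fourier_uniform u.
have N0 : 0 < N.+1%:R :> R by rewrite ltr0n.
have mode0 n : (n < N)%N -> mode n u = 0.
  move=> nN; have : mode n (proj N u) = 0 by rewrite pu linear0.
  rewrite /proj linear_sum (bigD1 (Ordinal nN))//= mode_mode eqxx big1 ?addr0//.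
  move=> i iN; rewrite mode_mode; case: eqVneq => // ni.
  by move: iN; rewrite -val_eqE /= -ni eqxx.
have B M : dot (proj M U) U <= N.+1%:R^-1 ^+ 2 * dot u u.
  apply: le_trans (_ : N.+1%:R^-1 ^+ 2 * dot (proj M u) u <= _); last first.
    by rewrite ler_wpM2l ?sqr_ge0// bessel.
  elim: M => [|M IH]; first by rewrite !proj0 !dot0l mulr0.
  rewrite !projS (dotDl (proj M U)) (dotDl (proj M u)) mulrDr; apply: lerD; first exact: IH.
  rewrite dot_mode_Kop.
  have [MN|NM] := ltnP M N; first by rewrite mode0// dot0l !mulr0.
  rewrite ler_wpM2r ?dot_mode_ge0// lerXn2r ?nnegrE ?invr_ge0//.
  by rewrite lef_pV2 ?posrE ?ltr0n// ler_nat ltnS.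
have UB : dot U U <= N.+1%:R^-1 ^+ 2 * dot u u.
  have H M : dot U U <= N.+1%:R^-1 ^+ 2 * dot u u +
      nrm U * (e M * Num.sqrt tau).
    have -> : dot U U = dot (proj M U) U + dot U (U - proj M U).
      by rewrite dotBr (dotC U (proj M U)); ring.
    rewrite lerD//; apply: le_trans (dot_le _ _) _.
    rewrite ler_wpM2l ?nrm_ge0//; apply: nrm_le_sup => z.
    by rewrite cperB; exact: eU.
  have cv : (fun M => N.+1%:R^-1 ^+ 2 * dot u u + nrm U * (e M * Num.sqrt tau))
      @ \oo --> N.+1%:R^-1 ^+ 2 * dot u u.
    rewrite -[X in _ --> X]addr0 -(mulr0 (nrm U)) -(mul0r (Num.sqrt tau)).
    apply: cvgD; first exact: cvg_cst.
    by apply: cvgM; [exact: cvg_cst|apply: cvgM; [exact: e0|exact: cvg_cst]].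
  rewrite -(cvg_lim (@Rhausdorff R) cv).
  apply: limr_ge; first by apply/cvg_ex; eexists; exact: cv.
  by near=> M; exact: H.
rewrite -(ler_pXn2r (n := 2)) ?nnegrE ?mulr_ge0 ?nrm_ge0//.
rewrite exprMn !nrm_sqr; move: UB; rewrite exprVn mulrC ler_pdivlMr ?exprn_gt0//.
by rewrite mulrC.
Unshelve. all: by end_near. Qed.

Lemma nrm_Kop u : nrm (Kop u) <= nrm u.
Proof. by have := @poincare 0 u (proj0 u); rewrite mul1r. Qed.

End PoincareInequality.

(** * Linear algebra of the resolvent equation *)

Section Neumann.
Context {R : realType}.
Local Notation V := (cper R).
Local Notation VV := (cper R * cper R)%type.
Implicit Types (p g : VV) (q B C : R).

(** Uniform convergence under a geometric majorant: the limit stays continuous and periodic, and the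
    rate is explicit. *)
Lemma cper_geometric_series (a : nat -> V) B q : 0 <= q -> q < 1 ->
  (forall k z, `|a k z| <= B * q ^+ k) ->
  exists s : V, forall n z,
    `|s z - (\sum_(k < n) a k) z| <= B * q ^+ n / (1 - q).
Proof.
move=> q0 q1 aB.
have B0 : 0 <= B by have := le_trans (normr_ge0 _) (aB 0%N 0); rewrite expr0 mulr1.
have q10 : 0 < 1 - q by rewrite subr_gt0.
pose S n z := (\sum_(k < n) a k) z.
have SE n z : S n.+1 z = S n z + a n z by rewrite /S big_ord_recr.
have geo n m z : `|S (n + m)%N z - S n z| <= B * q ^+ n / (1 - q).
  apply: le_trans (_ : B * q ^+ n * (1 - q ^+ m) / (1 - q) <= _); last first.
    rewrite ler_wpM2r ?invr_ge0 ?(ltW q10)// ler_piMr ?mulr_ge0 ?exprn_ge0//.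
    by rewrite lerBlDr lerDl exprn_ge0.
  elim: m => [|m IH]; first by rewrite addn0 subrr normr0 expr0 subrr mulr0 mul0r.
  rewrite addnS SE (_ : S (n + m)%N z + _ - _ =
    (S (n + m)%N z - S n z) + a (n + m)%N z); last by ring.
  apply: le_trans (ler_normD _ _) _; apply: le_trans (lerD IH (aB _ _)) _.
  rewrite le_eqVlt; apply/orP; left; apply/eqP.
  by rewrite exprD exprS; field; rewrite gt_eqF.
have qn : (fun n => B * q ^+ n / (1 - q)) @ \oo --> (0 : R).
  have E0 : B * 0 / (1 - q) = 0 by rewrite mulr0 mul0r.
  rewrite -[X in _ --> X]E0; apply: cvgM; last exact: cvg_cst.
  apply: cvgM; [exact: cvg_cst|apply: cvg_expr].
  by rewrite ger0_norm.
have small e : 0 < e -> exists n, B * q ^+ n / (1 - q) < e.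
  move=> e0; have /cvgr0Pnorm_lt/(_ _ e0)[n _ /(_ n (leqnn n))] := qn.
  by move=> /(le_lt_trans (ler_norm _)); exists n.
have cS z : cvgn (S^~ z).
  apply/cauchy_cvgP/cauchy_exP => e e0; have [n ne] := small e e0.
  exists (S n z); exists n => // m /= nm.
  rewrite /ball/= distrC -(subnKC nm).
  exact: le_lt_trans (geo _ _ _) ne.
pose s z := limn (S^~ z).
have sS n z : `|s z - S n z| <= B * q ^+ n / (1 - q).
  have cv : (fun m => `|S (n + m)%N z - S n z|) @ \oo --> `|s z - S n z|.
    apply: cvg_norm; apply: cvgB; last exact: cvg_cst.
    have := cS z; rewrite -(cvg_shiftn n (S^~ z)) => H.
    rewrite (_ : (fun m => _) = (fun m => S (m + n)%N z)) //.
    by apply/funext => m; rewrite addnC.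
  rewrite -(cvg_lim (@Rhausdorff R) cv); apply: limr_le.
    by apply/cvg_ex; eexists; exact: cv.
  by near=> m; exact: geo.
have sc : continuous s.
  move=> z0; apply/cvgrPdist_lt => e e0.
  have e3 : 0 < e / 3 by rewrite divr_gt0.
  have [n ne] := small _ e3.
  have /cvgrPdist_lt/(_ _ e3) := @cper_continuous _ (\sum_(k < n) a k) z0.
  apply: filterS => z; rewrite -/(S n z) -/(S n z0) => h.
  rewrite (_ : s z0 - s z = (s z0 - S n z0) + (S n z0 - S n z) - (s z - S n z));
    last by ring.
  apply: le_lt_trans (ler_normB _ _) _.
  apply: le_lt_trans (lerD (ler_normD _ _) (lexx _)) _.
  by have := sS n z; have := sS n z0; lra.
have sp : periodic s (pi *+ 2).
  move=> z; rewrite /s; congr (limn _); apply/funext => n.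
  by rewrite /S cper_periodic.
by exists (mkcper sc sp) => n z; exact: sS.
Unshelve. all: by end_near. Qed.

Definition nrm2 p : R := nrm p.1 + nrm p.2.

Lemma nrm2_ge0 p : 0 <= nrm2 p.
Proof. by rewrite addr_ge0 ?nrm_ge0. Qed.

Lemma nrm2_eq0 p : nrm2 p = 0 -> p = 0.
Proof.
case: p => u v /eqP; rewrite /nrm2 paddr_eq0 ?nrm_ge0//= => /andP[/eqP u0 /eqP v0].
by rewrite (nrm_eq0 u0) (nrm_eq0 v0).
Qed.

Lemma nrm2D p g : nrm2 (p + g) <= nrm2 p + nrm2 g.
Proof.
rewrite /nrm2 addrACA; exact: lerD (nrmD _ _) (nrmD _ _).
Qed.

Lemma nrm2Z c p : nrm2 (c *: p) = `|c| * nrm2 p.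
Proof. by rewrite /nrm2 /= !nrmZ mulrDr. Qed.

Lemma nrm2N p : nrm2 (- p) = nrm2 p.
Proof. by rewrite /nrm2 /= !nrmN. Qed.

Lemma nrm2_sum (I : Type) (r : seq I) (Q : pred I) (F : I -> VV) :
  nrm2 (\sum_(i <- r | Q i) F i) <= \sum_(i <- r | Q i) nrm2 (F i).
Proof.
elim/big_rec2 : _ => [|i y x _ h]; first by rewrite /nrm2 /= nrm0 addr0.
exact: le_trans (nrm2D _ _) (lerD _ h).
Qed.

Context (T : {linear VV -> VV}) (q C : R).
Hypotheses (q0 : 0 <= q) (q1 : q < 1)
  (Tq : forall p, nrm2 (T p) <= q * nrm2 p)
  (TC1 : forall p z, `|(T p).1 z| <= C * nrm2 p)
  (TC2 : forall p z, `|(T p).2 z| <= C * nrm2 p).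

Lemma neumann_bound p g : p = g + T p -> nrm2 p <= (1 - q)^-1 * nrm2 g.
Proof.
move=> hp; rewrite mulrC ler_pdivlMr ?subr_gt0//.
by have := nrm2D g (T p); rewrite -hp; have := Tq p; lra.
Qed.

(** [T] contracts in the L2 norm, for which [cper] is not complete; the sup bounds [TC1] and [TC2]
    make the series of the [T^(k+1) g] converge uniformly. The series starts at [T g] because only
    images under [T] are controlled in the sup norm. *)
Lemma neumann_exists g : exists p, p = g + T p.
Proof.
have C0 : 0 <= C * nrm2 g by exact: le_trans (TC1 g 0).
pose a k := iter k T (T g).
have ag k : nrm2 (iter k T g) <= q ^+ k * nrm2 g.
  elim: k => [|k IH]; first by rewrite expr0 mul1r.
  by rewrite exprS -mulrA; apply: le_trans (Tq _) _; rewrite ler_wpM2l.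
have aE k : a k = T (iter k T g) by rewrite /a -iterS -iterSr.
have [C0' | Clt0] := leP 0 C; last first.
  have g0 : nrm2 g = 0.
    by apply/eqP; rewrite eq_le nrm2_ge0 andbT -(nmulr_rge0 _ Clt0).
  by exists 0; rewrite (nrm2_eq0 g0) linear0 addr0.
have a1 k z : `|(a k).1 z| <= C * nrm2 g * q ^+ k.
  by rewrite aE; apply: le_trans (TC1 _ _) _; rewrite -mulrA ler_wpM2l// mulrC.
have a2 k z : `|(a k).2 z| <= C * nrm2 g * q ^+ k.
  by rewrite aE; apply: le_trans (TC2 _ _) _; rewrite -mulrA ler_wpM2l// mulrC.
have [s1 hs1] := cper_geometric_series q0 q1 a1.
have [s2 hs2] := cper_geometric_series q0 q1 a2.
pose s : VV := (s1, s2); pose S n : VV := \sum_(k < n) a k.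
have S1 n : (S n).1 = \sum_(k < n) (a k).1.
  by rewrite /S; elim/big_rec2 : _ => // i y x _ <-.
have S2 n : (S n).2 = \sum_(k < n) (a k).2.
  by rewrite /S; elim/big_rec2 : _ => // i y x _ <-.
have TS n : T (g + S n) = S n.+1.
  elim: n => [|n IH]; first by rewrite /S big_ord0 big_ord1 addr0.
  rewrite {1}/S big_ord_recr /= addrA linearD /= -/(S n) IH.
  by rewrite [RHS]big_ord_recr /=.
pose B := C * nrm2 g / (1 - q); pose K := Num.sqrt (pi *+ 2 : R).
have q10 : 0 < 1 - q by rewrite subr_gt0.
have B0 : 0 <= B by rewrite divr_ge0// ltW.
have sS n : nrm2 (s - S n) <= B * q ^+ n * K *+ 2.
  have E : C * nrm2 g * q ^+ n / (1 - q) = B * q ^+ n by rewrite /B mulrAC.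
  rewrite mulr2n /nrm2 lerD//= ?S1 ?S2; apply: nrm_le_sup => z.
    by rewrite -E; exact: hs1.
  by rewrite -E; exact: hs2.
have dist n : nrm2 (T (g + s) - s) <= (B * K *+ 2) * (q ^+ n * (q + q)).
  have -> : T (g + s) - s = T (s - S n) - (s - S n.+1).
    have -> : g + s = (g + S n) + (s - S n) by rewrite addrACA addrA addrK.
    by rewrite linearD TS opprB [RHS]addrA; congr (_ - _); rewrite addrC.
  apply: le_trans (nrm2D _ _) _; rewrite nrm2N.
  have := Tq (s - S n); have := ler_wpM2l q0 (sS n); have := sS n.+1.
  by rewrite exprS !mulr2n; lra.
have qn : (fun n => (B * K *+ 2) * (q ^+ n * (q + q))) @ \oo --> (0 : R).
  have E0 : (B * K *+ 2) * (0 * (q + q)) = 0 by rewrite mul0r mulr0.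
  rewrite -[X in _ --> X]E0; apply: cvgM; first exact: cvg_cst.
  by apply: cvgM; [apply: cvg_expr; rewrite ger0_norm|exact: cvg_cst].
exists (g + s).
have /nrm2_eq0/eqP : nrm2 (T (g + s) - s) = 0.
  apply/eqP; rewrite eq_le nrm2_ge0 andbT.
  rewrite -(cvg_lim (@Rhausdorff R) qn); apply: limr_ge.
    by apply/cvg_ex; eexists; exact: qn.
  by near=> n; exact: dist.
by rewrite subr_eq0 => /eqP ->.
Unshelve. all: by end_near. Qed.

(** With w_i = (1 - T)^-1 psi_i the equation reduces to a linear system with matrix 1 - G, G_ij =
    phi_j(w_i). A vector [c] with c G = c would give the homogeneous solution sum_i c_i w_i, which
    injectivity excludes. *)
Lemma fredholm (m : nat) (phi : 'I_m -> VV -> R) (psi : 'I_m -> VV) (L : R) :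
  (forall j, linear_for *%R (phi j)) ->
  (forall j p, `|phi j p| <= L * nrm2 p) ->
  (forall p, p = T p + \sum_j phi j p *: psi j -> p = 0) ->
  exists M, forall g, exists2 p, p = g + T p + \sum_j phi j p *: psi j &
    nrm2 p <= M * nrm2 g.
Proof.
move=> lphi bphi inj.
have L0 (j : 'I_m) g : 0 <= L * nrm2 g by exact: le_trans (bphi j g).
have phiS j (c : 'I_m -> R) (f : 'I_m -> VV) p :
    phi j (p + \sum_i c i *: f i) = phi j p + \sum_i c i * phi j (f i).
  pose Phi : {linear VV -> R | *%R} := HB.pack (phi j)
    (GRing.isLinear.Build R VV R *%R (phi j) (lphi j)).
  rewrite -[phi j]/(Phi : VV -> R) linearD linear_sum; congr (_ + _).
  by apply: eq_bigr => i _; rewrite linearZ.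
have phi0 j : phi j 0 = 0.
  by have := lphi j 1 0 0; rewrite scaler0 addr0 mul1r; lra.
pose w j := sval (cid (neumann_exists (psi j))).
have wE j : w j = psi j + T (w j) by exact: svalP (cid (neumann_exists (psi j))).
have sumE (c : 'I_m -> R) r g : r = g + T r ->
    r + \sum_i c i *: w i = g + T (r + \sum_i c i *: w i) + \sum_i c i *: psi i.
  move=> rE; rewrite linearD linear_sum /= {1}rE -!addrA; congr (_ + (_ + _)).
  rewrite -big_split /=; apply: eq_bigr => i _.
  by rewrite linearZ /= -scalerDr addrC -wE.
pose G : 'M[R]_m := \matrix_(i, j) phi j (w i).
have unitG : 1%:M - G \in unitmx.
  rewrite unitmxE unitfE; apply/negP => /det0P[c c0 cG].
  pose p := \sum_i c 0 i *: w i.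
  have phip j : phi j p = c 0 j.
    have -> : p = 0 + p by rewrite add0r.
    rewrite phiS phi0 add0r; move: cG; rewrite mulmxBr mulmx1 => /eqP.
    rewrite subr_eq0 => /eqP/rowP/(_ j) ->; rewrite mxE.
    by apply: eq_bigr => i _; rewrite mxE.
  have p0 : p = 0.
    apply: inj; have := @sumE (fun i => c 0 i) 0 0; rewrite linear0 addr0.
    move=> /(_ erefl); rewrite !add0r -/p => {1}->; congr (_ + _).
    by apply: eq_bigr => i _; rewrite phip.
  move: c0; rewrite (_ : c = 0) ?eqxx//; apply/rowP => j; rewrite mxE -phip p0.
  exact: phi0.
pose H := invmx (1%:M - G).
pose M := (1 - q)^-1 + \sum_j (\sum_i L * (1 - q)^-1 * `|H i j|) * nrm2 (w j).
exists M => g.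
have [r rE] := neumann_exists g; have rb := neumann_bound rE.
pose rho : 'rV[R]_m := \row_j phi j r; pose c := rho *m H.
have cE j : c 0 j = phi j (r + \sum_i c 0 i *: w i).
  rewrite phiS; have : c *m (1%:M - G) = rho by rewrite mulmxKV.
  rewrite mulmxBr mulmx1 => /eqP; rewrite subr_eq => /eqP/rowP/(_ j) ->.
  rewrite [LHS]mxE [rho 0 j]mxE [(c *m G) 0 j]mxE; congr (_ + _).
  by apply: eq_bigr => i _; congr (_ * _); rewrite mxE.
exists (r + \sum_i c 0 i *: w i).
  rewrite {1}(sumE (fun i => c 0 i) _ _ rE); congr (_ + _).
  by apply: eq_bigr => j _; rewrite -cE.
apply: le_trans (nrm2D _ _) _; rewrite /M mulrDl lerD//.
apply: le_trans (nrm2_sum _ _ _) _; rewrite mulr_suml; apply: ler_sum => j _.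
rewrite nrm2Z mulrAC ler_wpM2r ?nrm2_ge0// mxE.
apply: le_trans (ler_norm_sum _ _ _) _; rewrite mulr_suml; apply: ler_sum => i _.
rewrite normrM mulrAC ler_wpM2r// mxE; apply: le_trans (bphi _ _) _.
have Lge : 0 <= L * nrm2 r := L0 i r.
(* The sign of [L] is free; if it is negative, the bound on [phi] forces the norms of [r] and [g] to
   be zero. *)
have [L00|Llt0] := leP 0 L; first by rewrite -mulrA ler_wpM2l.
have r0 : nrm2 r = 0.
  by apply/eqP; rewrite eq_le nrm2_ge0 andbT -(nmulr_rge0 _ Llt0).
have g0 : nrm2 g = 0.
  by apply/eqP; rewrite eq_le nrm2_ge0 andbT -(nmulr_rge0 _ Llt0); exact: L0.
by rewrite r0 g0 !mulr0.
Qed.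

End Neumann.

(** * The energy form, neutral vectors and real eigenvectors *)

Section EnergyForm.
Context {R : realType}.
Local Notation V := (cper R).
Implicit Types (p q r v y : V) (x lam al be : R).

Lemma Kop_inj p : Kop p = 0 -> itau p = 0 -> p = 0.
Proof. by move=> /Kop_eq0 + p0; rewrite center_id. Qed.

Lemma dot_itau0 p : itau p = 0 -> (forall q, itau q = 0 -> dot p q = 0) -> p = 0.
Proof. by move=> p0 H; apply: dot_eq0; exact: H. Qed.

Context (b : V).

(* With [u = Kop p], [form lam x p q] is the weak form
   [<(M + lam K) u, Kop q>] of the eigenvalue problem
   [M u + lam K u = 0], [M u = - u'' - b u - x K^2 u]. *)
Definition kap p q := dot (Kop (Kop p)) (Kop q).
Definition form lam x p q := dot p q - dot (cmul b (Kop p)) (Kop q) +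
  x * dot (Kop (Kop p)) (Kop (Kop q)) + lam * kap p q.

Lemma kap_is_linear p : linear_for *%R (kap p).
Proof. by move=> c q r; rewrite /kap linearP dotDr dotZr. Qed.
HB.instance Definition _ p := GRing.isLinear.Build R V R *%R (kap p) (kap_is_linear p).

Lemma kapC p q : kap p q = - kap q p.
Proof. by rewrite /kap Kop_skew (dotC (Kop p)). Qed.

Lemma kapZl c p r : kap (c *: p) r = c * kap p r.
Proof. by rewrite kapC linearZ /= -mulrN -kapC. Qed.
Lemma kap_self p : kap p p = 0.
Proof. by have := kapC p p; lra. Qed.

Lemma form_is_linear lam x p : linear_for *%R (form lam x p).
Proof.
move=> c q r; have K1 s t : Kop (c *: s + t) = c *: Kop s + Kop t by rewrite linearP.
by rewrite /form /kap !K1 !(dotDr, dotZr); ring.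
Qed.
HB.instance Definition _ lam x p :=
  GRing.isLinear.Build R V R *%R (form lam x p) (form_is_linear lam x p).

Lemma formE lam x p q : form lam x p q = form 0 x p q + lam * kap p q.
Proof. by rewrite /form; ring. Qed.

Lemma formEx x p q : form 0 x p q =
  form 0 0 p q + x * dot (Kop (Kop p)) (Kop (Kop q)).
Proof. by rewrite /form; ring. Qed.

Lemma form0C x p q : form 0 x p q = form 0 x q p.
Proof.
rewrite /form (dotC q) (dotC (Kop (Kop q))) !mul0r dot_cmul.
by rewrite (dotC (Kop p)).
Qed.

Lemma formC lam x p q : form lam x p q = form (- lam) x q p.
Proof. by rewrite formE (formE (- lam)) form0C kapC; ring. Qed.

Lemma form_self lam x p : form lam x p p = form 0 x p p.
Proof. by rewrite formE kap_self mulr0 addr0. Qed.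

Lemma formDl lam x p q r : form lam x (p + q) r = form lam x p r + form lam x q r.
Proof. by rewrite formC linearD /= -!formC. Qed.
Lemma formBl lam x p q r : form lam x (p - q) r = form lam x p r - form lam x q r.
Proof. by rewrite formC linearB /= -!formC. Qed.
Lemma formZl lam x c p r : form lam x (c *: p) r = c * form lam x p r.
Proof. by rewrite formC linearZ /= -!formC. Qed.
Lemma formDr lam x p q r : form lam x r (p + q) = form lam x r p + form lam x r q.
Proof. exact: linearD. Qed.
Lemma formBr lam x p q r : form lam x r (p - q) = form lam x r p - form lam x r q.
Proof. exact: linearB. Qed.
Lemma formZr lam x c p r : form lam x r (c *: p) = c * form lam x r p.
Proof. exact: linearZ. Qed.
Definition form_linE := (formBl, formBr, formDl, formDr, formZl, formZr).

(** Up to sign [kap p q] is <Kop^3 p, q>, and [Kop] is injective on mean zero. *)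
Lemma kap_nondegenerate p : itau p = 0 ->
  (forall q, itau q = 0 -> kap p q = 0) -> p = 0.
Proof.
move=> p0 H; apply: Kop_inj (p0); apply: Kop_inj (itau_Kop p).
apply: Kop_inj (itau_Kop _); apply: dot_itau0 (itau_Kop _) _ => q q0.
by have := H q q0; rewrite /kap => h; rewrite Kop_skew h oppr0.
Qed.

Context (x : R).

(** Real and imaginary parts of E_x(p, q) + lam kap(p, q) = 0 for p = p.1 + i p.2 and lam = al + i
    be. *)
Definition kernel_eq al be (p : V * V) := [/\ itau p.1 = 0, itau p.2 = 0 &
  forall q, itau q = 0 ->
    form 0 x p.1 q = - al * kap p.1 q + be * kap p.2 q /\
    form 0 x p.2 q = - be * kap p.1 q - al * kap p.2 q].

(** The equations are tested with the two parts of [p]. Symmetry of the energy against antisymmetry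
    of [kap] gives the mixed term two opposite values, so [kap p.2 p.1 = 0] as [al != 0]. *)
Lemma kernel_eq_energy al be (p : V * V) : al != 0 -> kernel_eq al be p ->
  [/\ form 0 x p.1 p.1 = 0, form 0 x p.2 p.2 = 0 & form 0 x p.1 p.2 = 0].
Proof.
case: p => p r al0 [/= p0 r0 H].
have [E11 E21] := H p p0; have [E12 E22] := H r r0.
move: E11 E21 E12 E22; rewrite !kap_self (kapC p r) (form0C x r p) => E11 E21 E12 E22.
have k0 : kap r p = 0.
  have : al * kap r p = 0 by lra.
  by move=> /eqP; rewrite mulf_eq0 (negbTE al0) => /eqP.
by rewrite E11 E22 E12 k0; split; ring.
Qed.

Lemma rotation_eq0 al be (s t : R) : al != 0 ->
  - al * s + be * t = 0 -> - be * s - al * t = 0 -> s = 0 /\ t = 0.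
Proof.
move=> al0 h1 h2; have D0 : 0 < al ^+ 2 + be ^+ 2.
  by rewrite ltr_pwDl ?sqr_ge0// exprn_even_gt0.
have es : (al ^+ 2 + be ^+ 2) * s = 0.
  rewrite [LHS](_ : _ = - al * (- al * s + be * t) - be * (- be * s - al * t)).
    by rewrite h1 h2 !mulr0 subr0.
  by ring.
have et : (al ^+ 2 + be ^+ 2) * t = 0.
  rewrite [LHS](_ : _ = be * (- al * s + be * t) - al * (- be * s - al * t)).
    by rewrite h1 h2 !mulr0 subr0.
  by ring.
by split; apply/eqP; [move/eqP: es|move/eqP: et]; rewrite mulf_eq0 gt_eqF.
Qed.

Lemma kernel_eq_degenerate al be (p : V * V) : al != 0 -> kernel_eq al be p ->
  (forall q, itau q = 0 -> form 0 x p.1 q = 0 /\ form 0 x p.2 q = 0) ->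
  p = 0.
Proof.
case: p => p r al0 [/= p0 r0 H] F0.
have K0 q : itau q = 0 -> kap p q = 0 /\ kap r q = 0.
  move=> q0; have [h1 h2] := H q q0; have [f1 f2] := F0 q q0.
  by apply: (rotation_eq0 (be := be) al0); [rewrite -h1|rewrite -h2].
have -> : p = 0 by apply: (kap_nondegenerate p0) => q /K0[].
by have -> : r = 0 by apply: (kap_nondegenerate r0) => q /K0[].
Qed.

(** Nonnegativity of the energy enters in the form that vectors of zero energy lie in the radical;
    there both equations only contain [kap], which is nondegenerate. *)
Lemma kernel_nonneg al be (p : V * V) : al != 0 ->
  (forall q, itau q = 0 -> form 0 x q q = 0 ->
    forall r, itau r = 0 -> form 0 x q r = 0) ->
  kernel_eq al be p -> p = 0.
Proof.
move=> al0 pos ker; have [E1 E2 _] := kernel_eq_energy al0 ker.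
have [p0 r0 _] := ker; apply: kernel_eq_degenerate al0 ker _ => q q0.
by split; exact: pos.
Qed.

(* The energy is positive on the complement of the first sine mode: at most
   one negative direction. *)
Hypothesis index1 : forall p, itau p = 0 -> dot p (sinn 1) = 0 ->
  form 0 x p p <= 0 -> p = 0.

(** Subtracting the multiple of [p] that cancels the sine coefficient leaves a neutral vector
    orthogonal to sin, which is zero by [index1]. *)
Lemma neutral_dependent p r : itau p = 0 -> itau r = 0 ->
  form 0 x p p = 0 -> form 0 x r r = 0 -> form 0 x p r = 0 -> p != 0 ->
  exists t, r = t *: p.
Proof.
move=> p0 r0 Ep Er Epr pn0.
have sp : dot p (sinn 1) != 0.
  by apply: contraNneq pn0 => sp; apply/eqP/index1 => //; rewrite Ep.
exists (dot r (sinn 1) / dot p (sinn 1)).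
apply/eqP; rewrite -subr_eq0; apply/eqP/index1.
- by rewrite linearB linearZ /= p0 r0 mulr0 subr0.
- by rewrite dotBl dotZl divfK// subrr.
- by rewrite !form_linE Ep Er (form0C x r p) Epr !(mulr0, subr0).
Qed.

(** If p.2 = t p.1, eliminating the energy from the two equations leaves be (1 + t^2) kap(p.1, q) =
    0. *)
Lemma kernel_eq_complex al be (p : V * V) : al != 0 -> be != 0 -> kernel_eq al be p ->
  p = 0.
Proof.
move=> al0 be0 ker; have [E1 E2 E12] := kernel_eq_energy al0 ker.
have [p0 r0 H] := ker; move: p ker E1 E2 E12 p0 r0 H => [p r] /= ker E1 E2 E12 p0 r0 H.
have [pz|pn0] := eqVneq p 0.
  rewrite pz in H *; congr (_, _); apply: (kap_nondegenerate r0) => q q0.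
  have [h _] := H q q0; move: h; rewrite form0C linear0 kapC linear0 oppr0.
  rewrite mulr0 add0r => /esym/eqP; rewrite mulf_eq0 (negbTE be0).
  by move=> /eqP.
have [t rt] := neutral_dependent p0 r0 E1 E2 E12 pn0.
suff pz : p = 0 by rewrite pz eqxx in pn0.
apply: (kap_nondegenerate p0) => q q0; have [h1 h2] := H q q0.
move: h1 h2; rewrite rt formZl kapZl => -> h2.
have : be * (1 + t ^+ 2) * kap p q = 0 by move: h2 => /eqP; rewrite -subr_eq0 => /eqP <-; ring.
move=> /eqP; rewrite !mulf_eq0 (negbTE be0) /= gt_eqF ?ltr_pwDl ?sqr_ge0//.
by move=> /eqP.
Qed.

Definition eigenvector lam p :=
  itau p = 0 /\ forall q, itau q = 0 -> form lam x p q = 0.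

Lemma eigenvector_energy lam p : eigenvector lam p -> form 0 x p p = 0.
Proof. by move=> [p0 H]; rewrite -(form_self lam) H. Qed.

(** Each equation tested with the other vector gives E(p, r) = - lam kap(p, r) = mu kap(p, r), so
    both forms vanish and [p], [r] span a neutral space. Only opposite eigenvalues escape. *)
Lemma eigenvector_dependent lam mu p r : lam + mu != 0 -> p != 0 ->
  eigenvector lam p -> eigenvector mu r -> exists t, r = t *: p.
Proof.
move=> lm pn0 ep er; have Ep := eigenvector_energy ep.
have Er := eigenvector_energy er; have [p0 hp] := ep; have [r0 hr] := er.
have := hp r r0; have := hr p p0; rewrite (formE lam) (formE mu) (form0C x r p) (kapC r p).
move=> h1 h2; have k0 : kap p r = 0.
  have : (lam + mu) * kap p r = 0 by lra.
  by move=> /eqP; rewrite mulf_eq0 (negbTE lm) => /eqP.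
apply: neutral_dependent => //; first by move: h2; rewrite k0 mulr0 addr0.
Qed.

Lemma eigenvector_unique lam mu p r : lam + mu != 0 -> p != 0 -> r != 0 ->
  eigenvector lam p -> eigenvector mu r -> lam = mu.
Proof.
move=> lm pn0 rn0 ep er.
have [t rt] := eigenvector_dependent lm pn0 ep er.
apply/eqP; apply: contraNT rn0 => lmu; apply/eqP.
have [r0 hr] := er; have [p0 hp] := ep; apply: (kap_nondegenerate r0) => q q0.
have := hr q q0; have := hp q q0; rewrite (formE lam) (formE mu) => h1.
rewrite rt formZl kapZl => h2.
have : (mu - lam) * (t * kap p q) = 0.
  rewrite [LHS](_ : _ = (t * form 0 x p q + mu * (t * kap p q)) -
    t * (form 0 x p q + lam * kap p q)); last by ring.
  by rewrite h1 h2 mulr0 subr0.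
by move=> /eqP; rewrite mulf_eq0 subr_eq0 eq_sym (negbTE lmu) => /eqP.
Qed.

(** Testing the two equations with [p] and [v] gives lam kap(p, v) = 0 and shows that [v] is neutral
    too. Hence [v] is a multiple of [p], its equation has left side zero, and c kap(p, .) = 0. *)
Lemma jordan_chain_trivial lam c p v : lam != 0 -> p != 0 ->
  eigenvector lam p -> itau v = 0 ->
  (forall q, itau q = 0 -> form lam x v q = - c * kap p q) -> c = 0.
Proof.
move=> lam0 pn0 ep v0 hv; have Ep := eigenvector_energy ep; have [p0 hp] := ep.
have := hv p p0; have := hp v v0; have := hv v v0.
rewrite form_self !(formE lam) kap_self mulr0 (form0C x v p) (kapC v p) => h1 h2 h3.
have k0 : kap p v = 0.
  have : lam * kap p v = 0 by lra.
  by move=> /eqP; rewrite mulf_eq0 (negbTE lam0) => /eqP.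
have Ev : form 0 x v v = 0 by rewrite h1 k0 mulr0.
have Epv : form 0 x p v = 0 by move: h2; rewrite k0 mulr0 addr0.
have [t vt] := neutral_dependent p0 v0 Ep Ev Epv pn0.
apply/eqP; apply: contraNT pn0 => c0; apply/eqP.
apply: (kap_nondegenerate p0) => q q0; have := hv q q0.
rewrite vt formZl hp// mulr0 => /esym/eqP; rewrite mulf_eq0 oppr_eq0 (negbTE c0).
by move=> /eqP.
Qed.

End EnergyForm.

(** * The resolvent equation as a Fredholm problem *)

Section ResolventEquation.
Context {R : realType}.
Local Notation V := (cper R).
Local Notation VV := (cper R * cper R)%type.
Implicit Types (u v q r : V) (p F : VV) (N : nat).
Context (b : V) (x al be Mb : R).
Hypothesis bM : forall z, `|b z| <= Mb.

(* In terms of [p = u'], the equation [(lam - A) u = f] with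
   [lam = al + i be] reads [p = K (B p - K f)]. *)
Definition Bop (s : R) u v : V := - cmul b (Kop u) - x *: Kop (Kop (Kop u)) +
  al *: Kop (Kop u) - s *: Kop (Kop v).

Definition Bop2 p : VV := (Bop be p.1 p.2, Bop (- be) p.2 p.1).

Lemma Bop2_is_linear : linear Bop2.
Proof.
move=> c p p'.
have K1 s t : Kop (c *: s + t) = c *: Kop s + Kop t by rewrite linearP.
have C1 s t : cmul b (c *: s + t) = c *: cmul b s + cmul b t by rewrite linearP.
by congr (_, _); rewrite /Bop /= !K1 C1; apply: cperP => z; rewrite !cperE; ring.
Qed.
HB.instance Definition _ := GRing.isLinear.Build R VV VV *:%R Bop2 Bop2_is_linear.

Let L := Mb + `|x| + `|al| + `|be|.

Let Mb0 : 0 <= Mb. Proof. exact: le_trans (bM 0). Qed.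

Lemma nrm_Bop s u v : nrm (Bop s u v) <=
  (Mb + `|x| + `|al|) * nrm u + `|s| * nrm v.
Proof.
have nu := nrm_Kop u; have nuu := nrm_Kop (Kop u).
have nuuu := nrm_Kop (Kop (Kop u)).
have nv := nrm_Kop v; have nvv := nrm_Kop (Kop v).
apply: le_trans (nrmB _ _) _; rewrite nrmZ; apply: lerD; last first.
  by rewrite ler_wpM2l//; lra.
rewrite 2!mulrDl; apply: le_trans (nrmD _ _) _; rewrite nrmZ; apply: lerD; last first.
  by rewrite ler_wpM2l//; lra.
apply: le_trans (nrmB _ _) _; rewrite nrmN nrmZ; apply: lerD; last first.
  by rewrite ler_wpM2l//; lra.
by apply: le_trans (nrm_cmul _ bM) _; rewrite ler_wpM2l.
Qed.

Lemma nrm2_Bop2 p : nrm2 (Bop2 p) <= L * nrm2 p.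
Proof.
have := nrm_Bop be p.1 p.2; have := nrm_Bop (- be) p.2 p.1.
by rewrite /nrm2 /L normrN /=; lra.
Qed.

(** The part of [Kop] after [Bop2] that lives above frequency [N]; its norm is O(1 / N), hence a
    contraction for large [N]. *)
Definition highpart N p : VV :=
  (Kop ((Bop2 p).1 - proj N (Bop2 p).1), Kop ((Bop2 p).2 - proj N (Bop2 p).2)).

Lemma highpart_is_linear N : linear (highpart N).
Proof.
move=> c p p'; rewrite /highpart linearP; congr (_, _).
  rewrite [(_ + _).1]/=; rewrite linearP opprD addrACA -scalerBr.
  by rewrite linearP.
rewrite [(_ + _).2]/=; rewrite linearP opprD addrACA -scalerBr.
by rewrite linearP.
Qed.
HB.instance Definition _ N :=
  GRing.isLinear.Build R VV VV *:%R (highpart N) (highpart_is_linear N).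

Lemma nrm_Kop_subproj N u : nrm (Kop (u - proj N u)) <= N.+1%:R^-1 * nrm u.
Proof.
have pu : proj N (u - proj N u) = 0 by rewrite linearB /= proj_proj// subrr.
rewrite mulrC ler_pdivlMr ?ltr0n// mulrC.
exact: le_trans (poincare pu) (nrm_subproj N u).
Qed.

Lemma nrm2_highpart N p : nrm2 (highpart N p) <= (L / N.+1%:R) * nrm2 p.
Proof.
apply: le_trans (_ : N.+1%:R^-1 * nrm2 (Bop2 p) <= _).
  by rewrite /nrm2 mulrDr; exact: lerD (nrm_Kop_subproj _ _) (nrm_Kop_subproj _ _).
by rewrite (mulrC L) -mulrA ler_wpM2l ?invr_ge0// nrm2_Bop2.
Qed.

Let highpart_sup N u p : nrm u <= nrm2 (Bop2 p) -> forall z,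
  `|Kop (u - proj N u) z| <= Num.sqrt (pi *+ 2) * L * nrm2 p.
Proof.
move=> un z; apply: le_trans (Kop_sup _ _) _.
rewrite -mulrA ler_wpM2l ?sqrtr_ge0//.
apply: le_trans (nrm_subproj _ _) _; apply: le_trans un _; exact: nrm2_Bop2.
Qed.

Lemma highpart_sup1 N p z :
  `|(highpart N p).1 z| <= Num.sqrt (pi *+ 2) * L * nrm2 p.
Proof. by apply: highpart_sup; rewrite /nrm2 lerDl nrm_ge0. Qed.

Lemma highpart_sup2 N p z :
  `|(highpart N p).2 z| <= Num.sqrt (pi *+ 2) * L * nrm2 p.
Proof. by apply: highpart_sup; rewrite /nrm2 lerDr nrm_ge0. Qed.

Let L0 : 0 <= L. Proof. by rewrite !addr_ge0. Qed.

Definition resolvent_eq p F := p.1 = Kop ((Bop2 p).1 - F.1) /\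
  p.2 = Kop ((Bop2 p).2 - F.2).

(** Frequency, then component of the pair ([true] is the first), then cosine ([true]) or sine. *)
Definition low_index N := ('I_N * (bool * bool))%type.

Definition low_mode (n : nat) (j : bool) : V :=
  if j then cosn n.+1 else sinn n.+1.

Definition low_functional N (t : low_index N) p : R :=
  dot (if t.2.1 then (Bop2 p).1 else (Bop2 p).2) (low_mode t.1 t.2.2) / pi.

Definition low_vector N (t : low_index N) : VV :=
  if t.2.1 then (Kop (low_mode t.1 t.2.2), 0)
  else (0, Kop (low_mode t.1 t.2.2)).

Lemma low_sum N p : \sum_(t : low_index N) low_functional t p *: low_vector t =
  (Kop (proj N (Bop2 p).1), Kop (proj N (Bop2 p).2)).
Proof.
rewrite -(pair_bigA _ (fun n t => low_functional (n, t) p *: low_vector (n, t))).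
rewrite /proj !linear_sum /=.
transitivity (\sum_(n < N) (Kop (mode n (Bop2 p).1), Kop (mode n (Bop2 p).2)) : VV).
  apply: eq_bigr => n _.
  rewrite -(pair_bigA _ (fun i j => low_functional (n, (i, j)) p *:
    low_vector (n, (i, j)))) !big_bool /=.
  rewrite /mode !linearD !linearZ /low_functional /low_vector /low_mode.
  rewrite [t in _ = t]surjective_pairing.
  congr (_, _).
    by rewrite [LHS]/= !scaler0 !addr0.
  by rewrite [LHS]/= !scaler0 !add0r.
elim/big_rec3 : _ => // n w v u _ ->.
by [].
Qed.

Lemma resolvent_split N p F : resolvent_eq p F <->
  p = - (Kop F.1, Kop F.2) + highpart N p +
      \sum_(t : low_index N) low_functional t p *: low_vector t.
Proof.
rewrite low_sum /highpart.
have E u f : - Kop f + Kop (u - proj N u) + Kop (proj N u) = Kop (u - f).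
  by rewrite -addrA -linearD /= subrK addrC linearB.
split=> [[h1 h2]|h].
  by rewrite [LHS]surjective_pairing; congr (_, _); rewrite [RHS]E.
by split; [rewrite {1}h|rewrite {1}h]; rewrite [LHS]E.
Qed.

Theorem resolvent_exists :
  (forall p, resolvent_eq p 0 -> p = 0) ->
  exists M, forall F, exists2 p, resolvent_eq p F & nrm2 p <= M * nrm2 F.
Proof.
(* Then L < N + 1, so the high part is a strict contraction. *)
move=> inj; pose N := Num.truncn L.
have LN : L / N.+1%:R < 1.
  by rewrite ltr_pdivrMr ?ltr0n// mul1r; exact: truncnS_gt.
have LN0 : 0 <= L / N.+1%:R by rewrite divr_ge0.
pose m := #|{: low_index N}|.
pose phi (j : 'I_m) p := low_functional (enum_val j) p.
pose psi (j : 'I_m) := low_vector (enum_val j).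
have sumE p : \sum_j phi j p *: psi j =
    \sum_(t : low_index N) low_functional t p *: low_vector t.
  by rewrite (big_enum_val (fun t => low_functional t p *: low_vector t)).
have lphi j : linear_for *%R (phi j).
  move=> c p p'; rewrite /phi /low_functional linearP.
  by case: (enum_val j) => n [[] i] /=; rewrite !(dotDl, dotZl) mulrDl mulrA.
pose e : R := Num.sqrt (pi *+ 2).
have modeb n j : nrm (low_mode n j) <= e.
  rewrite -[e]mul1r; apply: nrm_le_sup => z.
  by rewrite /low_mode; case: j; rewrite ?cosnE ?sinnE ?cos_max ?sin_max.
have bphi j p : `|phi j p| <= (L * e / pi) * nrm2 p.
  rewrite /phi /low_functional normrM (ger0_norm (_ : 0 <= pi^-1)); last first.
    by rewrite invr_ge0 pi_ge0.
  rewrite [X in _ <= X]mulrAC ler_wpM2r ?invr_ge0 ?pi_ge0//.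
  apply: le_trans (cauchy_schwarz _ _) _; rewrite mulrAC ler_pM ?nrm_ge0//.
  apply: le_trans (nrm2_Bop2 p); case: (enum_val j) => n [[] i];
    by rewrite /nrm2 ?lerDl ?lerDr nrm_ge0.
have inj' p : p = highpart N p + \sum_j phi j p *: psi j -> p = 0.
  rewrite sumE => pE; apply: inj; apply/(resolvent_split N).
  rewrite [- _](_ : _ = 0) ?add0r//.
  by congr (_, _); rewrite [Kop _](linear0 Kop) oppr0.
have [M hM] := @fredholm R (highpart N) _ _ LN0 LN (nrm2_highpart N)
  (highpart_sup1 N) (highpart_sup2 N) m phi psi _ lphi bphi inj'.
(* The constant multiplies the norm of [Kop F]; it must be nonnegative before that norm is replaced
   by the larger norm of [F]. *)
have [Mneg|M0] := ltP M 0.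
  exists 0 => F; have [p pE pM] := hM (- (Kop F.1, Kop F.2)).
  exists p; first by apply/(resolvent_split N); rewrite -sumE.
  rewrite mul0r; apply: le_trans pM _.
  by rewrite mulr_le0_ge0 ?nrm2_ge0// ltW.
exists M => F; have [p pE pM] := hM (- (Kop F.1, Kop F.2)).
exists p; first by apply/(resolvent_split N); rewrite -sumE.
apply: le_trans pM _; rewrite ler_wpM2l// nrm2N.
by rewrite /nrm2 lerD ?nrm_Kop.
Qed.

Lemma weak_of_strong s u v f : u = Kop (Bop s u v - f) ->
  itau u = 0 /\ forall q, form b 0 x u q =
    - al * kap u q + s * kap v q + dot f (Kop q).
Proof.
move=> uE; split=> [|q]; first by rewrite uE itau_Kop.
have : dot u q = - dot (Bop s u v - f) (Kop q) by rewrite {1}uE Kop_skew.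
rewrite /form /kap /Bop !(dotDl, dotNl, dotZl) (Kop_skew (Kop (Kop u)) (Kop q)).
by move=> ->; ring.
Qed.

Lemma strong_of_weak s u v f : itau u = 0 ->
  (forall q, itau q = 0 -> form b 0 x u q =
    - al * kap u q + s * kap v q + dot f (Kop q)) ->
  u = Kop (Bop s u v - f).
Proof.
move=> u0 H; apply/eqP; rewrite -subr_eq0; apply/eqP/dot_itau0.
  by rewrite linearB /= u0 itau_Kop subr0.
move=> q q0; rewrite dotBl Kop_skew; have := H q q0.
rewrite /form /kap /Bop !(dotDl, dotNl, dotZl) (Kop_skew (Kop (Kop u)) (Kop q)).
by lra.
Qed.

Lemma kernel_resolvent p : resolvent_eq p 0 -> kernel_eq b x al be p.
Proof.
move=> [h1 h2]; have [p0 H1] := weak_of_strong h1.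
have [r0 H2] := weak_of_strong h2; split=> // q _.
by rewrite H1 H2 !dot0l; split; ring.
Qed.

End ResolventEquation.

(** * Reflection symmetry *)

Section Reflection.
Context {R : realType}.
Local Notation V := (cper R).
Implicit Types (u v : V).
Local Notation tau := (pi *+ 2 : R).

Let is_derive_opp (z : R) : is_derive z (1 : R) (fun x : R => - x) (- 1).
Proof. exact: is_deriveN (is_derive_id z (1 : R)). Qed.

Definition refl u : V.
Proof.
apply: (@mkcper _ (fun z => u (- z))) => z.
  apply: (@continuous_comp _ _ _ (fun x : R => - x) u z).
    2: exact: cper_continuous.
  by apply: cvgN; exact: cvg_id.
by rewrite opprD -[LHS](cper_periodic u) subrK.
Defined.

Lemma reflE u z : refl u z = u (- z). Proof. by []. Qed.

Lemma refl_is_linear : linear refl.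
Proof. by move=> c u v; apply: cperP => z; rewrite !(cperE, reflE). Qed.
HB.instance Definition _ := GRing.isLinear.Build R V V *:%R refl refl_is_linear.

Lemma itau_refl u : itau (refl u) = itau u.
Proof.
have dF (z : R) : is_derive z 1 (fun x => - prim u (- x)) (refl u z).
  have D := is_derive_prim (- z) (@cper_continuous _ u).
  have := is_deriveN (@is_derive1_comp R (prim u) (fun x => - x) z _ _ D (is_derive_opp z)).
  by rewrite mulrN1 opprK.
rewrite !itauE (oint_derive 0 tau (@cper_continuous _ (refl u)) dF) oppr0 prim0 oppr0 subr0.
have := oint_periodic (- tau) (cper_locint u) (@cper_periodic _ u).
rewrite addNr => <-; rewrite oint_prim ?prim0 ?sub0r//; exact: cper_locint.
Qed.

Lemma dot_refl u v : dot (refl u) (refl v) = dot u v.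
Proof. by rewrite /dot -[RHS]itau_refl; congr itau; apply: cperP. Qed.

Lemma refl_cst c : refl (ccst c) = ccst c.
Proof. exact: cperP. Qed.

Lemma Kop_refl u : Kop (refl u) = - refl (Kop u).
Proof.
have cr : center (refl u) = refl (center u).
  by rewrite /center /mean itau_refl linearB /= refl_cst.
have dF (z : R) : is_derive z 1 (- refl (Kop u)) (refl (center u) z).
  have D := Kop_derive u (- z).
  have := is_deriveN (@is_derive1_comp R (Kop u) (fun x => - x) z _ _ D (is_derive_opp z)).
  by rewrite mulrN1 opprK.
have E := @Kop_unique R (- refl (Kop u)) (refl (center u)) dF.
rewrite -Kop_center cr [LHS]E center_id//.
by rewrite linearN /= itau_refl itau_Kop oppr0.
Qed.

Lemma refl_cmul u v : refl (cmul u v) = cmul (refl u) (refl v).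
Proof. exact: cperP. Qed.

Lemma refl_sinn n : refl (sinn n) = - sinn n.
Proof. by apply: cperP => z; rewrite reflE cperN !sinnE mulrN sinN. Qed.

Lemma refl_cosn n : refl (cosn n) = cosn n.
Proof. by apply: cperP => z; rewrite reflE !cosnE mulrN cosN. Qed.

Lemma form_refl (b : V) x p q : refl b = b ->
  form b 0 x (refl p) (refl q) = form b 0 x p q.
Proof.
move=> rb; have K1 w : Kop (refl w) = - refl (Kop w) := Kop_refl w.
have K2 w : Kop (Kop (refl w)) = refl (Kop (Kop w)).
  by rewrite K1 linearN /= K1 opprK.
rewrite /form !mul0r !K2 !K1 !dot_refl; congr (_ - _ + _ + _).
have -> : cmul b (- refl (Kop p)) = - cmul b (refl (Kop p)).
  by apply: cperP => z; rewrite !(cperE, cmulE) mulrN.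
rewrite dotNl dotNr opprK.
by rewrite -[X in cmul X _]rb -refl_cmul dot_refl.
Qed.

End Reflection.

(** * Lyapunov-Schmidt reduction *)

Section LyapunovSchmidt.
Context {R : realType}.
Local Notation V := (cper R).
Implicit Types (p q r v y g h w : V) (x lam : R).
Local Notation s1 := (sinn 1 : V).
Local Notation c1 := (cosn 1 : V).

Lemma Kop_s1 : Kop s1 = - c1.
Proof. by rewrite Kop_sinn invr1 scaleN1r. Qed.
Lemma Kop_c1 : Kop c1 = s1.
Proof. by rewrite Kop_cosn invr1 scale1r. Qed.
Lemma dot_s1s1 : dot s1 s1 = pi. Proof. by rewrite dot_sinn_sinn eqxx. Qed.
Lemma dot_c1c1 : dot c1 c1 = pi. Proof. by rewrite dot_cosn_cosn eqxx. Qed.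
Lemma dot_s1c1 : dot s1 c1 = 0. Proof. exact: dot_sinn_cosn. Qed.
Lemma dot_c1s1 : dot c1 s1 = 0. Proof. exact: dot_cosn_sinn. Qed.
Let pi_neq0 : pi != 0 :> R. Proof. exact: lt0r_neq0 (pi_gt0 R). Qed.

Definition inW q := [/\ itau q = 0, dot q s1 = 0 & dot q c1 = 0].

Lemma inWB p q : inW p -> inW q -> inW (p - q).
Proof.
move=> [a1 a2 a3] [b1 b2 b3].
by split; rewrite ?dotBl ?linearB /= ?a1 ?a2 ?a3 ?b1 ?b2 ?b3 subrr.
Qed.

Lemma inW_proj q : inW q -> proj 1 q = 0.
Proof.
move=> [_ qs qc]; rewrite projS proj0 add0r /mode qs qc mul0r !scale0r addr0 //.
Qed.

Lemma inW_Kop q : inW q -> 2 * nrm (Kop q) <= nrm q.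
Proof. by move=> /inW_proj; exact: poincare. Qed.

Definition low g := g = s1 \/ g = c1.

Lemma low_itau g : low g -> itau g = 0.
Proof. by move=> [|] ->; rewrite ?itau_sinn ?itau_cosn. Qed.
Lemma low_inW g q : low g -> inW q -> dot g q = 0.
Proof. by move=> lg [_ h1 h2]; rewrite dotC; case: lg => ->. Qed.
Lemma low_nrm g : low g -> nrm g = Num.sqrt pi.
Proof. by move=> [|] ->; rewrite /nrm ?dot_s1s1 ?dot_c1c1. Qed.
Lemma low_Kop2 g : low g -> Kop (Kop g) = - g.
Proof. by move=> [|] ->; rewrite ?Kop_s1 ?Kop_c1 ?linearN /= ?Kop_s1 ?Kop_c1. Qed.

Lemma low_decomposition q : itau q = 0 ->
  inW (q - ((dot q s1 / pi) *: s1 + (dot q c1 / pi) *: c1)).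
Proof.
move=> q0; split.
- by rewrite linearB linearD !linearZ /= itau_sinn itau_cosn q0 !mulr0 addr0 subrr.
- by rewrite dotBl dotDl !dotZl dot_s1s1 dot_c1s1 mulr0 addr0 divfK// subrr.
- by rewrite dotBl dotDl !dotZl dot_c1c1 dot_s1c1 mulr0 add0r divfK// subrr.
Qed.

Context (b : V).
Hypothesis bM : forall z, `|b z| <= 3 / 2.
Local Notation form := (form b).

(** Without the first modes [Kop] halves the norm, so the potential costs at most (3/2)(1/4) = 3/8
    of [nrm q ^+ 2]. *)
Lemma form_coercive x q : 0 <= x -> inW q -> 2^-1 * nrm q ^+ 2 <= form 0 x q q.
Proof.
move=> x0 qW; have hK := inW_Kop qW; rewrite nrm_sqr.
have h1 : dot (cmul b (Kop q)) (Kop q) <= 3 / 2 * nrm (Kop q) ^+ 2.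
  apply: le_trans (dot_le _ _) _; rewrite expr2 mulrA ler_wpM2r ?nrm_ge0//.
  exact: nrm_cmul.
have h2 : (2 * nrm (Kop q)) ^+ 2 <= nrm q ^+ 2.
  by rewrite lerXn2r ?nnegrE ?mulr_ge0 ?nrm_ge0.
have h3 : 0 <= x * dot (Kop (Kop q)) (Kop (Kop q)) by rewrite mulr_ge0 ?dot_ge0.
move: h2; rewrite exprMn nrm_sqr (_ : 2 ^+ 2 = 4); last by rewrite -natrX.
have := dot_ge0 q; rewrite /form mul0r addr0; lra.
Qed.

(** The four terms cost 1, 3/2, 1 and 1, rounded up to 5. *)
Lemma form_bound lam x p q : `|x| <= 1 -> `|lam| <= 1 ->
  `|form lam x p q| <= 5 * nrm p * nrm q.
Proof.
move=> x1 l1; have np := nrm_Kop p; have npp := nrm_Kop (Kop p).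
have nq := nrm_Kop q; have nqq := nrm_Kop (Kop q).
have bd u v m : nrm u <= m * nrm p -> nrm v <= nrm q -> 0 <= m ->
    `|dot u v| <= m * (nrm p * nrm q).
  move=> hu hv m0; apply: le_trans (cauchy_schwarz _ _) _.
  by rewrite mulrA ler_pM ?nrm_ge0.
have h1 : `|dot p q| <= 1 * (nrm p * nrm q) by apply: bd; rewrite ?mul1r.
have h2 : `|dot (cmul b (Kop p)) (Kop q)| <= 3 / 2 * (nrm p * nrm q).
  apply: bd; [|exact: nq|lra].
  by apply: le_trans (nrm_cmul _ bM) _; rewrite ler_wpM2l//; lra.
have h3 : `|x * dot (Kop (Kop p)) (Kop (Kop q))| <= 1 * (nrm p * nrm q).
  rewrite normrM ler_pM//; rewrite -[X in _ <= X]mul1r; apply: bd; [rewrite mul1r; lra|lra|lra].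
have h4 : `|lam * kap p q| <= 1 * (nrm p * nrm q).
  rewrite normrM ler_pM//; rewrite -[X in _ <= X]mul1r; apply: bd; [rewrite mul1r; lra|lra|lra].
have pq0 : 0 <= nrm p * nrm q by rewrite mulr_ge0 ?nrm_ge0.
rewrite /form -mulrA; apply: le_trans (ler_normD _ _) _.
apply: le_trans (lerD (ler_normD _ _) (lexx _)) _.
apply: le_trans (lerD (lerD (ler_normB _ _) (lexx _)) (lexx _)) _; lra.
Qed.

Definition LS lam x g y := inW (y - g) /\ forall q, inW q -> form lam x y q = 0.

(** The part above frequency 1 has norm at most (3/2 + 1/8 + 1/8) / 2 = 7/8, so the Neumann series
    with source [g] converges. *)
Lemma LS_exists lam x g : 0 <= x <= 1 / 8 -> `|lam| <= 1 / 8 -> low g ->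
  exists y, LS lam x g y.
Proof.
move=> /andP[x0 x8] l8 lg.
pose L := 3 / 2 + `|x| + `|lam| + `|0 : R|.
have Lx : L / 2%:R < 1 by rewrite /L normr0 (ger0_norm x0); lra.
have L0 : 0 <= L / 2%:R by rewrite /L normr0 (ger0_norm x0); have := normr_ge0 lam; lra.
have [p pE] := @neumann_exists R (highpart b x lam 0 1) _ _ L0 Lx
  (nrm2_highpart x lam 0 bM 1) (highpart_sup1 x lam 0 bM 1)
  (highpart_sup2 x lam 0 bM 1) (g, 0).
pose B := Bop b x lam 0 p.1 p.2.
have yE : p.1 = g + Kop (B - proj 1 B) by rewrite {1}pE.
exists p.1; split.
  have pz : proj 1 (Kop (B - proj 1 B)) = 0.
    by rewrite -Kop_proj linearB /= proj_proj// subrr linear0.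
  have ed h : low h -> dot (Kop (B - proj 1 B)) h = 0.
    move=> lh; have <- : proj 1 h = h.
      rewrite projS proj0 add0r /mode; case: lh => ->.
        by rewrite dot_s1s1 dot_s1c1 mul0r scale0r add0r divff// scale1r.
      by rewrite dot_c1c1 dot_c1s1 mul0r scale0r addr0 divff// scale1r.
    by rewrite -dot_proj pz dot0l.
  by rewrite yE addrAC subrr add0r; split;
    [exact: itau_Kop|apply: ed; left|apply: ed; right].
move=> q qW; have [q0 _ _] := qW.
have hq : dot p.1 q = - dot B (Kop q).
  rewrite yE dotDl (low_inW lg qW) add0r Kop_skew dotBl dot_proj.
  by rewrite -Kop_proj (inW_proj qW) linear0 dot0r subr0.
rewrite /form /kap hq /B /Bop !(dotDl, dotNl, dotZl).
rewrite (Kop_skew (Kop (Kop p.1)) (Kop q)); ring.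
Qed.

Lemma LS_itau lam x g y : low g -> LS lam x g y -> itau y = 0.
Proof.
by move=> lg [[h _ _] _]; move: h; rewrite linearB /= (low_itau lg) subr0.
Qed.

Lemma LS_dot lam x g y h : low h -> LS lam x g y -> dot y h = dot g h.
Proof.
move=> lh [W _]; apply/eqP; rewrite -subr_eq0 -dotBl dotC.
by rewrite (low_inW lh W).
Qed.

Lemma half_sqr_le (a c : R) : 0 <= a -> 2^-1 * a ^+ 2 <= c * a -> 0 <= c ->
  a <= 2 * c.
Proof.
move=> a0 h c0; have [->|an0] := eqVneq a 0; first by rewrite mulr_ge0.
have ap : 0 < a by rewrite lt_neqAle eq_sym an0.
by move: h; rewrite expr2 mulrA ler_pM2r//; lra.
Qed.

(** Coercivity bounds the correction [y - g] by 2 * 5 times [nrm g], and [g] itself adds one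
    more. *)
Lemma LS_bound lam x g y : 0 <= x <= 1 -> `|lam| <= 1 -> low g ->
  LS lam x g y -> nrm y <= 11 * nrm g.
Proof.
move=> /andP[x0 x1] l1 lg [W H]; have x1' : `|x| <= 1 by rewrite ger0_norm.
have co := form_coercive x0 W.
have E : form 0 x (y - g) (y - g) = - form lam x g (y - g).
  by rewrite -(form_self b lam) [LHS]formBl (H _ W) sub0r.
have bd : 2^-1 * nrm (y - g) ^+ 2 <= 5 * nrm g * nrm (y - g).
  apply: le_trans co _; rewrite E.
  by apply: le_trans (form_bound _ _ x1' l1); rewrite -normrN ler_norm.
have := half_sqr_le (nrm_ge0 _) bd; rewrite mulr_ge0 ?nrm_ge0// => /(_ isT) h.
have := nrmD (y - g) g; rewrite subrK; lra.
Qed.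

Lemma form_param lam x lam' x' p q : form lam' x' p q = form lam x p q +
  ((x' - x) * dot (Kop (Kop p)) (Kop (Kop q)) + (lam' - lam) * kap p q).
Proof. by rewrite /form; ring. Qed.

Lemma param_bound (c d : R) p q :
  `|c * dot (Kop (Kop p)) (Kop (Kop q)) + d * kap p q| <=
  (`|c| + `|d|) * (nrm p * nrm q).
Proof.
have np := nrm_Kop p; have npp := nrm_Kop (Kop p).
have nq := nrm_Kop q; have nqq := nrm_Kop (Kop q).
apply: le_trans (ler_normD _ _) _; rewrite mulrDl !normrM; apply: lerD.
  rewrite ler_wpM2l//; apply: le_trans (cauchy_schwarz _ _) _.
  by rewrite ler_pM ?nrm_ge0//; lra.
rewrite ler_wpM2l//; apply: le_trans (cauchy_schwarz _ _) _.
by rewrite ler_pM ?nrm_ge0//; lra.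
Qed.

(** The constant is 11 pi, from the change of parameters at fixed [y], plus 5 * 2 * 11 pi, from the
    change of [y], which coercivity controls. *)
Lemma LS_lipschitz lam x lam' x' g h y y' : 0 <= x <= 1 -> 0 <= x' <= 1 ->
  `|lam| <= 1 -> `|lam'| <= 1 -> low g -> low h ->
  LS lam x g y -> LS lam' x' g y' ->
  `|form lam' x' y' h - form lam x y h| <= (121 * pi) * (`|x' - x| + `|lam' - lam|).
Proof.
move=> x01 x01' l1 l1' lg lh Ly Ly'.
have ny := LS_bound x01 l1 lg Ly.
have [W H] := Ly; have [W' H'] := Ly'.
have /andP[x0' x1'] := x01'; have xn' : `|x'| <= 1 by rewrite ger0_norm.
set De := `|x' - x| + `|lam' - lam|; have De0 : 0 <= De by rewrite addr_ge0.
have dW : inW (y' - y).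
  by have := inWB W' W; rewrite opprB addrA subrK.
set d := y' - y in dW *.
have y'E : y' = y + d by rewrite /d addrC subrK.
have co := form_coercive x0' dW.
have E : form 0 x' d d = - ((x' - x) * dot (Kop (Kop y)) (Kop (Kop d)) +
    (lam' - lam) * kap y d).
  have := form_param lam x lam' x' y d; rewrite (H d dW) add0r => <-.
  by rewrite -(form_self b lam') {1}/d formBl (H' d dW) sub0r.
have nd : nrm d <= 2 * (De * nrm y).
  apply: half_sqr_le; rewrite ?mulr_ge0 ?nrm_ge0//; apply: le_trans co _.
  rewrite E -mulrA; apply: le_trans (param_bound _ _ _ _).
  by rewrite -normrN ler_norm.
rewrite y'E formDl (form_param lam x) [X in `|X|](_ : _ =
  ((x' - x) * dot (Kop (Kop y)) (Kop (Kop h)) + (lam' - lam) * kap y h) +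
  form lam' x' d h); last by ring.
apply: le_trans (ler_normD _ _) _.
have h1 := param_bound (x' - x) (lam' - lam) y h; rewrite -/De in h1.
have h2 := form_bound d h xn' l1'.
have hn := nrm_ge0 h; have yn := nrm_ge0 y.
have pih : nrm g * nrm h = pi by rewrite !low_nrm// -expr2 sqr_sqrtr// pi_ge0.
have k1 : nrm y * nrm h <= 11 * pi.
  by rewrite -pih mulrA ler_wpM2r.
have k2 : De * (nrm y * nrm h) <= De * (11 * pi) by rewrite ler_wpM2l.
have k3 : nrm d * nrm h <= 2 * (De * nrm y) * nrm h by rewrite ler_wpM2r.
move: h1 h2 k2 k3; rewrite -[5 * nrm d * _]mulrA -[2 * _ * nrm h]mulrA.
rewrite -[De * nrm y * _]mulrA => h1 h2 k2 k3; lra.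
Qed.

Lemma LS_unique lam x g y y' : 0 <= x -> LS lam x g y -> LS lam x g y' -> y = y'.
Proof.
move=> x0 [W H] [W' H'].
have dW : inW (y - y') by have := inWB W W'; rewrite opprB addrA subrK.
have := form_coercive x0 dW; rewrite -(form_self b lam) formBl (H _ dW) (H' _ dW).
rewrite subrr => h; apply/eqP; rewrite -subr_eq0; apply/eqP/nrm_eq0/eqP.
have : nrm (y - y') ^+ 2 <= 0 by lra.
by rewrite le_eqVlt ltNge sqr_ge0 orbF sqrf_eq0.
Qed.

(** [- refl y] solves the same problem, so [y] is odd by uniqueness, and the energy pairs odd with
    even functions to zero. *)
Lemma LS_odd x y : 0 <= x -> refl b = b -> LS 0 x s1 y -> form 0 x y c1 = 0.
Proof.
move=> x0 rb Ly; have [W H] := Ly.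
have rs : refl s1 = - s1 := refl_sinn 1; have rc : refl c1 = c1 := refl_cosn 1.
have rr p : refl (refl p) = p by apply: cperP => z; rewrite !reflE opprK.
have Wr q : inW q -> inW (refl q).
  move=> [q0 qs qc]; split; first by rewrite itau_refl.
    by rewrite -[s1]opprK -rs dotNr dot_refl qs oppr0.
  by rewrite -rc dot_refl.
have Wn q : inW q -> inW (- q).
  by move=> [q0 qs qc]; split; rewrite ?dotNl ?linearN /= ?q0 ?qs ?qc oppr0.
have Lr : LS 0 x s1 (- refl y).
  split.
    have := Wn _ (Wr _ W); rewrite linearB /= rs opprB addrC => W2.
    by rewrite (_ : - refl y - s1 = - s1 - refl y) // addrC.
  move=> q qW; rewrite -scaleN1r formZl -[q]rr form_refl//.
  by rewrite (H _ (Wr _ qW)) mulr0.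
have yr := LS_unique x0 Ly Lr.
have := form_refl x y c1 rb; rewrite rc.
have -> : refl y = - y by rewrite {2}yr opprK.
by rewrite -scaleN1r formZl; lra.
Qed.

End LyapunovSchmidt.

Section LipschitzWithin.
Context {R : realType}.

Lemma lipschitz_within_continuous (f : R -> R) (a c k : R) :
  (forall x y, a <= x <= c -> a <= y <= c -> `|f x - f y| <= k * `|x - y|) ->
  {within `[a, c], continuous f}.
Proof.
move=> fk; apply/subspace_continuousP => x /=; rewrite in_itv/= => xac.
apply/cvgrPdist_lt => e e0.
pose k' := `|k| + 1; have k'0 : 0 < k' by rewrite ltr_wpDl.
have ek : 0 < e / k' by rewrite divr_gt0.
near=> y.
have yac : a <= y <= c.
  have : `[a, c]%classic y by near: y; exact: withinT.
  by rewrite /= in_itv.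
have xy : `|x - y| < e / k'.
  near: y; apply: cvg_within; near=> y; near: y.
  have /cvgrPdist_lt/(_ _ ek) := @cvg_id _ (nbhs x); exact.
apply: le_lt_trans (fk _ _ xac yac) _.
move: xy; rewrite ltr_pdivlMr// mulrC; apply: le_lt_trans.
by rewrite ler_wpM2r// /k' (le_trans (ler_norm k))// lerDl.
Unshelve. all: by end_near. Qed.

End LipschitzWithin.

(** * Sign of the energy and existence of real eigenvalues *)

Section SpectralDichotomy.
Context {R : realType}.
Local Notation V := (cper R).
Implicit Types (p q r v y g h w : V) (x lam : R).
Local Notation s1 := (sinn 1 : V).
Local Notation c1 := (cosn 1 : V).

Context (b : V).
Hypothesis bM : forall z, `|b z| <= 3 / 2.
Hypothesis b_even : refl b = b.
Local Notation form := (form b).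
Local Notation LS := (LS b).

(* The derivative of the travelling wave spans the odd part of the kernel of
   [M] at [x = 0]; [p0] is its derivative. *)
Context (p0 : V).
Hypotheses (p0_itau : itau p0 = 0) (p0_sin : dot p0 s1 = 0)
  (p0_cos : dot p0 c1 != 0)
  (p0_ker : forall q, itau q = 0 -> form 0 0 p0 q = 0).

(** Since [p0] has a nonzero cosine coefficient, [p] is a multiple of [p0] plus an element of [inW];
    the first lies in the radical of E_0 and E_0 is coercive on the second. *)
Lemma energy_nonneg x p : 0 <= x -> itau p = 0 -> dot p s1 = 0 ->
  0 <= form 0 x p p.
Proof.
move=> x0 pz ps.
have [v [t [vW pE]]] : exists v t, inW v /\ p = v + t *: p0.
  pose t := dot p c1 / dot p0 c1; exists (p - t *: p0), t.
  split; last by rewrite subrK.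
  split; first by rewrite linearB linearZ /= pz p0_itau mulr0 subr0.
    by rewrite dotBl dotZl ps p0_sin mulr0 subr0.
  by rewrite dotBl dotZl divfK// subrr.
have [vz _ _] := vW.
have E : form 0 0 p p = form 0 0 v v.
  rewrite pE !form_linE (form0C b 0 v p0) (p0_ker vz) (p0_ker p0_itau).
  by rewrite !mulr0 !addr0.
rewrite formEx E addr_ge0// ?mulr_ge0 ?dot_ge0//.
by apply: le_trans (form_coercive bM (lexx 0) vW); rewrite mulr_ge0 ?sqr_ge0.
Qed.

(** As E_0 is nonnegative here, the term x |Kop^2 p|^2 has to vanish. *)
Lemma energy_index1 x p : 0 < x -> itau p = 0 -> dot p s1 = 0 ->
  form 0 x p p <= 0 -> p = 0.
Proof.
move=> x0 pz ps; have := energy_nonneg (lexx 0) pz ps.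
rewrite [X in X <= 0]formEx => h1 h2.
have /dot_eq0 : dot (Kop (Kop p)) (Kop (Kop p)) = 0.
  apply/eqP; rewrite eq_le dot_ge0 andbT -(pmulr_rle0 _ x0); lra.
by move=> /Kop_inj/(_ (itau_Kop _))/Kop_inj/(_ pz).
Qed.

Lemma form_from_low lam x p : itau p = 0 -> (forall q, inW q -> form lam x p q = 0) ->
  form lam x p s1 = 0 -> form lam x p c1 = 0 ->
  forall q, itau q = 0 -> form lam x p q = 0.
Proof.
move=> pz pW ps pc q qz; have := pW _ (low_decomposition qz).
by rewrite formBr formDr !formZr ps pc !mulr0 addr0 subr0.
Qed.

Lemma LS_form lam x g y y' : LS lam x g y -> forall h, LS lam x h y' ->
  form lam x y y' = form lam x y h.
Proof.
move=> [W H] h [W' H']; have := H _ W'; rewrite formBr => /eqP.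
by rewrite subr_eq0 => /eqP.
Qed.

(** Whatever the higher modes of [y], the sine component of Kop^2 y is - sin. This bounds the slope
    of s from below. *)
Lemma nrm_Kop2_LS x y : LS 0 x s1 y -> pi <= dot (Kop (Kop y)) (Kop (Kop y)).
Proof.
move=> Ly; have ls : low s1 by left.
have E : dot (Kop (Kop y)) s1 = - pi.
  rewrite dot_Kop2 (low_Kop2 ls) dotNr.
  by rewrite (LS_dot ls Ly) dot_s1s1.
have := cauchy_schwarz (Kop (Kop y)) s1; rewrite E normrN ger0_norm ?pi_ge0//.
rewrite (low_nrm ls) -ler_pdivrMr ?sqrtr_gt0 ?pi_gt0//.
have -> : pi / Num.sqrt pi = Num.sqrt pi :> R.
  by rewrite -{1}(sqr_sqrtr (pi_ge0 R)) expr2 mulfK// gt_eqF// sqrtr_gt0 pi_gt0.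
by rewrite /nrm ler_sqrt// ?dot_ge0// ?pi_ge0.
Qed.

(** s(x) is the minimum of E_x over sin + [inW], attained at [y], and [y'] is a competitor. The
    order of [x] and [x'] is free, so the slope is bounded from both sides. *)
Lemma LS_monotone x x' y y' : 0 <= x -> LS 0 x s1 y -> LS 0 x' s1 y' ->
  form 0 x y s1 + (x' - x) * dot (Kop (Kop y')) (Kop (Kop y')) <=
  form 0 x' y' s1.
Proof.
move=> x0 Ly Ly'.
rewrite -(LS_form Ly Ly) -(LS_form Ly' Ly') (formEx b x').
rewrite mulrBl addrCA -[X in _ <= X]addrC lerD2l lerBlDr -formEx.
have [W H] := Ly; have [W' H'] := Ly'.
have [d dW ->] : exists2 d, inW d & y' = y + d.
  exists (y' - y); last by rewrite addrC subrK.
  by have := inWB W' W; rewrite opprB addrA subrK.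
rewrite !form_linE (form0C b x d y) (H _ dW).
rewrite add0r addr0 lerDl.
by apply: le_trans (form_coercive bM x0 dW); rewrite mulr_ge0 ?sqr_ge0.
Qed.

Definition LSsol lam x g : V := xget 0 [set y | LS lam x g y].

Lemma LSsolP lam x g : 0 <= x <= 1 / 8 -> `|lam| <= 1 / 8 -> low g ->
  LS lam x g (LSsol lam x g).
Proof. by move=> hx hl lg; apply: xgetPex; exact: LS_exists. Qed.

Let s x := form 0 x (LSsol 0 x s1) s1.

(** The slope of s is at least pi, so s(1 / 16) > 0, and s is Lipschitz. *)
Lemma threshold_exists : s 0 <= 0 -> - pi / 16 < s 0 ->
  exists x0 y0, [/\ 0 <= x0 <= 1 / 16, LS 0 x0 s1 y0 & form 0 x0 y0 s1 = 0].
Proof.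
move=> s0 s0'; have ls : low s1 by left.
have n0 : `|0 : R| <= 1 / 8 by rewrite normr0; lra.
have h0 : 0 <= (0 : R) <= 1 / 8 by rewrite lexx /=; lra.
have h16 : 0 <= (1 / 16 : R) <= 1 / 8 by apply/andP; split; lra.
have L0 := LSsolP h0 n0 ls; have L16 := LSsolP h16 n0 ls.
have sp : 0 < s (1 / 16).
  have := LS_monotone (lexx 0) L0 L16; rewrite -/(s _) -/(s _) subr0.
  by have := nrm_Kop2_LS L16; have := pi_gt0 R; lra.
have sc : {within `[0, 1 / 16], continuous s}.
  apply: (@lipschitz_within_continuous _ _ _ _ (121 * pi)) => x x' hx hx'.
  have Lx : LS 0 x s1 (LSsol 0 x s1).
    by apply: LSsolP => //; move: hx => /andP[? ?]; apply/andP; split; lra.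
  have Lx' : LS 0 x' s1 (LSsol 0 x' s1).
    by apply: LSsolP => //; move: hx' => /andP[? ?]; apply/andP; split; lra.
  have := @LS_lipschitz _ b bM 0 x' 0 x s1 s1 _ _ _ _ _ _ ls ls Lx' Lx.
  rewrite subrr normr0 addr0; apply; rewrite ?normr0//.
    by move: hx' => /andP[? ?]; apply/andP; split; lra.
  by move: hx => /andP[? ?]; apply/andP; split; lra.
have le016 : 0 <= (1 / 16 : R) by lra.
have [|x0] := IVT (v := 0) le016 sc.
  by rewrite ge_min le_max s0 (ltW sp) orbT.
rewrite in_itv/= => hx0 sx0; exists x0, (LSsol 0 x0 s1); split => //.
by apply: LSsolP => //; move: hx0 => /andP[? ?]; apply/andP; split; lra.
Qed.

(** At the threshold [y0] lies in the radical, and modulo [y0] every [q] is orthogonal to sin, so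
    E_x0 is nonnegative. For x > x0 a neutral vector is therefore zero; for x = x0 it is a multiple
    of [y0]. *)
Lemma energy_above_threshold x0 y0 x : 0 <= x0 <= 1 -> LS 0 x0 s1 y0 ->
  form 0 x0 y0 s1 = 0 -> x0 <= x -> 0 < x ->
  forall q, itau q = 0 -> form 0 x q q = 0 ->
  forall r, itau r = 0 -> form 0 x q r = 0.
Proof.
move=> /andP[x00 x01] Ly sy x0x xp q qz Eq.
have ls : low s1 by left.
have yz := LS_itau ls Ly; have [W H] := Ly.
have yker : forall r, itau r = 0 -> form 0 x0 y0 r = 0.
  by apply: form_from_low => //; exact: (LS_odd bM x00 b_even Ly).
have [q' [c [q'z q's qE]]] : exists q' c,
    [/\ itau q' = 0, dot q' s1 = 0 & q = q' + c *: y0].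
  pose c := dot q s1 / pi; exists (q - c *: y0), c; split.
  - by rewrite linearB linearZ /= qz yz mulr0 subr0.
  - rewrite dotBl dotZl (LS_dot ls Ly) dot_s1s1 divfK ?subrr//.
    exact: lt0r_neq0 (pi_gt0 R).
  - by rewrite subrK.
have E0 : form 0 x0 q q = form 0 x0 q' q'.
  rewrite qE !form_linE (form0C b x0 q' y0) (yker _ q'z) (yker _ yz).
  by rewrite !mulr0 !addr0.
have pos := energy_nonneg x00 q'z q's.
have Ex : form 0 x q q = form 0 x0 q q +
    (x - x0) * dot (Kop (Kop q)) (Kop (Kop q)).
  by rewrite [LHS]formEx (formEx b x0); ring.
have dge := dot_ge0 (Kop (Kop q)).
have [xx0|xnx0] := eqVneq x0 x; last first.
  have xlt : 0 < x - x0 by rewrite subr_gt0 lt_neqAle xnx0.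
  have /dot_eq0 : dot (Kop (Kop q)) (Kop (Kop q)) = 0.
    apply/eqP; rewrite eq_le dge andbT -(pmulr_rle0 _ xlt).
    by move: Eq; rewrite Ex E0; lra.
  move=> /Kop_inj/(_ (itau_Kop _))/Kop_inj/(_ qz) -> r rz.
  by rewrite form0C linear0.
move=> r rz; have q'0 : q' = 0.
  apply: (energy_index1 xp q'z q's); rewrite -xx0 -E0.
  by move: Eq; rewrite Ex -xx0 subrr mul0r addr0 => ->.
by rewrite qE q'0 add0r formZl -xx0 (yker _ rz) mulr0.
Qed.

(** The null vector is read off the first column, or off the second one if the first is zero. *)
Let det2_ker (m11 m12 m21 m22 : R) : m11 * m22 - m12 * m21 = 0 ->
  exists t u, [/\ (t != 0) || (u != 0), t * m11 + u * m21 = 0 &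
    t * m12 + u * m22 = 0].
Proof.
move=> D; have [h|] := boolP ((m21 != 0) || (m11 != 0)).
  exists m21, (- m11); split; first by rewrite oppr_eq0.
    by ring.
  by rewrite -[RHS]oppr0 -D; ring.
rewrite negb_or !negbK => /andP[/eqP z1 /eqP z2].
have [h|] := boolP ((m22 != 0) || (m12 != 0)).
  exists m22, (- m12); split; first by rewrite oppr_eq0.
    by rewrite z1 z2; ring.
  by ring.
rewrite negb_or !negbK => /andP[/eqP z3 /eqP z4].
exists 1, 0; rewrite oner_neq0; split => //; rewrite ?z1 ?z2 ?z3 ?z4; ring.
Qed.

(** A null vector of the matrix combines [y] and [y'] into a function whose form also vanishes on
    sin and cos; it is nonzero because its first modes are. *)
Lemma LS_singular lam x y y' : LS lam x s1 y -> LS lam x c1 y' ->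
  form lam x y s1 * form lam x y' c1 - form lam x y c1 * form lam x y' s1 = 0 ->
  exists2 p, p != 0 & eigenvector b x lam p.
Proof.
move=> Ly Ly' /det2_ker[t [u [tu h1 h2]]].
have ls : low s1 by left. have lc : low c1 by right.
have yz := LS_itau ls Ly; have yz' := LS_itau lc Ly'.
have pi0 : pi != 0 :> R := lt0r_neq0 (pi_gt0 R).
exists (t *: y + u *: y').
  have ps : dot (t *: y + u *: y') s1 = t * pi.
    by rewrite !dotE (LS_dot ls Ly) (LS_dot ls Ly') dot_s1s1 dot_c1s1 mulr0 addr0.
  have pc : dot (t *: y + u *: y') c1 = u * pi.
    by rewrite !dotE (LS_dot lc Ly) (LS_dot lc Ly') dot_s1c1 dot_c1c1 mulr0 add0r.
  apply/eqP => p00; move: ps pc; rewrite p00 !dot0l => /esym/eqP + /esym/eqP.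
  by rewrite !mulf_eq0 (negbTE pi0) !orbF => tz uz; move: tu; rewrite tz uz.
have pz : itau (t *: y + u *: y') = 0.
  by rewrite linearD !linearZ /= yz yz' !mulr0 addr0.
split => // q qz; apply: form_from_low qz => //.
- move=> w wW; have [_ H] := Ly; have [_ H'] := Ly'.
  by rewrite !form_linE (H w wW) (H' w wW) !mulr0 addr0.
- by rewrite !form_linE.
- by rewrite !form_linE.
Qed.

(** Since Kop^2 g = - g, the first term and the potential term cancel for b = 1; only x, lam and b -
    1 are left. *)
Lemma form_low lam x p g : low g -> form lam x p g =
  x * dot p g + lam * kap p g - dot (cmul (b - ccst 1) (Kop p)) (Kop g).
Proof.
move=> lg; rewrite /form dot_Kop2 (low_Kop2 lg) 2!linearN /= (low_Kop2 lg) opprK.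
have -> : cmul (b - ccst 1) (Kop p) = cmul b (Kop p) - Kop p.
  by apply: cperP => z; rewrite !(cperE, cmulE, ccstE); ring.
rewrite dotBl (Kop_skew p (Kop g)) (low_Kop2 lg) dotNr; ring.
Qed.

Lemma kap_s1 p : kap p s1 = dot p c1.
Proof. by rewrite /kap Kop_s1 dotNr dot_Kop2 low_Kop2 ?dotNr ?opprK//; right. Qed.

Lemma kap_c1 p : kap p c1 = - dot p s1.
Proof. by rewrite /kap Kop_c1 dot_Kop2 low_Kop2 ?dotNr//; left. Qed.

Context (de : R).
Hypotheses (de_small : 11 * de <= 1 / 80)
  (b_near1 : forall z, `|b z - 1| <= de).

(** The error is at most [de] times the bound 11 sqrt pi on [y] times sqrt pi. *)
Let low_error lam x g h y : 0 <= x <= 1 -> `|lam| <= 1 -> low g -> low h ->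
  LS lam x g y -> `|dot (cmul (b - ccst 1) (Kop y)) (Kop h)| <= pi / 80.
Proof.
move=> hx hl lg lh Ly; apply: le_trans (cauchy_schwarz _ _) _.
have de0 : 0 <= de by exact: le_trans (b_near1 0).
have n1 : nrm (cmul (b - ccst 1) (Kop y)) <= de * nrm y.
  apply: le_trans (_ : de * nrm (Kop y) <= _).
    by apply: nrm_cmul => z; rewrite !cperE ccstE.
  by apply: ler_wpM2l => //; exact: nrm_Kop.
have n2 := LS_bound bM hx hl lg Ly; rewrite (low_nrm lg) in n2.
have n3 : nrm (Kop h) <= Num.sqrt pi by rewrite -(low_nrm lh) nrm_Kop.
have -> : pi / 80 = (1 / 80 * Num.sqrt pi) * Num.sqrt pi :> R.
  by rewrite -mulrA -expr2 sqr_sqrtr ?pi_ge0//; ring.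
apply: ler_pM; rewrite ?nrm_ge0//.
apply: le_trans n1 _; apply: le_trans (ler_wpM2l de0 n2) _.
by rewrite mulrCA mulrA ler_wpM2r ?sqrtr_ge0//.
Qed.

Lemma eigenvalue_exists x y0 sg : 0 < x <= 1 / 16 -> LS 0 x s1 y0 ->
  form 0 x y0 s1 < 0 -> `|sg| = 1 ->
  exists lam p, [/\ 0 < lam, p != 0 & eigenvector b x (sg * lam) p].
Proof.
move=> /andP[x0 x16] Ly0 sy sg1.
have ls : low s1 by left. have lc : low c1 by right.
have hx8 : 0 <= x <= 1 / 8 by apply/andP; split; lra.
have hx1 : 0 <= x <= 1 by apply/andP; split; lra.
pose m g h lam := form (sg * lam) x (LSsol (sg * lam) x g) h.
have sl lam : `|sg * lam| = `|lam| by rewrite normrM sg1 mul1r.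
have LSl lam g : 0 <= lam <= 1 / 8 -> low g ->
    LS (sg * lam) x g (LSsol (sg * lam) x g).
  by move=> /andP[l0 l1] lg; apply: LSsolP; rewrite // sl ger0_norm.
have mc g h : low g -> low h -> {within `[0, 1 / 8], continuous (m g h)}.
  move=> lg lh.
  apply: (@lipschitz_within_continuous _ _ _ _ (121 * pi)) => l l' hl hl'.
  have := @LS_lipschitz _ b bM _ x _ x g h _ _ hx1 hx1 _ _ lg lh
    (LSl _ _ hl' lg) (LSl _ _ hl lg).
  rewrite subrr normr0 add0r -mulrBr !sl; apply; rewrite ger0_norm;
    by move: hl hl' => /andP[? ?] /andP[? ?]; lra.
pose D lam := m s1 s1 lam * m c1 c1 lam - m s1 c1 lam * m c1 s1 lam.
have Dc : {within `[0, 1 / 8], continuous D}.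
  by move=> z; apply: cvgB; apply: cvgM; apply: mc.
have h0 : 0 <= (0 : R) <= 1 / 8 by rewrite lexx /=; lra.
have h8 : 0 <= (1 / 8 : R) <= 1 / 8 by rewrite lexx andbT; lra.
(* At lam = 0 the matrix is symmetric, so the off-diagonal product is a square. The cosine entry is
   the energy of a function orthogonal to sin, hence positive, and the sine entry is negative by
   hypothesis. *)
have D0 : D 0 < 0.
  have Ls := LSl _ _ h0 ls; have Lc := LSl _ _ h0 lc.
  rewrite /D /m; move: Ls Lc; rewrite mulr0 => Ls Lc.
  have -> : form 0 x (LSsol 0 x s1) s1 = form 0 x y0 s1.
    by rewrite (LS_unique bM (ltW x0) Ls Ly0).
  have E : form 0 x (LSsol 0 x c1) s1 = form 0 x (LSsol 0 x s1) c1.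
    by rewrite -(LS_form Lc Ls) -(LS_form Ls Lc) form0C.
  have cp : 0 < form 0 x (LSsol 0 x c1) c1.
    rewrite -(LS_form Lc Lc) ltNge; apply/negP => h.
    have cs : dot (LSsol 0 x c1) s1 = 0 by rewrite (LS_dot ls Lc) dot_c1s1.
    have z := energy_index1 x0 (LS_itau lc Lc) cs h.
    have := LS_dot lc Lc; rewrite z dot0l dot_c1c1 => /esym/eqP.
    by rewrite gt_eqF// pi_gt0.
  rewrite E; set e := form 0 x (LSsol 0 x s1) c1.
  have := sqr_ge0 e; rewrite expr2; have : form 0 x y0 s1 * form 0 x (LSsol 0 x c1) c1 < 0.
    by rewrite nmulr_rlt0.
  lra.
(* In units of t = pi / 80: lam pi = 10 t in absolute value, x pi <= 5 t, and errors are at most t.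
   The diagonal product is at least - 36 t^2, and minus the off-diagonal product is at least 81
   t^2. *)
have D8 : 0 < D (1 / 8).
  have Ls := LSl _ _ h8 ls; have Lc := LSl _ _ h8 lc.
  have l1 : `|sg * (1 / 8)| <= 1 by rewrite sl ger0_norm; lra.
  rewrite /D /m !form_low// !kap_s1 !kap_c1.
  rewrite !(LS_dot ls Ls) !(LS_dot lc Ls) !(LS_dot ls Lc) !(LS_dot lc Lc).
  rewrite dot_s1s1 dot_c1c1 dot_s1c1 dot_c1s1.
  have := low_error hx1 l1 ls ls Ls; have := low_error hx1 l1 ls lc Ls.
  have := low_error hx1 l1 lc ls Lc; have := low_error hx1 l1 lc lc Lc.
  set e1 := dot _ (Kop s1); set e2 := dot _ (Kop c1).
  set e3 := dot _ (Kop s1); set e4 := dot _ (Kop c1).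
  clearbody e1 e2 e3 e4; rewrite !(oppr0, mulr0, addr0, add0r).
  have t0 : 0 < pi / 80 :> R by rewrite divr_gt0 ?pi_gt0.
  have xp : 0 <= x * pi <= 5 * (pi / 80).
    apply/andP; split; first by apply: mulr_ge0; apply: ltW => //; exact: pi_gt0.
    rewrite (_ : 5 * (pi / 80) = 1 / 16 * pi); last by field.
    by apply: ler_wpM2r => //; apply: ltW; exact: pi_gt0.
  have p8 : sg * (1 / 8) * pi = sg * (10 * (pi / 80)) by field.
  rewrite mulrN p8; move: t0 xp {p8}; set t := pi / 80; set X := x * pi.
  clearbody t X => t0 /andP[X0 X5] n4 n3 n2 n1.
  have A1 : `|X - e3| <= 6 * t by apply: le_trans (ler_normB _ _) _; rewrite ger0_norm; lra.
  have A4 : `|X - e2| <= 6 * t by apply: le_trans (ler_normB _ _) _; rewrite ger0_norm; lra.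
  have P1 : - (36 * t ^+ 2) <= (X - e3) * (X - e2).
    rewrite lerNl; apply: le_trans (ler_norm _) _.
    rewrite normrN normrM (_ : 36 * t ^+ 2 = (6 * t) * (6 * t)); last by ring.
    by rewrite ler_pM.
  have P2 (u v : R) : 9 * t <= u -> 9 * t <= v -> 81 * t ^+ 2 <= u * v.
    move=> hu hv; rewrite (_ : 81 * t ^+ 2 = (9 * t) * (9 * t)); last by ring.
    by apply: ler_pM => //; lra.
  have t2 : 0 < t ^+ 2 by rewrite exprn_gt0.
  move: n2 n3; rewrite !ler_norml => /andP[a2 b2] /andP[a3 b3].
  have [sgE|sgE] : sg = 1 \/ sg = - 1.
    by move: sg1; have [_ ->|_ h] := ger0P sg; [left|right; rewrite -h opprK].
  - have h : 81 * t ^+ 2 <= (10 * t + e4) * (10 * t - e1) by apply: P2; lra.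
    rewrite sgE !mul1r (_ : (- (10 * t) - e4) * (10 * t - e1) =
      - ((10 * t + e4) * (10 * t - e1))); [lra|ring].
  - have h : 81 * t ^+ 2 <= (10 * t - e4) * (10 * t + e1) by apply: P2; lra.
    rewrite sgE !mulN1r opprK (_ : (10 * t - e4) * (- (10 * t) - e1) =
      - ((10 * t - e4) * (10 * t + e1))); [lra|ring].
have h18 : 0 <= (1 / 8 : R) by lra.
have [|l] := IVT (v := 0) h18 Dc.
  by rewrite ge_min le_max (ltW D0) (ltW D8) orbT.
rewrite in_itv/= => /andP[l0 l8] Dl.
have hl : 0 <= l <= 1 / 8 by apply/andP.
have [p pn0 ep] := LS_singular (LSl _ _ hl ls) (LSl _ _ hl lc) Dl.
exists l, p; split => //.
rewrite lt_neqAle l0 andbT; apply/eqP => l00; move: Dl D0.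
by rewrite -l00 => ->; rewrite ltxx.
Qed.

End SpectralDichotomy.

(** * Small-amplitude asymptotics *)

Section Asymptotics.
Context {R : realType}.
Local Notation V := (cper R).
Implicit Types (f g : R -> R) (u v : R -> V) (n m : nat).

Definition bigO n f := exists C, \forall a \near (0 : R), `|f a| <= C * `|a| ^+ n.
Definition bigOV n u :=
  exists C, \forall a \near (0 : R), forall z, `|u a z| <= C * `|a| ^+ n.

Lemma bigO_near n f g : (\forall a \near (0 : R), f a = g a) ->
  bigO n f -> bigO n g.
Proof. by move=> fg [C hC]; exists C; near=> a; have <- : f a = g a; near: a. Unshelve. all: by end_near. Qed.

Lemma bigO_eq n f g : f =1 g -> bigO n f -> bigO n g.
Proof. by move=> fg; apply: bigO_near; near=> a; exact: fg. Unshelve. all: by end_near. Qed.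

Lemma bigOV_near n u v : (\forall a \near (0 : R), u a = v a) ->
  bigOV n u -> bigOV n v.
Proof. by move=> fg [C hC]; exists C; near=> a; have <- : u a = v a; near: a. Unshelve. all: by end_near. Qed.

Lemma bigOV_eq n u v : u =1 v -> bigOV n u -> bigOV n v.
Proof. by move=> fg; apply: bigOV_near; near=> a; exact: fg. Unshelve. all: by end_near. Qed.

Lemma bigOD n f g : bigO n f -> bigO n g -> bigO n (fun a => f a + g a).
Proof.
move=> [C hC] [D hD]; exists (C + D); near=> a.
apply: le_trans (ler_normD _ _) _; rewrite mulrDl; apply: lerD; near: a.
  exact: hC.
exact: hD.
Unshelve. all: by end_near. Qed.

Lemma bigOM n m f g : bigO n f -> bigO m g -> bigO (n + m) (fun a => f a * g a).
Proof.
move=> [C hC] [D hD]; exists (C * D); near=> a.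
rewrite normrM exprD mulrACA; apply: ler_pM => //; near: a.
  exact: hC.
exact: hD.
Unshelve. all: by end_near. Qed.

Lemma bigO_cst c : bigO 0 (fun=> c).
Proof. by exists `|c|; near=> a; rewrite expr0 mulr1. Unshelve. all: by end_near. Qed.

Lemma bigO_id : bigO 1 (fun a => a).
Proof. by exists 1; near=> a; rewrite mul1r. Unshelve. all: by end_near. Qed.

Lemma bigO_exp n : bigO n (fun a => a ^+ n).
Proof. by exists 1; near=> a; rewrite mul1r normrX. Unshelve. all: by end_near. Qed.

Lemma bigOZ n c f : bigO n f -> bigO n (fun a => c * f a).
Proof. by move=> hf; have := bigOM (bigO_cst c) hf. Qed.

Lemma bigON n f : bigO n f -> bigO n (fun a => - f a).
Proof. by move=> hf; apply: bigO_eq (bigOZ (- 1) hf) => a; rewrite mulN1r. Qed.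

Lemma bigOB n f g : bigO n f -> bigO n g -> bigO n (fun a => f a - g a).
Proof. by move=> hf hg; exact: bigOD hf (bigON hg). Qed.

Lemma near0_le1 : \forall a \near (0 : R), `|a| <= 1.
Proof.
have /cvgr0Pnorm_le/(_ _ ltr01) := @cvg_id _ (nbhs (0 : R)); exact.
Qed.

Let le_scale (C : R) n m (a : R) : (m <= n)%N -> `|a| <= 1 ->
  C * `|a| ^+ n <= `|C| * `|a| ^+ m.
Proof.
move=> mn a1; apply: le_trans (_ : `|C| * `|a| ^+ n <= _).
  by rewrite ler_wpM2r ?exprn_ge0// ler_norm.
by rewrite ler_wpM2l// ler_wiXn2l.
Qed.

Lemma bigO_le n m f : (m <= n)%N -> bigO n f -> bigO m f.
Proof.
move=> mn [C hC]; exists `|C|; near=> a.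
apply: le_trans (le_scale C mn (_ : `|a| <= 1)); near: a; first exact: hC.
exact: near0_le1.
Unshelve. all: by end_near. Qed.

Lemma bigOV_le n m u : (m <= n)%N -> bigOV n u -> bigOV m u.
Proof.
move=> mn [C hC]; exists `|C|; near=> a => z.
apply: le_trans (le_scale C mn (_ : `|a| <= 1)).
  by move: z; near: a; exact: hC.
by near: a; exact: near0_le1.
Unshelve. all: by end_near. Qed.

Lemma bigO_small n f e : bigO n.+1 f -> 0 < e -> \forall a \near (0 : R), `|f a| <= e.
Proof.
move=> /(bigO_le (_ : 1 <= n.+1)%N) [//|C hC] e0.
have C0 : 0 < `|C| + 1 by rewrite ltr_wpDl.
have eC : 0 < e / (`|C| + 1) by rewrite divr_gt0.
near=> a; have h : `|f a| <= C * `|a| ^+ 1 by near: a.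
have h2 : `|a| <= e / (`|C| + 1).
  near: a; have /cvgr0Pnorm_le/(_ _ eC) := @cvg_id _ (nbhs (0 : R)); exact.
apply: le_trans h _; rewrite expr1.
apply: le_trans (_ : (`|C| + 1) * (e / (`|C| + 1)) <= _); last first.
  by rewrite mulrC divfK// gt_eqF.
apply: le_trans (_ : (`|C| + 1) * `|a| <= _); last by rewrite ler_wpM2l// ltW.
by rewrite ler_wpM2r// (le_trans (ler_norm C))// lerDl.
Unshelve. all: by end_near. Qed.

Lemma bigO_norm_exp (C : R) n : bigO n (fun a => C * `|a| ^+ n).
Proof.
by exists `|C|; near=> a; rewrite normrM [X in _ * X]ger0_norm ?exprn_ge0.
Unshelve. all: by end_near. Qed.

Lemma bigOV_small n u e : bigOV n.+1 u -> 0 < e ->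
  \forall a \near (0 : R), forall z, `|u a z| <= e.
Proof.
move=> [C hC] e0; have h := bigO_norm_exp C n.+1.
near=> a => z; apply: (@le_trans _ _ (C * `|a| ^+ n.+1)).
  by move: z; near: a; exact: hC.
apply: le_trans (ler_norm _) _; near: a; exact: bigO_small h e0.
Unshelve. all: by end_near. Qed.

Lemma bigOV_D n u v : bigOV n u -> bigOV n v -> bigOV n (fun a => u a + v a).
Proof.
move=> [C hC] [D hD]; exists (C + D); near=> a => z; rewrite cperD.
apply: le_trans (ler_normD _ _) _; rewrite mulrDl; apply: lerD; move: z; near: a.
  exact: hC.
exact: hD.
Unshelve. all: by end_near. Qed.

Lemma bigOV_Z n m f u : bigO n f -> bigOV m u ->
  bigOV (n + m) (fun a => f a *: u a).
Proof.
move=> [C hC] [D hD]; exists (C * D); near=> a => z; rewrite cperZ.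
rewrite normrM exprD mulrACA; apply: ler_pM => //; last first.
  by move: z; near: a; exact: hD.
by near: a; exact: hC.
Unshelve. all: by end_near. Qed.

Lemma bigOV_mul n m u v : bigOV n u -> bigOV m v ->
  bigOV (n + m) (fun a => cmul (u a) (v a)).
Proof.
move=> [C hC] [D hD]; exists (C * D); near=> a => z; rewrite cmulE.
rewrite normrM exprD mulrACA; apply: ler_pM => //; move: z; near: a.
  exact: hC.
exact: hD.
Unshelve. all: by end_near. Qed.

Lemma bigOV_cst (w : V) M : (forall z, `|w z| <= M) -> bigOV 0 (fun=> w).
Proof. by move=> h; exists M; near=> a => z; rewrite expr0 mulr1. Unshelve. all: by end_near. Qed.

Lemma bigOV_cosn n : bigOV 0 (fun=> cosn n).
Proof. by apply: (@bigOV_cst _ 1) => z; exact: cos_max. Qed.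
Lemma bigOV_ccst (c : R) : bigOV 0 (fun=> ccst c).
Proof. exact: (@bigOV_cst _ `|c|). Qed.

Lemma bigO_dot n m u v : bigOV n u -> bigOV m v ->
  bigO (n + m) (fun a => dot (u a) (v a)).
Proof.
move=> [C hC] [D hD]; exists (C * D * (pi *+ 2)); near=> a.
apply: le_trans (cauchy_schwarz _ _) _.
have h1 : nrm (u a) <= C * `|a| ^+ n * Num.sqrt (pi *+ 2).
  by apply: nrm_le_sup => z; move: z; near: a; exact: hC.
have h2 : nrm (v a) <= D * `|a| ^+ m * Num.sqrt (pi *+ 2).
  by apply: nrm_le_sup => z; move: z; near: a; exact: hD.
apply: le_trans (ler_pM (nrm_ge0 _) (nrm_ge0 _) h1 h2) _.
have : Num.sqrt (pi *+ 2) * Num.sqrt (pi *+ 2) = pi *+ 2 :> R.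
  by rewrite -expr2 sqr_sqrtr// ltW// tau_gt0.
move: (Num.sqrt (pi *+ 2)) => q <-.
by rewrite exprD le_eqVlt; apply/orP; left; apply/eqP; ring.
Unshelve. all: by end_near. Qed.

Lemma bigO_nrm n u : bigOV n u -> bigO n (fun a => nrm (u a)).
Proof.
move=> [C hC]; exists (C * Num.sqrt (pi *+ 2)); near=> a.
rewrite ger0_norm ?nrm_ge0// mulrAC; apply: nrm_le_sup => z.
by move: z; near: a; exact: hC.
Unshelve. all: by end_near. Qed.

End Asymptotics.

(** * Identities for a single travelling wave *)

Section TravellingWave.
Context {R : realType}.
Local Notation V := (cper R).
Local Notation s1 := (sinn 1 : V).
Local Notation c1 := (cosn 1 : V).
Local Notation c2 := (cosn 2 : V).
Context (p : R -> R) (k : R) (pc : V).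
Hypotheses (wave : periodic_wave p k) (pcE : cper_val pc = p).

Definition wave_coef : V := (k ^+ 2)^-1 *: (ccst 1 + pc).
(** The second derivative of the wave as its equation gives it: a polynomial in [pc], hence
    differentiable once more. *)
Definition wave_dd : V := - (k ^+ 2)^-1 *: (pc + 2^-1 *: cmul pc pc).

Let k2 : k ^+ 2 != 0.
Proof. by have [_ _ k0 _ _] := wave; rewrite expf_neq0// gt_eqF. Qed.

Lemma derive1_periodic (f : R -> R) T : (forall z, derivable f z 1) ->
  periodic f T -> periodic (f^`())%classic T.
Proof.
move=> df pf z.
have D : is_derive (z + T) (1 : R) f ((f^`())%classic (z + T)).
  by rewrite derive1E; exact: DeriveDef (df _) erefl.
have DT : is_derive z (1 : R) (fun x : R => x + T) 1.
  have Dc : is_derive z (1 : R) (fun=> T : R) 0 by exact: is_derive_cst.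
  by have := is_deriveD (is_derive_id z (1 : R)) Dc; rewrite addr0.
have DF := @is_derive1_comp R f (fun x => x + T) z _ _ D DT.
have fE : f \o (fun x => x + T) = f by apply/funext => x /=; rewrite pf.
rewrite fE mulr1 in DF.
by rewrite [RHS]derive1E (@derive_val _ _ _ _ _ _ _ DF).
Qed.

Lemma wave_derivative : exists r : V,
  [/\ cper_val r = (p^`())%classic,
      forall z : R, is_derive z (1 : R) pc (r z) &
      forall z : R, is_derive z (1 : R) r (wave_dd z)].
Proof.
have [pp _ _ dp ode] := wave.
have cr : continuous (p^`())%classic.
  move=> z; apply/differentiable_continuous/derivable1_diffP.
  exact: (dp z).2.
have pr : periodic (p^`())%classic (pi *+ 2).
  by apply: derive1_periodic pp => z; exact: (dp z).1.
exists (mkcper cr pr); split => // z.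
  rewrite pcE [mkcper _ _ z]derive1E; exact: DeriveDef (dp z).1 erefl.
have E : wave_dd z = ((p^`())^`())%classic z.
  have := ode z; rewrite -[(p^`(2))%classic z]/(((p^`())^`())%classic z) => h.
  apply: (mulfI k2); rewrite h !(cperE, cmulE) pcE (expr2 (p z)).
  by move: (k ^+ 2) k2 => K K0; field.
rewrite E derive1E; exact: DeriveDef (dp z).2 erefl.
Qed.

Lemma wave_dd_itau : itau wave_dd = 0.
Proof. by have [r [_ _ d2]] := wave_derivative; exact: itau_derive d2. Qed.

Lemma wave_dd_Kop2 : Kop (Kop wave_dd) = center pc.
Proof.
have [r [_ d1 d2]] := wave_derivative.
rewrite (@Kop_unique R r wave_dd d2) center_id; last exact: itau_derive d1.
exact: (@Kop_unique R pc r d1).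
Qed.

(** The differentiated wave equation reads p''' = - b p', so p'' = Kop (- b p') and Kop p'' = p';
    the two terms of the form cancel by skewness. *)
Lemma wave_dd_ker q : itau q = 0 -> form wave_coef 0 0 wave_dd q = 0.
Proof.
move=> q0; have [r [_ d1 d2]] := wave_derivative.
have Kd : Kop wave_dd = r.
  by rewrite (@Kop_unique R r wave_dd d2) center_id//; exact: itau_derive d1.
have d3 (z : R) : is_derive z (1 : R) wave_dd ((- cmul wave_coef r) z).
  have D1 := is_deriveM (d1 z) (d1 z).
  have -> : (- cmul wave_coef r) z =
      - (k ^+ 2)^-1 * (r z + 2^-1 * (pc z * r z + pc z * r z)).
    by rewrite cperN cmulE /wave_coef cperZ cperD ccstE; move: (k ^+ 2) k2 => K K0; field.
  have D2 := is_deriveZ (- (k ^+ 2)^-1) (is_deriveD (d1 z) (is_deriveZ 2^-1 D1)).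
  exact: D2.
have K3 : Kop (- cmul wave_coef r) = wave_dd.
  by rewrite (@Kop_unique R _ _ d3) center_id// wave_dd_itau.
rewrite /form !mul0r !addr0 Kd -{1}K3 Kop_skew dotNl opprK subrr //.
Qed.

Lemma wave_even : refl pc = pc.
Proof.
have [_ ep _ _ _] := wave.
by apply: cperP => z; rewrite reflE pcE ep.
Qed.

Lemma wave_coef_even : refl wave_coef = wave_coef.
Proof. by rewrite /wave_coef linearZ linearD /= wave_even refl_cst. Qed.

Lemma wave_dd_even : refl wave_dd = wave_dd.
Proof.
by rewrite /wave_dd linearZ linearD linearZ /= refl_cmul wave_even.
Qed.

Lemma wave_dd_sin : dot wave_dd s1 = 0.
Proof.
have := dot_refl wave_dd s1; rewrite wave_dd_even refl_sinn dotNr.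
by move: (dot _ _) => t; lra.
Qed.

Let dot_center (u v : V) : itau v = 0 -> dot (center u) v = dot u v.
Proof. by move=> v0; rewrite /center dotBl (dotC (ccst _)) dot_cst v0 mulr0 subr0. Qed.

Lemma wave_dd_cos : dot wave_dd c1 = - dot pc c1.
Proof.
have lc : low c1 by right.
rewrite -[dot pc c1]dot_center ?itau_cosn// -wave_dd_Kop2 dot_Kop2.
by rewrite (low_Kop2 lc) dotNr opprK.
Qed.

(** The wave equation integrated over a period. *)
Lemma wave_mean : itau pc = - 2^-1 * dot pc pc.
Proof.
have := wave_dd_itau; rewrite /wave_dd linearZ linearD linearZ /= => /eqP.
rewrite mulf_eq0 oppr_eq0 invr_eq0 (negbTE k2) /= => /eqP h.
by rewrite /dot; lra.
Qed.

Lemma wave_cos2 : 4 * k ^+ 2 * dot pc c2 =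
  dot pc c2 + 2^-1 * dot (cmul pc pc) c2.
Proof.
have e : Kop (Kop c2) = - 4^-1 *: c2.
  rewrite Kop_cosn linearZ /= Kop_sinn scalerA; congr (_ *: _).
  by field.
have h : dot pc c2 = - 4^-1 * dot wave_dd c2.
  by rewrite -[LHS]dot_center ?itau_cosn// -wave_dd_Kop2 dot_Kop2 e dotZr.
have : dot wave_dd c2 = - (k ^+ 2)^-1 * (dot pc c2 + 2^-1 * dot (cmul pc pc) c2).
  by rewrite /wave_dd !(dotZl, dotDl).
move=> h2; move: h; rewrite h2; move: (k ^+ 2) k2 => K K0.
set A := dot pc c2; set B := dot _ c2 => h; clearbody A B.
have -> : A + 2^-1 * B = 4 * K * (- 4^-1 * (- K^-1 * (A + 2^-1 * B))) by field.
by rewrite -h.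
Qed.

End TravellingWave.

Section TrigProducts.
Context {R : realType}.

Lemma cosn0 : cosn 0 = ccst 1 :> cper R.
Proof. by apply: cperP => z; rewrite cosnE mul0r cos0. Qed.

Lemma cmul_cosn n m : (m <= n)%N ->
  cmul (cosn n) (cosn m) = 2^-1 *: (cosn (n + m) + cosn (n - m)) :> cper R.
Proof.
move=> mn; apply: cperP => z.
rewrite cmulE cperZ cperD !cosnE natrD natrB// mulrDl mulrBl cosD cosB.
by field.
Qed.

End TrigProducts.

(** * Expansions in the amplitude *)

Section WaveFamily.
Context {R : realType}.
Local Notation V := (cper R).
Local Notation s1 := (sinn 1 : V).
Local Notation s2 := (sinn 2 : V).
Local Notation c1 := (cosn 1 : V).
Local Notation c2 := (cosn 2 : V).
Local Notation c3 := (cosn 3 : V).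
Local Notation c4 := (cosn 4 : V).
Context (P : R -> R -> R) (k : R -> R).
Hypothesis waves : small_periodic_waves P k.

Lemma landau_bigO n (f g : R -> R) :
  f = g +O_ (0 : R) (fun a : R => a ^+ n) <-> bigO n (fun a => f a - g a).
Proof.
rewrite eqaddOP; split.
  move=> /bigO_exP[C C0 hC]; exists C; move: hC; apply: filterS => a.
  by rewrite normrX.
move=> [C hC]; apply/bigO_exP; exists (`|C| + 1); first by rewrite ltr_wpDl.
move: hC; apply: filterS => a h; apply: le_trans h _; rewrite normrX.
rewrite ler_wpM2r ?exprn_ge0//; have := ler_norm C; lra.
Qed.

(** Near a = 0 the function [P a] is continuous and periodic ([wave_near]); the default 0 is taken
    where it is not. *)
Definition wv (a : R) : V := insubd 0 (P a).
Definition bc (a : R) : V := wave_coef (k a) (wv a).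

Lemma wave_near : \forall a \near (0 : R),
  [/\ periodic_wave (P a) (k a), cper_val (wv a) = P a & dot (wv a) c1 = a * pi].
Proof.
have [w _ _ _] := waves; move: w; apply: filterS => a [w ai].
have wE : cper_val (wv a) = P a.
  have [pw _ _ dw _] := w; apply: (insubdK (0 : V)).
  apply/asboolP; split => // z.
  by apply/differentiable_continuous/derivable1_diffP; exact: (dw z).1.
split => //; rewrite /dot itauE oint_le ?(ltW (tau_gt0 R))//.
rewrite [in RHS]ai mulrAC mulVf ?mul1r ?gt_eqF ?pi_gt0//.
by apply: eq_Rintegral => z _; rewrite cmulE wE cosnE mul1r.
Qed.

Let phi : V := 4^-1 *: (3^-1 *: c2 - ccst 1).
Let rem a : V := wv a - (a *: c1 + a ^+ 2 *: phi).
(** By the normalisation of [a], [G a] is exactly orthogonal to cos ([dotG1]), which removes the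
    cross terms in quantities quadratic in the wave. *)
Let G a : V := wv a - a *: c1.
Let kap2 a : R := (k a ^+ 2)^-1.

Lemma rem_bigO : bigOV 3 rem.
Proof.
have [_ [C hC] _ _] := waves; exists C; near=> a => z.
have [_ E _] : [/\ periodic_wave (P a) (k a), cper_val (wv a) = P a &
  dot (wv a) c1 = a * pi] by near: a; exact: wave_near.
rewrite /rem /phi !(cperE, cosnE, ccstE) E mul1r.
rewrite [X in `|_ - (_ + X)|]mulrC.
by move: z; near: a; exact: hC.
Unshelve. all: by end_near. Qed.

Let phi_bigO : bigOV 0 (fun=> phi).
Proof.
apply: (@bigOV_cst _ _ (4^-1 * (3^-1 + 1))) => z.
rewrite /phi !(cperE, cosnE, ccstE) normrM ger0_norm ?invr_ge0// ler_wpM2l ?invr_ge0//.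
apply: le_trans (ler_normB _ _) _; rewrite normr1 lerD2r normrM ger0_norm ?invr_ge0//.
by rewrite ler_piMr ?invr_ge0// cos_max.
Qed.

Lemma G_bigO : bigOV 2 G.
Proof.
apply: (@bigOV_eq _ _ (fun a => a ^+ 2 *: phi + rem a)) => [a|].
  by apply: cperP => z; rewrite /rem /G !cperE; ring.
apply: bigOV_D; first exact: (bigOV_Z (bigO_exp 2) phi_bigO).
exact: bigOV_le rem_bigO.
Qed.

Lemma wv_bigO : bigOV 1 wv.
Proof.
apply: (@bigOV_eq _ _ (fun a => a *: c1 + G a)) => [a|].
  by apply: cperP => z; rewrite /G !cperE; ring.
apply: bigOV_D; first exact: (bigOV_Z bigO_id (bigOV_cosn 1)).
exact: bigOV_le G_bigO.
Qed.

Lemma k2_bigO : bigO 4 (fun a => k a ^+ 2 - (1 - 5 / 24 * a ^+ 2)).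
Proof. by have [_ _ h _] := waves; apply/landau_bigO. Qed.

Lemma k2_bigO2 : bigO 2 (fun a => k a ^+ 2 - 1).
Proof.
apply: (@bigO_eq _ _ (fun a => (k a ^+ 2 - (1 - 5 / 24 * a ^+ 2)) - 5 / 24 * a ^+ 2)).
  by move=> a; ring.
apply: bigOB; first exact: bigO_le k2_bigO.
exact: bigOZ (bigO_exp 2).
Qed.

Lemma k2_near : \forall a \near (0 : R), `|k a ^+ 2 - 1| <= 2^-1.
Proof. by apply: bigO_small k2_bigO2 _; rewrite invr_gt0. Qed.

Lemma kap2_bigO0 : bigO 0 kap2.
Proof.
exists 2; near=> a; rewrite expr0 mulr1 /kap2.
have : `|k a ^+ 2 - 1| <= 2^-1 by near: a; exact: k2_near.
rewrite ler_norml => /andP[h _]; have kp : 2^-1 <= k a ^+ 2 by lra.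
have k0 : 0 < k a ^+ 2 by lra.
by rewrite ger0_norm ?invr_ge0 ?(ltW k0)// -[X in _ <= X]invrK lef_pV2 ?posrE ?invr_gt0.
Unshelve. all: by end_near. Qed.

Let k2_neq0 : \forall a \near (0 : R), k a ^+ 2 != 0.
Proof.
near=> a; have : `|k a ^+ 2 - 1| <= 2^-1 by near: a; exact: k2_near.
by rewrite ler_norml => /andP[h _]; apply: lt0r_neq0; lra.
Unshelve. all: by end_near. Qed.

Let k4 a := kap2 a - (1 + 5 / 24 * a ^+ 2).

Lemma kap2_bigO4 : bigO 4 k4.
Proof.
apply: (@bigO_near _ _ (fun a => - (kap2 a *
  ((k a ^+ 2 - (1 - 5 / 24 * a ^+ 2)) * (1 + 5 / 24 * a ^+ 2) -
   (5 / 24) ^+ 2 * a ^+ 4)))).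
  near=> a; have k0 : k a ^+ 2 != 0 by near: a.
  by rewrite /k4 /kap2; move: (k a ^+ 2) k0 => K K0; field.
apply: bigON; apply: (bigOM kap2_bigO0 (m := 4)); apply: bigOB.
  apply: (bigOM k2_bigO (m := 0)); apply: bigOD (bigO_cst 1) _.
  exact: bigO_le (bigOZ _ (bigO_exp 2)).
exact: bigOZ (bigO_exp 4).
Unshelve. all: by end_near. Qed.

Lemma kap2_bigO2 : bigO 2 (fun a => kap2 a - 1).
Proof.
apply: (@bigO_eq _ _ (fun a => k4 a + 5 / 24 * a ^+ 2)).
  by move=> a; rewrite /k4; ring.
apply: bigOD; first exact: bigO_le kap2_bigO4.
exact: bigOZ (bigO_exp 2).
Qed.

Lemma bc_bigO : bigOV 1 (fun a => bc a - ccst 1).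
Proof.
apply: (@bigOV_eq _ _ (fun a => (kap2 a - 1) *: ccst 1 + kap2 a *: wv a)).
  by move=> a; apply: cperP => z; rewrite /bc /wave_coef /kap2 !(cperE, ccstE); ring.
apply: bigOV_D; last exact: (bigOV_Z kap2_bigO0 wv_bigO).
exact: bigOV_le (bigOV_Z kap2_bigO2 (bigOV_ccst 1)).
Qed.

Let dotG1 : \forall a \near (0 : R), dot (G a) c1 = 0.
Proof.
near=> a; have [_ _ E] : [/\ periodic_wave (P a) (k a), cper_val (wv a) = P a &
  dot (wv a) c1 = a * pi] by near: a; exact: wave_near.
by rewrite /G dotBl dotZl dot_c1c1 E subrr.
Unshelve. all: by end_near. Qed.

Let wvE a : wv a = a *: c1 + G a.
Proof. by rewrite /G addrC subrK. Qed.

(** The second-order part of the wave only has the harmonics 0 and 2, so this coefficient comes from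
    the remainder. *)
Let dotG3 : bigO 3 (fun a => dot (G a) c3).
Proof.
apply: (@bigO_eq _ _ (fun a => dot (rem a) c3)); last exact: bigO_dot rem_bigO (bigOV_cosn 3).
move=> a; have -> : rem a = G a - a ^+ 2 *: phi.
  by apply: cperP => z; rewrite /rem /G !cperE; ring.
have p3 : dot phi c3 = 0.
  rewrite /phi dotZl dotBl dotZl (dotC (ccst 1)) dot_cst itau_cosn.
  by rewrite dot_cosn_cosn /= !mulr0 subrr mulr0.
by rewrite dotBl dotZl p3 mulr0 subr0.
Qed.

Let T1 a := dot (wv a) (wv a) - pi * a ^+ 2.
Lemma T1_bigO : bigO 4 T1.
Proof.
apply: (@bigO_near _ _ (fun a => dot (G a) (G a))); last exact: bigO_dot G_bigO G_bigO.
near=> a; have g1 : dot (G a) c1 = 0 by near: a.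
move: g1; rewrite /T1 wvE; move: (G a) => g g1.
by rewrite !(dotDl, dotDr, dotZl, dotZr) (dotC c1 g) g1 dot_c1c1; ring.
Unshelve. all: by end_near. Qed.

Let c1c1 : cmul c1 c1 = 2^-1 *: (c2 + ccst 1). Proof. by rewrite cmul_cosn// cosn0. Qed.
Let c2c1 : cmul c2 c1 = 2^-1 *: (c3 + c1). Proof. by rewrite cmul_cosn. Qed.
Let c2c2 : cmul c2 c2 = 2^-1 *: (c4 + ccst 1). Proof. by rewrite cmul_cosn// cosn0. Qed.
Let cmulC u v : cmul u v = cmul v u :> V.
Proof. by apply: cperP => z; rewrite !cmulE mulrC. Qed.

Let T2 a := dot (cmul (wv a) (wv a)) c2 - pi / 2 * a ^+ 2.
Lemma T2_bigO : bigO 4 T2.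
Proof.
apply: (@bigO_near _ _ (fun a => a * dot (G a) c3 + dot (cmul (G a) (G a)) c2)).
  near=> a; have : dot (G a) c1 = 0 by near: a.
  have := wvE a; rewrite /T2; move: (G a) (wv a) => g w wE g1.
  have E : dot (cmul w w) c2 = a ^+ 2 * dot c1 (cmul c2 c1) +
      a * 2 * dot g (cmul c2 c1) + dot (cmul g g) c2.
    have -> : cmul w w = a ^+ 2 *: cmul c1 c1 + (a * 2) *: cmul c1 g +
        cmul g g.
      by apply: cperP => z; rewrite wE !(cmulE, cperE); ring.
    by rewrite !(dotDl, dotZl) !dot_cmul (cmulC c1 c2) (cmulC g c2).
  rewrite E c2c1 !(dotZr, dotDr) g1 dot_c1c1 dot_cosn_cosn /=.
  by field.
apply: bigOD; first exact: (bigOM bigO_id dotG3).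
apply: (bigO_dot (n := 4) (m := 0) _ (bigOV_cosn 2)).
exact: bigOV_mul G_bigO G_bigO.
Unshelve. all: by end_near. Qed.

Let cos2_err a := dot (wv a) c2 - pi / 12 * a ^+ 2.
(** [wave_cos2] is solved for the coefficient: it is <P^2, cos 2z> / 2 divided by 4 k^2 - 1, that is
    (pi / 4) a^2 / 3 to leading order, and the error inherits the order 4 of [T2]. *)
Lemma cos2_err_bigO : bigO 4 cos2_err.
Proof.
pose inv a := (4 * k a ^+ 2 - 1)^-1.
have inv0 : bigO 0 inv.
  exists 1; near=> a; rewrite expr0 mulr1 /inv.
  have : `|k a ^+ 2 - 1| <= 2^-1 by near: a; exact: k2_near.
  rewrite ler_norml => /andP[h _]; have kp : 1 <= 4 * k a ^+ 2 - 1 by lra.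
  have k0 : 0 < 4 * k a ^+ 2 - 1 by lra.
  by rewrite ger0_norm ?invr_ge0 ?(ltW k0)// invf_le1.
apply: (@bigO_near _ _ (fun a => inv a *
    (2^-1 * T2 a - (4 * (k a ^+ 2 - 1)) * (pi / 12 * a ^+ 2)))).
  near=> a; have : `|k a ^+ 2 - 1| <= 2^-1 by near: a; exact: k2_near.
  rewrite ler_norml => /andP[h _]; have k0 : 4 * k a ^+ 2 - 1 != 0.
    by apply: lt0r_neq0; lra.
  have [w wE _] : [/\ periodic_wave (P a) (k a), cper_val (wv a) = P a &
    dot (wv a) c1 = a * pi] by near: a; exact: wave_near.
  have := wave_cos2 w wE; rewrite /cos2_err /T2 /inv.
  move: (dot (wv a) c2) (dot (cmul (wv a) (wv a)) c2) (k a ^+ 2) k0 (@pi R) => x y K K0 p H.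
  have -> : y = 2 * (4 * K * x - x) by rewrite H; field.
  by field.
apply: (bigOM inv0 (m := 4)); apply: bigOB; first exact: bigOZ T2_bigO.
apply: (bigOM (n := 2) (m := 2)); first exact: bigOZ k2_bigO2.
exact: bigOZ (bigO_exp 2).
Unshelve. all: by end_near. Qed.

Lemma mean_wave : \forall a \near (0 : R), itau (wv a) = - 2^-1 * dot (wv a) (wv a).
Proof.
near=> a; have [w wE _] : [/\ periodic_wave (P a) (k a), cper_val (wv a) = P a &
  dot (wv a) c1 = a * pi] by near: a; exact: wave_near.
exact: wave_mean w wE.
Unshelve. all: by end_near. Qed.

Let dot_bc a (u v : V) : dot (cmul (bc a) u) v =
  kap2 a * (dot u v + dot (wv a) (cmul u v)).
Proof.
have -> : cmul (bc a) u = kap2 a *: (u + cmul (wv a) u).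
  by apply: cperP => z; rewrite /bc /wave_coef /kap2 !(cperE, cmulE, ccstE); ring.
rewrite dotZl dotDl; congr (_ * (_ + _)).
by rewrite /dot; congr itau; apply: cperP => z; rewrite !cmulE; ring.
Qed.

Let X a := dot (cmul (bc a) c1) c1 - pi.
(** The second-order terms cancel: 1 / k^2 brings + (5/24) pi a^2, while the mean and the second
    harmonic bring (1/2)(1/12 - 1/2) pi a^2 = - (5/24) pi a^2. *)
Lemma X_bigO : bigO 4 X.
Proof.
pose Q a := 2^-1 * (- 2^-1 * T1 a + cos2_err a).
have hQ : bigO 4 Q.
  apply: bigOZ; apply: bigOD; [exact: bigOZ T1_bigO|exact: cos2_err_bigO].
apply: (@bigO_near _ _ (fun a => kap2 a * Q a +
    pi * k4 a * (1 - 5 / 24 * a ^+ 2) - (5 / 24) ^+ 2 * pi * a ^+ 4)).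
  near=> a; have m : itau (wv a) = - 2^-1 * dot (wv a) (wv a).
    by near: a; exact: mean_wave.
  rewrite /X dot_bc c1c1 dotZr dotDr dot_cst m dot_c1c1 /Q /k4 /T1 /cos2_err.
  by field.
apply: bigOB; last exact: bigOZ (bigO_exp 4).
apply: bigOD; first exact: (bigOM kap2_bigO0 hQ).
apply: (bigOM (n := 4) (m := 0)); first exact: bigOZ kap2_bigO4.
apply: bigOB; first exact: bigO_cst.
exact: bigO_le (bigOZ _ (bigO_exp 2)).
Unshelve. all: by end_near. Qed.

Let Y a := dot (cmul (bc a) c1) c2 - pi / 2 * a.
Lemma Y_bigO : bigO 3 Y.
Proof.
apply: (@bigO_near _ _ (fun a => kap2 a * (2^-1 * dot (G a) c3) +
    (kap2 a - 1) * (pi / 2 * a))).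
  near=> a; have [_ _ w1] : [/\ periodic_wave (P a) (k a), cper_val (wv a) = P a &
    dot (wv a) c1 = a * pi] by near: a; exact: wave_near.
  have w3 : dot (wv a) c3 = dot (G a) c3.
    by rewrite {1}wvE [LHS]dotDl dotZl dot_cosn_cosn /= mulr0 add0r.
  rewrite /Y dot_bc (cmulC c1 c2) c2c1 dotZr dotDr w1 w3 dot_cosn_cosn /=.
  by field.
apply: bigOD; first exact: (bigOM kap2_bigO0 (bigOZ _ dotG3)).
exact: (bigOM kap2_bigO2 (bigOZ _ bigO_id)).
Unshelve. all: by end_near. Qed.

Let Z a := dot (cmul (bc a) c2) c2 - pi.
Lemma Z_bigO : bigO 2 Z.
Proof.
apply: (@bigO_near _ _ (fun a => (kap2 a - 1) * pi +
    kap2 a * (2^-1 * (dot (G a) c4 - 2^-1 * (T1 a + pi * a ^+ 2))))).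
  near=> a; have m : itau (wv a) = - 2^-1 * dot (wv a) (wv a).
    by near: a; exact: mean_wave.
  have w4 : dot (wv a) c4 = dot (G a) c4.
    by rewrite {1}wvE [LHS]dotDl dotZl dot_cosn_cosn /= mulr0 add0r.
  by rewrite /Z dot_bc c2c2 dotZr dotDr dot_cst m w4 dot_cosn_cosn /= /T1; field.
apply: bigOD; first by apply: (bigOM kap2_bigO2 (m := 0)); exact: bigO_cst.
apply: (bigOM kap2_bigO0 (m := 2)); apply: bigOZ; apply: bigOB.
  exact: (bigO_dot G_bigO (bigOV_cosn 4)).
apply: bigOZ; apply: bigOD; first exact: bigO_le T1_bigO.
exact: bigOZ (bigO_exp 2).
Unshelve. all: by end_near. Qed.

Let K_s2 : Kop s2 = - 2^-1 *: c2. Proof. by rewrite Kop_sinn. Qed.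
(** To first order E_0(sin z, sin 2z) = - pi a / 4 and E_0(sin 2z, sin 2z) = 3 pi / 4, so the
    coefficient a / 3 makes [yt a] nearly E_0-orthogonal to sin 2z. *)
Let yt a : V := s1 + (a / 3) *: s2.
Let K_yt a : Kop (yt a) = - (c1 + (a / 6) *: c2).
Proof.
rewrite /yt linearD linearZ /= K_s2 Kop_s1 opprD scalerA -scaleNr.
by congr (_ + _ *: _); field.
Qed.

Let trial_err a := form (bc a) 0 0 (yt a) (yt a) + pi / 12 * a ^+ 2.
(** The leading terms add up to pi a^2 (1/9 - 1/6 - 1/36) = - pi a^2 / 12. The errors [X], [Y], [Z],
    of orders 4, 3, 2, enter with factors of orders 0, 1, 2. *)
Lemma trial_err_bigO : bigO 4 trial_err.
Proof.
apply: (@bigO_eq _ _ (fun a => - X a - (3^-1 * a) * Y a - (36^-1 * a ^+ 2) * Z a)).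
  move=> a; rewrite /trial_err /form K_yt !mul0r !addr0 /X /Y /Z.
  have -> : cmul (bc a) (- (c1 + (a / 6) *: c2)) =
      - (cmul (bc a) c1 + (a / 6) *: cmul (bc a) c2).
    by apply: cperP => z; rewrite !(cperE, cmulE); ring.
  have E : dot (cmul (bc a) c2) c1 = dot (cmul (bc a) c1) c2.
    by rewrite dot_cmul dotC.
  rewrite /yt !(dotDl, dotDr, dotNl, dotNr, dotZl, dotZr) E.
  by rewrite !dot_sinn_sinn /=; field.
apply: bigOB; last exact: (bigOM (bigOZ _ (bigO_exp 2)) Z_bigO).
apply: bigOB; first exact: bigON X_bigO.
exact: (bigOM (bigOZ _ bigO_id) Y_bigO).
Qed.

(** Residual of the trial function: E_0(yt, v) = <H, Kop v> for [v] in [inW]. The term in [c2] comes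
    from <yt, v>; [c1] and the constant are orthogonal to [Kop v], and subtracting them leaves
    nothing of order below a^2. *)
Let H a : V := cmul (bc a) (c1 + (a / 6) *: c2) - (2 * a / 3) *: c2 - c1 -
  ccst (a / 2).
Lemma H_bigO : bigOV 2 H.
Proof.
apply: (@bigOV_eq _ _ (fun a => (kap2 a - 1) *: c1 +
   (((kap2 a - 1) * a) *: cmul c1 c1 + (kap2 a *: cmul (G a) c1 +
    (6^-1 * a) *: cmul (bc a - ccst 1) c2)))).
  move=> a; have -> : G a = wv a - a *: c1 by [].
  apply: cperP => z; have := congr1 (fun u : V => u z) c1c1.
  rewrite /H /bc /wave_coef -/(kap2 a) !(cperE, cmulE, ccstE).
  move: (c1 z) (c2 z) (wv a z) (kap2 a) => x y w q xx.
  have -> : y = 2 * (x * x) - 1 by rewrite xx; field.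
  by field.
apply: bigOV_D; first exact: (bigOV_Z kap2_bigO2 (bigOV_cosn 1)).
apply: bigOV_D.
  apply: (@bigOV_le _ 3) => //; apply: (bigOV_Z (n := 3) (m := 0)).
    exact: (bigOM kap2_bigO2 bigO_id).
  exact: (bigOV_mul (bigOV_cosn 1) (bigOV_cosn 1)).
apply: bigOV_D.
  apply: (bigOV_Z kap2_bigO0 (m := 2)); exact: (bigOV_mul G_bigO (bigOV_cosn 1)).
apply: (bigOV_Z (bigOZ _ bigO_id) (m := 1)).
exact: (bigOV_mul bc_bigO (bigOV_cosn 2)).
Qed.

Lemma bc_bound : \forall a \near (0 : R), forall z, `|bc a z| <= 3 / 2.
Proof.
have e0 : 0 < (1 / 2 : R) by lra.
have := bigOV_small bc_bigO e0; apply: filterS => a h z.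
have := h z; rewrite !cperE ccstE !ler_norml => /andP[? ?].
by apply/andP; split; lra.
Qed.

(** With v = yt - y in [inW], s(0) = E_0(yt, yt) - E_0(v, v), and by coercivity E_0(v, v) is at most
    twice the squared residual, O(a^4). Closeness of [y] to sin later bounds the slope of s from
    above. *)
Lemma threshold_energy : exists C, \forall a \near (0 : R), forall y,
  LS (bc a) 0 0 s1 y ->
  `|form (bc a) 0 0 y s1 + pi / 12 * a ^+ 2| <= C * `|a| ^+ 4 /\
  nrm (y - s1) <= C * `|a|.
Proof.
have [C1 h1] := trial_err_bigO; have [C2 h2] := bigO_nrm H_bigO.
have C2p : bigO 1 (fun a => 3^-1 * a * nrm s2 + 2 * nrm (H a)).
  apply: bigOD; first by apply: (bigOM (bigOZ _ bigO_id) (m := 0)); exact: bigO_cst.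
  by apply: bigOZ; apply: (@bigO_le _ 2) => //; exists C2.
have : bigO 1 (fun a => 3^-1 * `|a| * nrm s2 + 2 * nrm (H a)).
  apply: bigOD; last by apply: bigOZ; apply: (@bigO_le _ 2) => //; exists C2.
  exists (3^-1 * nrm s2); near=> a; rewrite expr1 ger0_norm; first by rewrite mulrAC.
  by rewrite !mulr_ge0 ?nrm_ge0 ?invr_ge0.
move=> [C3 h3]; exists (`|C1 + 2 * C2 ^+ 2| + `|C3|); near=> a => y Ly.
have bM : forall z, `|bc a z| <= 3 / 2 by near: a; exact: bc_bound.
have e1 : `|trial_err a| <= C1 * `|a| ^+ 4 by near: a.
have e2 : `|nrm (H a)| <= C2 * `|a| ^+ 2 by near: a.
have e3 : `|3^-1 * `|a| * nrm s2 + 2 * nrm (H a)| <= C3 * `|a| ^+ 1 by near: a.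
have [W Hy] := Ly.
have ls : low s1 by left.
have [v vW ytE] : exists2 v, inW v & yt a = y + v.
  exists (yt a - y); last by rewrite addrC subrK.
  have sW : inW ((a / 3) *: s2).
    by split; rewrite ?linearZ /= ?itau_sinn ?dotZl ?dot_sinn_sinn ?dot_sinn_cosn mulr0.
  have := inWB sW W; rewrite /yt opprB addrA => h.
  by rewrite (_ : s1 + _ - y = (a / 3) *: s2 + s1 - y) // [s1 + _]addrC.
have vv : form (bc a) 0 0 v v = dot (H a) (Kop v).
  have -> : form (bc a) 0 0 v v = form (bc a) 0 0 (yt a) v.
    by rewrite ytE formDl (Hy v vW) add0r.
  have Kc1 : dot c1 (Kop v) = 0.
    by have [_ vs _] := vW; rewrite dotC Kop_skew Kop_c1 vs oppr0.
  have Kc2 : dot s2 v = - 2 * dot c2 (Kop v).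
    have -> : s2 = 2 *: Kop c2 by rewrite Kop_cosn scalerA mulfV// scale1r.
    by rewrite dotZl Kop_skew; ring.
  have [_ vs _] := vW.
  rewrite /form !mul0r !addr0 K_yt /yt dotDl dotZl (dotC s1) vs add0r Kc2.
  have -> : cmul (bc a) (- (c1 + (a / 6) *: c2)) =
      - cmul (bc a) (c1 + (a / 6) *: c2).
    by apply: cperP => z; rewrite !(cperE, cmulE); ring.
  rewrite /H dotNl 3!dotBl dotZl Kc1 (dotC (ccst _)) dot_cst itau_Kop.
  by field.
have yy : form (bc a) 0 0 y s1 = form (bc a) 0 0 (yt a) (yt a) - form (bc a) 0 0 v v.
  rewrite -(LS_form Ly Ly) ytE !(formDl, formDr) (form0C _ 0 v y) (Hy v vW).
  by rewrite !(addr0, add0r) addrK.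
have co := form_coercive bM (lexx 0) vW.
have vH : form (bc a) 0 0 v v <= nrm (H a) * nrm v.
  rewrite vv; apply: le_trans (dot_le _ _) _.
  by rewrite ler_wpM2l ?nrm_ge0// nrm_Kop.
have nv : nrm v <= 2 * nrm (H a).
  by apply: half_sqr_le; rewrite ?nrm_ge0//; exact: le_trans co vH.
have vv0 : 0 <= form (bc a) 0 0 v v.
  by apply: le_trans co; rewrite mulr_ge0 ?invr_ge0 ?sqr_ge0.
have vH2 : form (bc a) 0 0 v v <= 2 * nrm (H a) ^+ 2.
  apply: le_trans vH _; rewrite expr2 mulrCA; apply: ler_wpM2l => //.
  exact: nrm_ge0.
have H2 : nrm (H a) ^+ 2 <= C2 ^+ 2 * `|a| ^+ 4.
  rewrite -[4%N]/(2 * 2)%N exprM -exprMn lerXn2r ?nnegrE ?nrm_ge0//.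
    by apply: le_trans e2.
  by move: e2; rewrite ger0_norm ?nrm_ge0.
have a4 : 0 <= `|a| ^+ 4 by exact: exprn_ge0.
split.
  have -> : form (bc a) 0 0 y s1 + pi / 12 * a ^+ 2 = trial_err a - form (bc a) 0 0 v v.
    by rewrite yy /trial_err; ring.
  apply: le_trans (ler_normB _ _) _; rewrite (ger0_norm vv0).
  apply: le_trans (_ : (C1 + 2 * C2 ^+ 2) * `|a| ^+ 4 <= _); first by lra.
  rewrite [X in _ <= X]mulrDl; apply: le_trans (_ : `|C1 + 2 * C2 ^+ 2| * `|a| ^+ 4 <= _).
    by rewrite ler_wpM2r// ler_norm.
  by rewrite lerDl mulr_ge0.
have -> : y - s1 = (a / 3) *: s2 - v.
  rewrite -[y](addrK v) -ytE /yt; apply: cperP => z; rewrite !cperE; ring.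
apply: le_trans (nrmB _ _) _; rewrite nrmZ normrM (ger0_norm (_ : 0 <= 3^-1)) ?invr_ge0//.
apply: le_trans (_ : C3 * `|a| <= _).
  move: e3; rewrite expr1 (mulrC `|a|) ger0_norm.
    by apply: le_trans; apply: lerD.
  by rewrite addr_ge0 ?mulr_ge0 ?nrm_ge0 ?invr_ge0.
rewrite ler_wpM2r//; apply: le_trans (ler_norm _) _.
by rewrite lerDr.
Unshelve. all: by end_near. Qed.

End WaveFamily.

(** * The threshold and its asymptotics *)

Section WaveDichotomy.
Context {R : realType}.
Local Notation V := (cper R).
Local Notation s1 := (sinn 1 : V).
Local Notation c1 := (cosn 1 : V).
Context (P : R -> R -> R) (k : R -> R).
Hypothesis waves : small_periodic_waves P k.
Local Notation bc := (bc P k).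

Lemma bc0 : bc 0 = ccst 1.
Proof.
apply: cperP => z; rewrite ccstE.
have [C /nbhs_singleton/(_ z)] := bc_bigO waves.
by rewrite normr0 expr1 mulr0 normr_le0 !cperE ccstE subr_eq0 => /eqP.
Qed.

Lemma bc_even : \forall a \near (0 : R), refl (bc a) = bc a.
Proof.
near=> a; have [w wE _] : [/\ periodic_wave (P a) (k a), cper_val (wv P a) = P a &
  dot (wv P a) c1 = a * pi] by near: a; exact: wave_near.
exact: wave_coef_even w wE.
Unshelve. all: by end_near. Qed.

Lemma kernel_exists : \forall a \near (0 : R), exists p0 : V,
  [/\ itau p0 = 0, dot p0 s1 = 0, dot p0 c1 != 0 &
      forall q, itau q = 0 -> form (bc a) 0 0 p0 q = 0].
Proof.
near=> a; have [->|a0] := eqVneq a 0.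
  exists c1; rewrite itau_cosn dot_c1s1 dot_c1c1; split => //.
    exact: lt0r_neq0 (pi_gt0 R).
  have lc : low c1 by right.
  move=> q q0; rewrite bc0 /form !mul0r !addr0.
  have -> : cmul (ccst 1) (Kop c1) = Kop c1.
    by apply: cperP => z; rewrite cmulE ccstE mul1r.
  by rewrite -[dot (Kop c1) _]opprK -Kop_skew (low_Kop2 lc) dotNl opprK subrr.
have [w wE wc] : [/\ periodic_wave (P a) (k a), cper_val (wv P a) = P a &
  dot (wv P a) c1 = a * pi] by near: a; exact: wave_near.
exists (wave_dd (k a) (wv P a)); split.
- exact: wave_dd_itau w wE.
- exact: wave_dd_sin w wE.
- by rewrite (wave_dd_cos w wE) wc oppr_eq0 mulf_neq0// gt_eqF// pi_gt0.
- by move=> q q0; exact: wave_dd_ker w wE q q0.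
Unshelve. all: by end_near. Qed.

Let near_sqr_le (e : R) : 0 < e -> \forall a \near (0 : R), a ^+ 2 <= e.
Proof.
move=> e0; have := bigO_small (bigO_exp 2) e0; apply: filterS => a.
by rewrite ger0_norm ?sqr_ge0.
Qed.

(** Stated over plain reals for linear arithmetic: p = pi, c = |C|, A = a^2, Q = a^4, s = s(0). *)
Let threshold_sign (p c C A Q s : R) : 2 <= p -> p <= 4 -> 0 <= c -> C <= c ->
  0 <= A -> Q = A * A -> (1 + c) * A <= 1 / 12 ->
  - (C * Q) <= s + p / 12 * A <= C * Q -> s <= 0 /\ - p / 16 < s.
Proof.
move=> p2 p4 c0 Cc A0 -> cA /andP[l u].
have A1 : A <= 1 / 12 by have := mulr_ge0 c0 A0; rewrite mulrDl in cA; lra.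
have h1 : C * (A * A) <= 1 / 12 * A.
  rewrite mulrA ler_wpM2r//; have := ler_wpM2r A0 Cc; rewrite mulrDl in cA; lra.
have h2 : 2 / 12 * A <= p / 12 * A by rewrite ler_wpM2r//; lra.
have h3 : p / 12 * A <= p / 12 * (1 / 12) by rewrite ler_wpM2l//; lra.
by split; lra.
Qed.

(** Here x is the threshold, and d, dn are the values of |Kop^2 y|^2 at 0 and at x. The slope bounds
    enclose - s between p x and (p + C^2 A) x, and s is - p A / 12 up to C Q. *)
Let threshold_asymptotics (p c C A Q s x d dn : R) : 2 <= p -> p <= 4 ->
  0 <= c -> C <= c -> 0 <= A -> Q = A * A -> (1 + c) * A <= 1 / 12 ->
  - (C * Q) <= s + p / 12 * A <= C * Q -> 0 <= x -> s + x * dn <= 0 ->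
  p <= dn -> - x * d <= s -> d <= p + C ^+ 2 * A ->
  `|x - 12^-1 * A| <= (c + C ^+ 2 * (1 + c)) * Q.
Proof.
move=> p2 p4 c0 Cc A0 QE cA /andP[l u] x0 up pn lo dd.
have Q0 : 0 <= Q by rewrite QE mulr_ge0.
have h1 : C * Q <= c * Q by rewrite ler_wpM2r.
have h2 : x * p <= x * dn by rewrite ler_wpM2l.
have h3 : x * d <= x * p + x * (C ^+ 2 * A) by rewrite -mulrDr ler_wpM2l.
have h4 : c * Q <= 1 / 12 * A.
  rewrite QE mulrA ler_wpM2r//; rewrite mulrDl in cA; lra.
have h5 : p / 12 * A <= 4 / 12 * A by rewrite ler_wpM2r//; lra.
have h6 : x * 2 <= x * p by rewrite ler_wpM2l.
have xA : x <= (1 + c) * A by rewrite mulrDl mul1r; have := mulr_ge0 c0 A0; lra.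
have h7 : x * (C ^+ 2 * A) <= C ^+ 2 * (1 + c) * Q.
  rewrite QE [X in _ <= X](_ : _ = ((1 + c) * A) * (C ^+ 2 * A)); last by ring.
  by rewrite ler_wpM2r// mulr_ge0 ?sqr_ge0.
have h8 : 0 <= C ^+ 2 * (1 + c) * Q 
  by apply: mulr_ge0 => //; apply: mulr_ge0; [exact: sqr_ge0|exact: addr_ge0].
have key : `|(x - 12^-1 * A) * p| <= (c + C ^+ 2 * (1 + c)) * Q.
  rewrite [X in _ <= X]mulrDl mulrBl ler_norml; clear cA dd QE.
  by apply/andP; split; lra.
apply: le_trans key; rewrite normrM (ger0_norm (_ : 0 <= p)); last lra.
by rewrite ler_peMr//; lra.
Qed.

Let h00 : 0 <= (0 : R) <= 1 / 8. Proof. by rewrite lexx /=; lra. Qed.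
Let n0 : `|0 : R| <= 1 / 8. Proof. by rewrite normr0; lra. Qed.
Let le01 (x : R) : 0 <= x -> x <= 1 / 16 -> 0 <= x <= 1.
Proof. by move=> x0 x1; apply/andP; split; lra. Qed.
Let lt016 (x x0 : R) : 0 < x -> x < x0 -> x0 <= 1 / 16 -> 0 < x <= 1 / 16.
Proof. by move=> xp xx x1; apply/andP; split; lra. Qed.
Let le08 (x : R) : 0 < x <= 1 / 16 -> 0 <= x <= 1 / 8.
Proof. by move=> /andP[? ?]; apply/andP; split; lra. Qed.
Let below_sign (m x x0 d p : R) : 0 < p -> p <= d -> x < x0 ->
  m + (x0 - x) * d <= 0 -> m < 0.
Proof.
move=> p0 pd xx h; have xd : 0 < x0 - x by rewrite subr_gt0.
have : 0 < (x0 - x) * d by rewrite mulr_gt0//; lra.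
lra.
Qed.

Theorem wave_dichotomy : exists C, \forall a \near (0 : R), exists x0,
  [/\ 0 <= x0 /\ `|x0 - 12^-1 * a ^+ 2| <= C * `|a| ^+ 4,
      forall x p, 0 < x -> itau p = 0 -> dot p s1 = 0 ->
        form (bc a) 0 x p p <= 0 -> p = 0,
      forall x, x0 <= x -> 0 < x ->
        forall q, itau q = 0 -> form (bc a) 0 x q q = 0 ->
        forall r, itau r = 0 -> form (bc a) 0 x q r = 0 &
      forall x sg, 0 < x < x0 -> `|sg| = 1 ->
        exists lam p, [/\ 0 < lam, p != 0 & eigenvector (bc a) x (sg * lam) p]].
Proof.
have [C hC] := threshold_energy waves.
exists (`|C| + C ^+ 2 * (1 + `|C|)).
have pi2 : 2 <= pi :> R := pi_ge2 R.
have pi4 : pi <= 4 :> R by have := pihalf_lt2 R; lra.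
have C0 : 0 <= `|C| by [].
(* If a^2 is below this bound, then C a^4 <= a^2 / 12, which puts s(0) between - pi / 16 and 0. *)
have eC : 0 < (1 + `|C|)^-1 / 12.
  by apply: divr_gt0 => //; rewrite invr_gt0; apply: ltr_pwDl.
have e8 : 0 < 1 / 80 / 11 :> R by lra.
have de_small : 11 * (1 / 80 / 11) <= 1 / 80 :> R by lra.
near=> a.
have bM : forall z, `|bc a z| <= 3 / 2 by near: a; exact: bc_bound.
have be : refl (bc a) = bc a by near: a; exact: bc_even.
have b1 : forall z, `|bc a z - 1| <= 1 / 80 / 11.
  move=> z; have : `|(bc a - ccst 1) z| <= 1 / 80 / 11; last by rewrite !cperE ccstE.
  by move: z; near: a; exact: bigOV_small (bc_bigO waves) e8.
have [p0 [p0z p0s p0c p0k]] : exists p0 : V,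
  [/\ itau p0 = 0, dot p0 s1 = 0, dot p0 c1 != 0 &
      forall q, itau q = 0 -> form (bc a) 0 0 p0 q = 0].
  by near: a; exact: kernel_exists.
have E : forall y, LS (bc a) 0 0 s1 y ->
  `|form (bc a) 0 0 y s1 + pi / 12 * a ^+ 2| <= C * `|a| ^+ 4 /\
  nrm (y - s1) <= C * `|a| by near: a.
have a2 : a ^+ 2 <= (1 + `|C|)^-1 / 12 by near: a; exact: near_sqr_le.
have Ca2 : (1 + `|C|) * a ^+ 2 <= 1 / 12.
  have cn : 1 + `|C| != 0 by rewrite gt_eqF// ltr_pwDl.
  apply: le_trans (ler_wpM2l (addr_ge0 ler01 C0) a2) _.
  by rewrite mulrA divff.
have a2p : 0 <= a ^+ 2 := sqr_ge0 a.
have a4E : `|a| ^+ 4 = a ^+ 2 * a ^+ 2.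
  by rewrite -[4%N]/(2 + 2)%N exprD real_normK ?num_real.
have ls : low s1 by left.
have L0 := LSsolP bM h00 n0 ls; have [E1 E2] := E _ L0.
set y := LSsol _ 0 0 s1 in L0 E1 E2; rewrite ler_norml in E1.
have [s0 s0'] := threshold_sign pi2 pi4 C0 (ler_norm C) a2p a4E Ca2 E1.
have [x0 [y0 [/andP[x00 x016] Ly0 Ey0]]] := threshold_exists bM s0 s0'.
have x01 := le01 x00 x016.
exists x0; split.
- split => //.
  (* The comparison from 0 to [x0] and the one from [x0] to 0 enclose - s(0) between [x0] times the
     two values of |Kop^2 y|^2. *)
  have up := LS_monotone bM (lexx 0) L0 Ly0; rewrite Ey0 subr0 in up.
  have lo := LS_monotone bM x00 Ly0 L0; rewrite Ey0 sub0r add0r in lo.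
  have pn := nrm_Kop2_LS Ly0.
  have d0 : dot (Kop (Kop y)) (Kop (Kop y)) <= pi + C ^+ 2 * a ^+ 2.
    have [W _] := L0.
    have [d [yE dW dn]] : exists d, [/\ y = s1 + d, inW d & nrm d <= C * `|a|].
      by exists (y - s1); split=> //; rewrite addrC subrK.
    have K1 : Kop (Kop y) = - s1 + Kop (Kop d).
      by rewrite yE !linearD /= (low_Kop2 ls).
    have sd : dot s1 (Kop (Kop d)) = 0.
      by rewrite -dot_Kop2 (low_Kop2 ls) dotNl (low_inW ls dW) oppr0.
    have nd : nrm (Kop (Kop d)) <= C * `|a|.
      by apply: le_trans dn; apply: le_trans (nrm_Kop _) (nrm_Kop _).
    rewrite K1; move: (Kop (Kop d)) sd nd => e sd nd.
    rewrite !(dotDl, dotDr, dotNl, dotNr) (dotC e s1) sd dot_s1s1.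
    rewrite addr0 opprK oppr0 add0r lerD2l -nrm_sqr.
    rewrite -(real_normK (num_real a)) -exprMn lerXn2r ?nnegrE ?nrm_ge0//.
    exact: le_trans (nrm_ge0 _) nd.
  exact: (threshold_asymptotics pi2 pi4 C0 (ler_norm C) a2p a4E Ca2 E1 x00 up pn lo d0).
- by move=> x p xp pz ps; exact: (energy_index1 bM p0z p0s p0c p0k xp pz ps).
- move=> x xx0 xp; exact: (energy_above_threshold bM be p0z p0s p0c p0k x01 Ly0 Ey0 xx0 xp).
- move=> x sg /andP[xp xx0] sg1.
  have hx := lt016 xp xx0 x016.
  have Lx := LSsolP bM (le08 hx) n0 ls.
  apply: (eigenvalue_exists bM p0z p0s p0c p0k de_small b1 hx Lx _ sg1).
  have := LS_monotone bM (ltW xp) Lx Ly0; rewrite Ey0.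
  exact: below_sign (pi_gt0 R) (nrm_Kop2_LS Ly0) xx0.
Unshelve. all: by end_near. Qed.

End WaveDichotomy.

(** * Distributional derivatives *)

Section SmoothBump.
Context {R : realType}.
Implicit Types (f g : R -> R) (m n : nat) (a b c d x z : R).

Lemma derive1_is_derive f g : (forall x, is_derive x 1 f (g x)) -> f^`()%classic = g.
Proof. by move=> df; apply/funext => x; rewrite derive1E; have [] := df x. Qed.

Lemma derive1nSr n f : (f^`(n.+1))%classic = ((f^`())^`(n))%classic.
Proof. by rewrite /derive1n iterSr. Qed.

(** The exponential is the n-th power of expR (x / n), which is at least x / n. *)
Lemma expn_le_expR n x : 0 <= x -> x ^+ n <= n%:R ^+ n * expR x.
Proof.
case: n => [|n] x0; first by rewrite !expr0 mul1r (le_trans _ (expR_ge1Dx x))// lerDl.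
have n0 : (0 : R) < n.+1%:R by rewrite ltr0n.
have E : expR x = expR (x / n.+1%:R) ^+ n.+1.
  by rewrite -expRM_natl -mulr_natl; congr expR; field; rewrite gt_eqF// addrC natr1.
rewrite E -exprMn lerXn2r ?nnegrE ?mulr_ge0 ?expR_ge0//.
have := expR_ge1Dx (x / n.+1%:R).
move=> H; rewrite mulrC -ler_pdivrMr//; apply: le_trans H.
by rewrite lerDr.
Qed.

(* The span of these functions is closed under differentiation; it contains the
   smooth function [flat 0]. *)
Definition flat m x : R := if 0 < x then x^-1 ^+ m * expR (- x^-1) else 0.

Lemma flat_ge0 m x : 0 <= flat m x.
Proof.
rewrite /flat; case: ifPn => // x0.
by rewrite mulr_ge0 ?expR_ge0// exprn_ge0// invr_ge0 ltW.
Qed.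

(** Quadratic smallness at 0 gives the derivative 0 there, for every [m]. *)
Lemma flat_sqr_bound m x : 0 <= flat m x <= m.+2%:R ^+ m.+2 * x ^+ 2.
Proof.
rewrite flat_ge0 /flat; case: ifPn => [x0|_]; last first.
  by rewrite mulr_ge0 ?sqr_ge0// exprn_ge0.
have x0' : 0 < x^-1 by rewrite invr_gt0.
have := @expn_le_expR m.+2 x^-1 (ltW x0').
rewrite -ler_pdivrMr ?expR_gt0// -expRN => H.
rewrite -ler_pdivrMr ?exprn_gt0//; apply: le_trans H.
by rewrite -exprVn mulrAC -exprD addn2.
Qed.

Lemma is_derive_flat m x :
  is_derive x 1 (flat m) (flat m.+2 x - m%:R * flat m.+1 x).
Proof.
have [x0|x0|x0] := ltgtP 0 x.
- have E : \forall y \near x, y^-1 ^+ m * expR (- y^-1) = flat m y.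
    near=> y; rewrite /flat ifT//; near: y; exact: lt_nbhsr.
  apply: (near_eq_is_derive E).
  rewrite /flat x0.
  have x0' : x != 0 by rewrite gt_eqF.
  have D1 : is_derive x (1 : R) (fun y : R => y^-1) (- x ^- 2).
    have := @is_deriveV R id x 1 1 x0' (is_derive_id _ _).
    by rewrite /GRing.scale/= mulr1.
  have D2 : is_derive x (1 : R) (fun y : R => - y^-1) (x ^- 2).
    by have := is_deriveN D1; rewrite opprK.
  have D3 := @is_derive1_comp _ expR (fun y => - y^-1) _ _ _
    (is_derive_expR (- x^-1)) D2.
  have D4 : is_derive x (1 : R) (fun y : R => y^-1 ^+ m)
      (m%:R * x^-1 ^+ m.-1 * - x ^- 2).
    by have := is_deriveX m D1; rewrite exprfctE.
  have D5 := is_deriveM D4 D3.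
  apply: (is_derive_eq D5).
  rewrite /GRing.scale/=.
  case: m {E D4 D5} => [|m]; rewrite ?exprS; field => //.
- have E : \forall y \near x, 0 = flat m y.
    near=> y; rewrite /flat ifF//; apply/negbTE; rewrite -leNgt ltW//.
    by near: y; exact: lt_nbhsl.
  apply: (near_eq_is_derive E).
  rewrite /flat !ifF ?mulr0 ?subr0; last 2 first.
  - by apply/negbTE; rewrite -leNgt ltW.
  - by apply/negbTE; rewrite -leNgt ltW.
  exact: is_derive_cst.
- rewrite -{x}x0.
  have F0 k : flat k 0 = 0 by rewrite /flat ltxx.
  rewrite !F0 mulr0 subr0.
  have H : h^-1 *: (flat m (h *: 1 + 0) - flat m 0) @[h --> 0^'] --> (0 : R).
    rewrite F0; apply/cvgrPdist_le => e e0.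
    set C : R := m.+2%:R ^+ m.+2.
    have C0 : 0 < C by rewrite exprn_gt0// ltr0n.
    near=> h.
    have h0 : h != 0 by near: h; exact: nbhs_dnbhs_neq.
    rewrite /GRing.scale/= mulr1 addr0 subr0 sub0r normrN normrM normfV.
    have /andP[f0 fb] := flat_sqr_bound m h.
    rewrite (ger0_norm f0) mulrC ler_pdivrMr ?normr_gt0//.
    apply: le_trans fb _; rewrite -/C -real_normK ?num_real// expr2 mulrA ler_wpM2r//.
    rewrite mulrC -ler_pdivlMr//.
    near: h; apply: dnbhs0_le; exact: divr_gt0.
  apply: DeriveDef.
    by apply/cvg_ex; exists 0.
  exact/cvg_lim.
Unshelve. all: by end_near. Qed.

(** Products of two factors are what a bump needs, one for each end of its support; closure under
    differentiation makes all members smooth. *)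
Inductive flat_span : (R -> R) -> Prop :=
| flat_span_prod m n a b c d :
    flat_span (fun x => flat m (a * x + b) * flat n (c * x + d))
| flat_span_lin a f g : flat_span f -> flat_span g ->
    flat_span (fun x => a * f x + g x).

Let is_derive_flat_affine m a b x : is_derive x 1 (fun x => flat m (a * x + b))
  ((flat m.+2 (a * x + b) - m%:R * flat m.+1 (a * x + b)) * a).
Proof.
have D : is_derive x (1 : R) (fun x => a * x + b) a.
  by apply: is_derive_eq; rewrite addr0 /GRing.scale/= mulr1.
exact: (@is_derive1_comp _ (flat m) (fun x => a * x + b) _ _ _
  (is_derive_flat m (a * x + b)) D).
Qed.

Lemma flat_span_derive f : flat_span f ->
  exists2 g, flat_span g & forall x, is_derive x 1 f (g x).
Proof.
elim=> [m n a b c d|a f1 f2 _ [g1 s1 d1] _ [g2 s2 d2]]; last first.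
  exists (fun x => a * g1 x + g2 x); first exact: flat_span_lin.
  by move=> x; apply: is_deriveD; have := is_deriveZ a (d1 x).
pose F i j x := flat i (a * x + b) * flat j (c * x + d).
have sF i j : flat_span (F i j) by exact: flat_span_prod.
(* The last two terms cancel; they let the linear combination end in a member of the span. *)
exists (fun x => a * F m.+2 n x + (- (a * m%:R) * F m.+1 n x +
  (c * F m n.+2 x + (- (c * n%:R) * F m n.+1 x + (- 1 * F m n x + F m n x))))).
  by do 5 apply: flat_span_lin => //.
move=> x.
apply: (is_derive_eq (is_deriveM (is_derive_flat_affine m a b x)
  (is_derive_flat_affine n c d x))).
by rewrite /GRing.scale/= /F; ring.
Qed.
End SmoothBump.

(** * Test functions *)

Section TestFunctions.
Context {R : realType}.
Notation mu := (@lebesgue_measure R).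
Implicit Types (phi psi f g : R -> R) (a b c M x z : R).

Lemma smooth_flat_span f : flat_span f -> forall n x, derivable (f^`(n))%classic x 1.
Proof.
move=> sf n; elim: n f sf => [|n IH] f sf.
  by have [g sg dg] := flat_span_derive sf => x; have [] := dg x.
have [g sg dg] := flat_span_derive sf.
by rewrite derive1nSr (derive1_is_derive dg); exact: IH.
Qed.

Lemma test_function_vanish phi : test_function phi ->
  exists2 M, 0 < M & forall x, M <= `|x| -> phi x = 0.
Proof.
move=> [_ /compact_bounded [N [Nr H]]].
exists (`|N| + 1); first by have := normr_ge0 N; lra.
move=> x Mx; apply/eqP/negPn/negP => px.
have cx : closure [set x | phi x != 0] x by exact: subset_closure.
have h1 := ler_norm N; have h2 : N < `|N| + 1 / 2 by lra.
by have /= := H _ h2 x cx; lra.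
Qed.

Lemma test_function_bounded_support phi M :
  (forall n x, derivable (phi^`(n))%classic x 1) ->
  (forall x, M < `|x| -> phi x = 0) -> test_function phi.
Proof.
move=> sphi phi0; split => //.
apply: (subclosed_compact (@closed_closure _ _) (@segment_compact R (- M) M)).
have cI : closed `[- M, M]%classic by exact: interval_closed.
rewrite ((closure_id _).1 cI).
apply: closure_subset => x /= /eqP px; rewrite in_itv/= -ler_norml leNgt.
by apply/negP => /phi0.
Qed.

Lemma test_function_derive phi : test_function phi ->
  forall x, is_derive x 1 phi ((phi^`())%classic x).
Proof.
by move=> [sphi _] x; rewrite derive1E; apply/derivableP; exact: (sphi 0%N).
Qed.

Lemma test_function_derive1 phi : test_function phi ->
  test_function (phi^`())%classic.
Proof.
move=> [sphi cphi]; split; first by move=> n x; rewrite -derive1nSr.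
apply: (subclosed_compact (@closed_closure _ _) cphi).
rewrite [X in _ `<=` X]((closure_id _).1 (@closed_closure _ _)).
apply: closure_subset => x /= px.
apply: contrapT => nx; move/eqP : px; apply.
have /= : nbhs x (~` closure [set x | phi x != 0]).
  by apply: open_nbhs_nbhs; split => //; apply: closed_openC; exact: closed_closure.
move=> N; rewrite derive1E.
have E : \forall y \near x, (cst 0 : R -> R) y = phi y.
  by apply: filterS N => y ny; apply/esym/eqP/negPn/negP => py; apply: ny;
    exact: subset_closure.
have D : is_derive x (1 : R) phi 0.
  by apply: (near_eq_is_derive E); exact: is_derive_cst.
by case: D.
Qed.

Lemma test_function_derive1n n phi : test_function phi ->
  test_function (phi^`(n))%classic.
Proof.
by elim: n => // n IH tphi; rewrite derive1nS; apply/test_function_derive1/IH.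
Qed.

Lemma test_function_continuous phi : test_function phi -> continuous phi.
Proof. by move=> t; apply: is_derive_continuous (test_function_derive t). Qed.

Lemma Rintegral_vanish f M : 0 < M -> (forall x, M <= `|x| -> f x = 0) ->
  \int[mu]_x f x = oint (- M) M f.
Proof.
move=> M0 f0; rewrite oint_le; last by lra.
rewrite [RHS]Rintegral_mkcond; apply: eq_Rintegral => x _.
rewrite patchE; case: ifPn => // /negP nx; apply: f0; rewrite leNgt.
by apply/negP => xM; apply: nx; rewrite inE/= in_itv/= -ler_norml ltW.
Qed.

Lemma locally_integrableM f g : continuous f -> locally_integrable setT g ->
  locally_integrable setT (fun x => f x * g x).
Proof.
move=> cf [mg _ lg]; split; [|exact: openT|].
  by apply: measurable_funM => //; exact: continuous_measurable_fun.
move=> K _ cK.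
have [C [Cr HC]] : bounded_set (f @` K).
  apply: compact_bounded; apply: continuous_compact => //.
  exact: continuous_subspaceT.
have C0 : 0 <= `|C| + 1 by have := normr_ge0 C; lra.
have mK : measurable K by exact: compact_measurable.
apply: (@le_lt_trans _ _ (\int[mu]_(x in K) ((`|C| + 1)%:E * `|(g x)%:E|))%E).
  apply: ge0_le_integral => //.
  - apply/measurable_EFinP; apply/measurable_funTS; apply: measurableT_comp => //.
    by apply: measurable_funM => //; exact: continuous_measurable_fun.
  - apply/measurable_funeM; apply/measurable_EFinP; apply: measurable_funTS.
    by apply: measurableT_comp.
  - move=> x Kx; rewrite normrM -EFinM lee_fin ler_wpM2r//.
    have Cn : C < `|C| + 1 by have := ler_norm C; lra.
    exact: (HC _ Cn (f x) (ex_intro2 _ _ x Kx erefl)).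
rewrite ge0_integralZl//; first last.
- by apply/measurable_EFinP; apply: measurable_funTS; apply: measurableT_comp.
apply: lte_mul_pinfty => //.
by have := lg K (@subsetT _ _) cK.
Qed.

End TestFunctions.

(** * Integration by parts with a locally integrable factor *)

Section IntegrationByParts.
Context {R : realType}.
Notation mu := (@lebesgue_measure R).
Implicit Types (phi f g u v : R -> R) (a b c s t x z : R).

Lemma locally_integrable_norm f : locally_integrable setT f ->
  locally_integrable setT (fun x => `|f x|).
Proof.
move=> [mf _ hf]; split; [exact: measurableT_comp|exact: openT|].
by move=> K KT cK; under eq_integral do rewrite normr_id; exact: hf.
Qed.

Lemma locally_integrable_add f g : locally_integrable setT f ->
  locally_integrable setT g -> locally_integrable setT (fun x => f x + g x).
Proof. exact: locally_integrableD. Qed.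

Lemma locally_integrableZ c f : locally_integrable setT f ->
  locally_integrable setT (fun x => c * f x).
Proof. by apply: locally_integrableM => z; exact: cvg_cst. Qed.

Lemma locally_integrable_cst c : locally_integrable setT (fun _ : R => c).
Proof. by apply: continuous_locally_integrable => z; exact: cvg_cst. Qed.

Lemma oint_cst a b c : oint a b (fun=> c) = c * (b - a).
Proof.
have D (z : R) : is_derive z (1 : R) (fun x => c * x) c.
  by apply: is_derive_eq; rewrite /GRing.scale/= mulr1.
by rewrite (oint_derive _ _ _ D) ?mulrBr// => z; exact: cvg_cst.
Qed.

Lemma ler_oint a b f g : locally_integrable setT f -> locally_integrable setT g ->
  a <= b -> (forall x, a <= x <= b -> f x <= g x) -> oint a b f <= oint a b g.
Proof.
move=> lf lg ab fg; rewrite !oint_le//.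
by apply: le_Rintegral => //; exact: locally_integrable_itv.
Qed.

Lemma ler_norm_oint a b f : locally_integrable setT f -> a <= b ->
  `|oint a b f| <= oint a b (fun x => `|f x|).
Proof.
move=> lf ab; rewrite !oint_le//; apply: le_normr_Rintegral => //.
exact: locally_integrable_itv.
Qed.

Lemma eq_oint a b f g : (forall x, f x = g x) -> oint a b f = oint a b g.
Proof. by move=> fg; congr oint; apply/funext. Qed.

Lemma locally_integrable_prim_continuous f : locally_integrable setT f ->
  continuous (prim f).
Proof.
move=> lf z; pose a := - `|z| - 1; pose b := `|z| + 1.
have zab : z \in `]a, b[.
  rewrite in_itv/= /a /b; have := ler_norm z; have := ler_norm (- z).
  by rewrite normrN => ? ?; apply/andP; split; lra.
have a0 : a < 0 by rewrite /a; have := normr_ge0 z; lra.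
have ab : a <= b by rewrite /a /b; have := normr_ge0 z; lra.
have ab' : a < b by rewrite /a /b; have := normr_ge0 z; lra.
have C := parameterized_integral_continuous ab (locally_integrable_itv a b lf).
have {}C := within_continuous_continuous ab' C zab.
have az : a < z by move: zab; rewrite in_itv/= => /andP[].
have E : {near z, (fun y => parameterized_integral mu a y f - oint a 0 f)
    =1 prim f}.
  near=> y.
  have ay : a <= y.
    by near: y; apply: filterS (lt_nbhsr az) => y /ltW.
  rewrite /parameterized_integral -oint_le//= /prim -(oint_chasles a 0 y lf); lra.
rewrite /continuous_at -(nbhs_singleton E).
apply: cvg_trans (near_eq_cvg E) _.
by apply: cvgB; [exact: C|exact: cvg_cst].
Unshelve. all: by end_near. Qed.

(* Since [g] is continuous, the difference quotients of [f] tend to zero. *)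
Lemma derive0_of_modulus f g c : continuous g ->
  (forall s t, s <= t -> `|f t - f s| <= c * (t - s) * (g t - g s)) ->
  forall x y, f x = f y.
Proof.
move=> cg H x y; apply: is_derive_0_is_cst => {x y} s.
have H2 t : `|f t - f s| <= `|c| * `|t - s| * `|g t - g s|.
  have [st|/ltW ts] := leP s t.
    apply: le_trans (H _ _ st) _; rewrite -!normrM; exact: ler_norm.
  rewrite (distrC (f t)) (distrC t) (distrC (g t)).
  by apply: le_trans (H _ _ ts) _; rewrite -!normrM; exact: ler_norm.
have L : h^-1 *: (f (h *: 1 + s) - f s) @[h --> 0^'] --> (0 : R).
  apply/cvgrPdist_le => e e0.
  have c0 : 0 < `|c| + 1 by have := normr_ge0 c; lra.
  have K : \forall h \near 0^', `|g (h + s) - g s| <= e / (`|c| + 1).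
    apply: cvg_within.
    have : g (h + s) @[h --> 0] --> g (0 + s).
      apply: (@continuous_comp _ _ _ (fun h => h + s) g); last exact: cg.
      by apply: cvgD; [exact: cvg_id|exact: cvg_cst].
    rewrite add0r => /cvgrPdist_le /(_ (e / (`|c| + 1)) (divr_gt0 e0 c0)).
    by apply: filterS => h; rewrite distrC.
  near=> h.
  have h0 : h != 0 by near: h; exact: nbhs_dnbhs_neq.
  have K' : `|g (h + s) - g s| <= e / (`|c| + 1) by near: h.
  rewrite /GRing.scale/= mulr1 sub0r normrN normrM normfV mulrC.
  rewrite ler_pdivrMr ?normr_gt0//; apply: le_trans (H2 _) _.
  rewrite addrK mulrAC ler_wpM2r//.
  rewrite ler_pdivlMr// in K'; rewrite mulrC; apply: le_trans K'.
  by rewrite ler_wpM2l// lerDl.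
by apply: DeriveDef; [apply/cvg_ex; exists 0|exact/cvg_lim].
Unshelve. all: by end_near. Qed.

(* [prim v] need not be differentiable, but the defect over [s, t] is at most
   [2 c (t - s)] times the integral of [|v|] over [s, t]. *)
Lemma prim_by_parts phi phi' v c a b : continuous phi' ->
  (forall x, is_derive x 1 phi (phi' x)) -> (forall x, `|phi' x| <= c) ->
  locally_integrable setT v ->
  oint a b (fun x => phi' x * prim v x) =
  phi b * prim v b - phi a * prim v a - oint a b (fun x => phi x * v x).
Proof.
move=> cphi' dphi bphi' lv.
have cphi := is_derive_continuous dphi.
have cV := locally_integrable_prim_continuous lv.
have l1 : locally_integrable setT (fun x => phi' x * prim v x).
  by apply: locally_integrableM => //; exact: continuous_locally_integrable.
have l2 : locally_integrable setT (fun x => phi x * v x).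
  exact: locally_integrableM.
have l12 := locally_integrable_add l1 l2.
pose N := prim (fun x => `|v x|); have lN := locally_integrable_norm lv.
have cN : continuous N by exact: locally_integrable_prim_continuous.
pose G t := prim (fun x => phi' x * prim v x + phi x * v x) t - phi t * prim v t.
suff GE : G b = G a.
  move: GE; rewrite /G => /eqP; rewrite subr_eq -addrA => /eqP GE.
  have := oint_prim a b l12; rewrite ointD// GE; lra.
apply: (@derive0_of_modulus _ N (2 * c)) => // s t st.
(* With increments based at [s] and at [t], both terms are small on [s, t]: the first by the
   integral of |v|, the second by c (t - s). *)
have -> : G t - G s = oint s t (fun x => phi' x * (prim v x - prim v s) +
    (phi x - phi t) * v x).
  transitivity (oint s t (fun x => (phi' x * prim v x + phi x * v x) +
      ((- prim v s) * phi' x + (- phi t) * v x))); last first.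
    by apply: eq_oint => x; ring.
  have lphi' := continuous_locally_integrable cphi'.
  rewrite ointD//; last by apply: locally_integrable_add; exact: locally_integrableZ.
  rewrite [X in _ = _ + X]ointD ?ointZ//; try exact: locally_integrableZ.
  rewrite (oint_derive _ _ cphi' dphi) (oint_prim s t lv) (oint_prim s t l12) /G.
  ring.
have l3 : locally_integrable setT (fun x => phi' x * (prim v x - prim v s)).
  apply: locally_integrableM => //; apply: continuous_locally_integrable.
  by move=> x; apply: cvgB; [exact: cV|exact: cvg_cst].
have l4 : locally_integrable setT (fun x => (phi x - phi t) * v x).
  apply: locally_integrableM => //.
  by move=> x; apply: cvgB; [exact: cphi|exact: cvg_cst].
apply: le_trans (ler_norm_oint _ st) _; first exact: locally_integrable_add.
have l5 : locally_integrable setT (fun x => c * (N t - N s) + (c * (t - s)) * `|v x|).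
  apply: locally_integrable_add; first exact: locally_integrable_cst.
  exact: locally_integrableZ.
apply: le_trans (ler_oint (locally_integrable_norm (locally_integrable_add l3 l4)) l5 st _) _;
  last first.
  rewrite (ointD s t (locally_integrable_cst _) (locally_integrableZ _ lN)).
  rewrite oint_cst (ointZ s t _ lN) (oint_prim s t lN) -/N.
  by rewrite le_eqVlt; apply/orP; left; apply/eqP; ring.
move=> x /andP[sx xt]; apply: le_trans (ler_normD _ _) _; rewrite !normrM.
have c0 : 0 <= c by apply: le_trans (bphi' 0).
apply: lerD.
  apply: ler_pM => //.
  rewrite -oint_prim//; apply: le_trans (ler_norm_oint lv sx) _.
  rewrite -(oint_prim s t lN) -(oint_chasles s x t lN) lerDl.
  by rewrite oint_le// Rintegral_ge0.
rewrite ler_wpM2r// distrC -(oint_derive x t cphi' dphi).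
have lphi' := continuous_locally_integrable cphi'.
apply: le_trans (ler_norm_oint lphi' xt) _.
apply: le_trans (ler_oint (locally_integrable_norm lphi') (locally_integrable_cst c) xt _) _.
  by move=> y _; exact: bphi'.
by rewrite oint_cst ler_wpM2l//; lra.
Qed.
End IntegrationByParts.

(** * The du Bois-Reymond lemma: weak derivatives and primitives *)

Section DuBoisReymond.
Context {R : realType}.
Notation mu := (@lebesgue_measure R).
Implicit Types (phi psi f h u v w : R -> R) (a b c x z M : R) (n : nat).

(** By Lebesgue's differentiation theorem [h] is almost everywhere the derivative of its
    primitive. *)
Lemma prim_eq0_ae h : locally_integrable setT h -> (forall z, prim h z = 0) ->
  {ae mu, forall z, h z = 0}.
Proof.
move=> lh h0; have := lebesgue_differentiation lh.
apply: filterS; first exact: (ae_filter_ringOfSetsType mu).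
move=> z lz; have z1 : z < z + 1 by rewrite ltrDl.
have [| |_ <-] := @FTC1_lebesgue_pt R h (BLeft (z - 1)) z (z + 1) z1 _ _ lz; last first.
- rewrite (_ : (fun y => _) = cst 0) ?derive1_cst//; apply/funext => y /=.
  have [zy|yz] := leP (z - 1) y.
    by rewrite -oint_le// oint_prim// !h0 subrr.
  by rewrite set_itv_ge ?Rintegral_set0// bnd_simp -ltNge.
- by rewrite /= lte_fin gtrBl.
- exact: locally_integrable_itv.
Qed.

(** Written in affine form to match [flat_span_prod]; the factor [n.+1] steepens both ends. *)
Definition bump a b n x : R :=
  flat 0 (n.+1%:R * x + - (n.+1%:R * a)) * flat 0 (- n.+1%:R * x + n.+1%:R * b).

Lemma bumpE a b n x :
  bump a b n x = flat 0 (n.+1%:R * (x - a)) * flat 0 (n.+1%:R * (b - x)).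
Proof. by rewrite /bump !mulrBr mulNr [X in _ * flat 0 X = _]addrC. Qed.

Lemma flat0_le1 x : flat 0 x <= 1.
Proof.
rewrite /flat; case: ifPn => // x0; rewrite expr0 mul1r -expR0 ler_expR.
by rewrite oppr_le0 invr_ge0 ltW.
Qed.

Lemma bump_vanish a b n x : ~ a < x < b -> bump a b n x = 0.
Proof.
move=> nx; rewrite bumpE /flat.
rewrite !(pmulr_rgt0 _ (ltr0Sn R n)) !subr_gt0.
by case: ifPn => ax; rewrite ?mul0r//; case: ifPn => xb; rewrite ?mulr0//;
  case: nx; rewrite ax xb.
Qed.

Lemma bump_continuous a b n : continuous (bump a b n).
Proof.
have [g _ dg] := flat_span_derive (flat_span_prod 0 0 n.+1%:R (- (n.+1%:R * a))
  (- n.+1%:R) (n.+1%:R * b)).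
exact: is_derive_continuous dg.
Qed.

Lemma bump_bound a b n x : `|bump a b n x| <= 1.
Proof.
rewrite normrM !ger0_norm ?flat_ge0//.
by rewrite mulr_ile1 ?flat_ge0 ?flat0_le1.
Qed.

Let flat0_cvg z : 0 < z -> flat 0 (n.+1%:R * z) @[n --> \oo] --> (1 : R).
Proof.
move=> z0.
have E n : flat 0 (n.+1%:R * z) = expR (- (z^-1 * n.+1%:R^-1)).
  by rewrite /flat pmulr_rgt0// z0 expr0 mul1r invfM mulrC.
have C : z^-1 * (harmonic n : R) @[n --> \oo] --> z^-1 * 0.
  by apply: cvgM; [exact: cvg_cst|exact: cvg_harmonic].
rewrite mulr0 in C.
have C' : - (z^-1 * (harmonic n : R)) @[n --> \oo] --> (0 : R).
  by rewrite -[X in _ --> X]oppr0; apply: cvgN.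
rewrite (_ : (fun n => _) = expR \o (fun n => - (z^-1 * (harmonic n : R)))); last first.
  by apply/funext => n; rewrite E.
by rewrite -expR0; apply: (cvg_comp _ _ C'); exact: continuous_expR.
Qed.

Lemma bump_cvg a b x : a < x < b -> bump a b n x @[n --> \oo] --> (1 : R).
Proof.
move=> /andP[ax xb]; rewrite -(mulr1 1).
under eq_cvg do rewrite bumpE.
by apply: cvgM; apply: flat0_cvg; rewrite subr_gt0.
Qed.

(* The bumps converge to the indicator of ]a, b[ as [n] grows. *)
Lemma bump_test_eq0 a b h : locally_integrable setT h -> a < b ->
  (forall n, \int[mu]_x (bump a b n x * h x) = 0) -> oint a b h = 0.
Proof.
move=> lh ab H; have [mh _ _] := lh.
have ih : mu.-integrable `]a, b[ (EFin \o h).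
  by apply: integrableS (locally_integrable_itv a b lh) => //;
    exact: subset_itv_oo_cc.
pose f n x := (bump a b n x * h x)%:E.
have mf n : measurable_fun `]a, b[ (f n).
  apply/measurable_EFinP; apply: measurable_funTS; apply: measurable_funM => //.
  by apply: continuous_measurable_fun; exact: bump_continuous.
have [| | | | |_ _] := @dominated_convergence _ _ _ mu `]a, b[ _ f (EFin \o h)
    (EFin \o (fun x => `|h x|)) mf.
- exact: measurable_itv.
- by apply/measurable_EFinP; exact: measurable_funTS.
- apply: aeW => x; rewrite /= in_itv/= => xab; apply: cvg_EFin; first exact: nearW.
  rewrite /f/= -[X in _ --> X]mul1r; apply: cvgM; [exact: bump_cvg|exact: cvg_cst].
- exact: integrable_norm.
- apply: aeW => x n _ /=; rewrite lee_fin normrM ler_piMl//; exact: bump_bound.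
rewrite [X in X @ _](_ : _ = cst 0%E); last first.
  apply/funext => n; rewrite /f /=.
  have fin : (\int[mu]_(x in `]a, b[) (bump a b n x * h x)%:E)%E \is a fin_num.
    apply: integrable_fin_num => //.
    have lbh := locally_integrableM (@bump_continuous a b n) lh.
    apply: integrableS (locally_integrable_itv a b lbh) => //.
    exact: subset_itv_oo_cc.
  rewrite -(fineK fin); congr EFin; rewrite -[LHS]/(Rintegral _ _ _).
  rewrite -[RHS](H n) Rintegral_mkcond; apply: eq_Rintegral => x _.
  rewrite patchE; case: ifPn => // /negP nx; rewrite bump_vanish ?mul0r// => xab.
  by apply: nx; rewrite inE/= in_itv.
move=> /cvg_lim => /(_ (@ereal_hausdorff R)); rewrite lim_cst// => E.
rewrite oint_le ?ltW// -Rintegral_itv_bndo_bndc; last first.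
  by apply: integrableS (locally_integrable_itv a b lh) => //; exact: subset_itv_co_cc.
rewrite -Rintegral_itv_obnd_cbnd// /Rintegral -E//.
Qed.

Lemma test_function_bounded phi : test_function phi ->
  exists c, forall x, `|phi x| <= c.
Proof.
move=> tphi; have [M M0 phiM] := test_function_vanish tphi.
have [C [Cr HC]] : bounded_set (phi @` `[- M, M]).
  apply: compact_bounded; apply: continuous_compact; last exact: segment_compact.
  by apply: continuous_subspaceT; exact: test_function_continuous.
have Cn : C < `|C| + 1 by have := ler_norm C; lra.
exists (`|C| + 1) => x; have [/phiM ->|xM] := leP M `|x|.
  by rewrite normr0; have := normr_ge0 C; lra.
by apply: (HC _ Cn); exists x => //; rewrite /= in_itv/= -ler_norml ltW.
Qed.

(** The primitive started at [- M] vanishes to the left by the support of [psi], and to the right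
    because the whole integral is zero. *)
Lemma test_function_prim psi M : 0 < M -> flat_span psi ->
  (forall x, M <= `|x| -> psi x = 0) -> \int[mu]_x psi x = 0 ->
  exists2 phi, test_function phi & (phi^`())%classic = psi.
Proof.
move=> M0 spsi psiM; rewrite (Rintegral_vanish M0 psiM) => I0.
have [g _ dg] := flat_span_derive spsi; have cpsi := is_derive_continuous dg.
have lpsi := continuous_locally_integrable cpsi.
pose phi x := prim psi x - prim psi (- M).
have dphi (x : R) : is_derive x (1 : R) phi (psi x).
  by rewrite -[psi x]subr0; apply: is_deriveB; exact: is_derive_prim.
exists phi; last exact: derive1_is_derive.
apply: (@test_function_bounded_support _ _ M).
  case=> [|n] x; first by have [] := dphi x.
  by rewrite derive1nSr (derive1_is_derive dphi); exact: smooth_flat_span.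
move=> x; rewrite ltNge ler_norml negb_and -!ltNge => /orP[xM|Mx].
  rewrite /phi -oint_prim// ointC oint_le ?ltW//; apply/eqP; rewrite oppr_eq0; apply/eqP.
  rewrite (@eq_Rintegral _ _ _ _ _ (cst 0)) ?Rintegral_cst ?mul0r//= => y.
  rewrite inE /= in_itv/= => /andP[_ yM]; apply: psiM.
  by rewrite ler_normr; apply/orP; right; lra.
rewrite /phi -oint_prim// -(oint_chasles (- M) M x lpsi) I0 add0r oint_le ?ltW//.
rewrite (@eq_Rintegral _ _ _ _ _ (cst 0)) ?Rintegral_cst ?mul0r//= => y.
rewrite inE /= in_itv/= => /andP[My _]; apply: psiM.
by rewrite ler_normr My.
Qed.

Let integrable_testM psi f M : continuous psi -> 0 < M ->
  (forall x, M <= `|x| -> psi x = 0) -> locally_integrable setT f ->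
  \int[mu]_x (psi x * f x) = oint (- M) M (fun x => psi x * f x).
Proof.
by move=> cpsi M0 psiM lf; apply: Rintegral_vanish => // x /psiM ->; rewrite mul0r.
Qed.

Let bump_vanish_far a b n x : `|a| + `|b| + 1 <= `|x| -> bump a b n x = 0.
Proof.
move=> H; apply: bump_vanish => /andP[ax xb]; move: H.
have := ler_norm b; have := ler_norm (- a); rewrite normrN => ha hb.
have := normr_ge0 a; have := normr_ge0 b.
by move=> ? ?; rewrite leNgt ltr_norml; move/negP; apply; apply/andP; split; lra.
Qed.

(** Otherwise the limit of the bumps would give the unit interval length zero. *)
Lemma bump_mass n0 : exists n, \int[mu]_x bump 0 1 n x != 0.
Proof.
apply: contrapT => H.
have H0 n : \int[mu]_x (bump 0 1 n x * 1) = 0.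
  under eq_Rintegral do rewrite mulr1.
  by apply/eqP/negPn/negP => Hn; apply: H; exists n.
have := bump_test_eq0 (locally_integrable_cst 1) ltr01 H0.
by rewrite oint_cst subr0 mulr1 => /eqP; rewrite oner_eq0.
Qed.

(* A bump minus a multiple of a fixed bump of nonzero mass has zero integral, hence
   is the derivative of a test function. *)
Lemma ae_cst_of_weak_derivative0 w : locally_integrable setT w ->
  (forall phi, test_function phi -> \int[mu]_x ((phi^`())%classic x * w x) = 0) ->
  exists c, {ae mu, forall x, w x = c}.
Proof.
move=> lw H; have [m J0] := bump_mass 0%N; set J := Rintegral _ _ _ in J0.
pose c := \int[mu]_x (bump 0 1 m x * w x) / J; exists c.
pose h x := w x - c.
have lh : locally_integrable setT h.
  by apply: locally_integrable_add => //; exact: locally_integrable_cst.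
suff h0 z : prim h z = 0.
  have := prim_eq0_ae lh h0.
  apply: filterS; first exact: (ae_filter_ringOfSetsType mu).
  by move=> z /eqP; rewrite subr_eq0 => /eqP.
have O a b : a < b -> oint a b h = 0.
  move=> ab; apply: bump_test_eq0 => // n.
  pose M := (`|a| + `|b| + 1) + (`|0 : R| + `|1 : R| + 1).
  have M0 : 0 < M.
    by rewrite /M normr0 normr1; have := normr_ge0 a; have := normr_ge0 b; lra.
  have v1 x : M <= `|x| -> bump a b n x = 0.
    move=> Mx; apply: bump_vanish_far; apply: le_trans Mx.
    by rewrite /M normr0 normr1; lra.
  have v2 x : M <= `|x| -> bump 0 1 m x = 0.
    move=> Mx; apply: bump_vanish_far; apply: le_trans Mx.
    by rewrite /M; have := normr_ge0 a; have := normr_ge0 b; lra.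
  have cb n' a' b' := @bump_continuous a' b' n'.
  have lb n' a' b' := continuous_locally_integrable (cb n' a' b').
  pose t := (\int[mu]_x bump a b n x) / J.
  pose psi x := (- t) * bump 0 1 m x + bump a b n x.
  have psiM x : M <= `|x| -> psi x = 0.
    by move=> Mx; rewrite /psi v1// v2// mulr0 addr0.
  have spsi : flat_span psi by apply: flat_span_lin; exact: flat_span_prod.
  have I0 : \int[mu]_x psi x = 0.
    rewrite (Rintegral_vanish M0 psiM) /psi ointD//; last exact: locally_integrableZ.
    rewrite ointZ// -!(Rintegral_vanish M0)// -/J /t mulNr divfK//.
    by rewrite addrC subrr.
  have [phi tphi dphi] := test_function_prim M0 spsi psiM I0.
  have := H _ tphi; rewrite dphi.
  have cpsi := is_derive_continuous (test_function_derive (test_function_derive1 tphi)).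
  rewrite dphi in cpsi.
  rewrite (integrable_testM cpsi M0 psiM lw).
  have lbw a' b' n' := locally_integrableM (cb n' a' b') lw.
  have E1 x : psi x * w x = (- t) * (bump 0 1 m x * w x) + bump a b n x * w x.
    by rewrite /psi; ring.
  rewrite (eq_oint _ _ E1) ointD//; last exact: locally_integrableZ.
  rewrite ointZ// -(integrable_testM (cb _ _ _) M0 v2 lw).
  rewrite (integrable_testM (cb _ _ _) M0 v1 lh).
  have E2 x : bump a b n x * h x = bump a b n x * w x + (- c) * bump a b n x.
    by rewrite /h; ring.
  rewrite (eq_oint _ _ E2) ointD//; last exact: locally_integrableZ.
  rewrite ointZ// -(Rintegral_vanish M0 v1) /t /c => K.
  rewrite -[RHS]K; move: (Rintegral _ _ _) (Rintegral _ _ _) (oint _ _ _) => A B C.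
  by field.
have [z0|z0|<-] := ltgtP 0 z; [exact: O| |exact: prim0].
by rewrite /prim ointC O ?oppr0.
Qed.

Definition weak_derivative n u v := [/\ locally_integrable setT u,
  locally_integrable setT v & forall phi, test_function phi ->
    \int[mu]_x ((phi^`(n))%classic x * u x) = (-1) ^+ n * \int[mu]_x (phi x * v x)].

Lemma test_function_vanish2 phi : test_function phi -> exists M, [/\ 0 < M,
  forall x, M <= `|x| -> phi x = 0 & forall x, M <= `|x| -> (phi^`())%classic x = 0].
Proof.
move=> tphi; have [M M0 H] := test_function_vanish tphi.
have [N N0 H'] := test_function_vanish (test_function_derive1 tphi).
exists (M + N); split; first by lra.
  by move=> x Mx; apply: H; lra.
by move=> x Mx; apply: H'; lra.
Qed.

Lemma test_by_parts phi c v : test_function phi -> locally_integrable setT v ->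
  \int[mu]_x ((phi^`())%classic x * (c + prim v x)) = - \int[mu]_x (phi x * v x).
Proof.
move=> tphi lv; have [M [M0 H H']] := test_function_vanish2 tphi.
have [C HC] := test_function_bounded (test_function_derive1 tphi).
have cphi := test_function_continuous tphi.
have cphi' := test_function_continuous (test_function_derive1 tphi).
have dphi := test_function_derive tphi.
have lV := continuous_locally_integrable (locally_integrable_prim_continuous lv).
have lphi' := continuous_locally_integrable cphi'.
rewrite (integrable_testM cphi M0 H lv).
have lcV : locally_integrable setT (fun x => c + prim v x).
  by apply: locally_integrable_add => //; exact: locally_integrable_cst.
rewrite (integrable_testM cphi' M0 H' lcV).
have E x : (phi^`())%classic x * (c + prim v x) =
    c * (phi^`())%classic x + (phi^`())%classic x * prim v x by ring.
rewrite (eq_oint _ _ E) (ointD _ _ (locally_integrableZ _ lphi')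
  (locally_integrableM cphi' lV)) ointZ//.
rewrite (oint_derive _ _ cphi' dphi) (prim_by_parts _ _ cphi' dphi HC lv).
rewrite (H M) ?(H (- M)) ?normrN ?ger0_norm// ?ltW//; ring.
Qed.

Lemma weak_derivative_cst_prim c v : locally_integrable setT v ->
  weak_derivative 1 (fun x => c + prim v x) v.
Proof.
move=> lv; split => //.
  apply: locally_integrable_add; first exact: locally_integrable_cst.
  exact: continuous_locally_integrable (locally_integrable_prim_continuous lv).
by move=> phi tphi; rewrite expr1 mulN1r; exact: test_by_parts.
Qed.

Lemma weak_derivative_prim u v : weak_derivative 1 u v ->
  exists c, {ae mu, forall x, u x = c + prim v x}.
Proof.
move=> [lu lv H].
have lV := continuous_locally_integrable (locally_integrable_prim_continuous lv).
pose w x := u x + (-1) * (0 + prim v x).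
have l0V : locally_integrable setT (fun x => 0 + prim v x).
  by apply: locally_integrable_add => //; exact: locally_integrable_cst.
have lw : locally_integrable setT w.
  by apply: locally_integrable_add => //; exact: locally_integrableZ.
have [|c Hc] := ae_cst_of_weak_derivative0 lw.
  move=> phi tphi; have [M [M0 M1 M2]] := test_function_vanish2 tphi.
  have cphi' := test_function_continuous (test_function_derive1 tphi).
  rewrite (integrable_testM cphi' M0 M2 lw).
  have E x : (phi^`())%classic x * w x = (phi^`())%classic x * u x +
      (-1) * ((phi^`())%classic x * (0 + prim v x)) by rewrite /w; ring.
  rewrite (eq_oint _ _ E) ointD; last 2 first.
  - exact: locally_integrableM.
  - by apply: locally_integrableZ; exact: locally_integrableM.
  rewrite ointZ; last exact: locally_integrableM.
  rewrite -(integrable_testM cphi' M0 M2 lu) -(integrable_testM cphi' M0 M2 l0V).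
  rewrite (test_by_parts 0 tphi lv); have := H _ tphi.
  by rewrite expr1 => ->; ring.
exists c; apply: filterS Hc; first exact: (ae_filter_ringOfSetsType mu).
by move=> x <-; rewrite /w add0r mulN1r subrK.
Qed.

Lemma weak_derivative_shift n u v w : weak_derivative 1 u v ->
  weak_derivative n.+1 u w -> weak_derivative n v w.
Proof.
move=> [lu lv H1] [_ lw H]; split => // phi tphi.
have := H1 _ (test_function_derive1n n tphi).
rewrite expr1 mulN1r derive1n1 -derive1nS (H _ tphi) exprS -mulrA mulN1r.
by move/oppr_inj => ->.
Qed.

Lemma weak_derivative_trans n u v w : weak_derivative 1 u v ->
  weak_derivative n v w -> weak_derivative n.+1 u w.
Proof.
move=> [lu lv H1] [_ lw H]; split => // phi tphi.
have := H1 _ (test_function_derive1n n tphi).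
by rewrite expr1 mulN1r derive1n1 -derive1nS (H _ tphi) exprS -mulrA mulN1r.
Qed.

End DuBoisReymond.

(** * The operator on complex functions *)

Section SquareIntegrable.
Context {R : realType}.
Notation mu := (@lebesgue_measure R).
Local Notation tau := (pi *+ 2 : R).
Implicit Types (f g h : R -> R) (u v w : R -> R[i]) (a b c x z M : R) (n : nat).

Lemma locally_integrable_dominated f g : measurable_fun setT f ->
  locally_integrable setT g -> (forall x, `|f x| <= g x) ->
  locally_integrable setT f.
Proof.
move=> mf [mg _ lg] fg; split => //; first exact: openT.
move=> K KT cK; have mK : measurable K by exact: compact_measurable.
apply: le_lt_trans (lg K KT cK).
apply: ge0_le_integral => //.
- by apply/measurable_EFinP/measurable_funTS; exact: measurableT_comp.
- by apply/measurable_EFinP/measurable_funTS; exact: measurableT_comp.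
- by move=> x _; rewrite lee_fin; apply: le_trans (fg x) (ler_norm _).
Qed.

Lemma locally_integrable_periodic f T : 0 < T -> measurable_fun setT f ->
  (forall x, 0 <= f x) -> periodic f T ->
  (\int[mu]_(x in `[0%R, T]) (f x)%:E < +oo)%E -> locally_integrable setT f.
Proof.
move=> T0 mf f0 pf If.
have mE : measurable_fun setT (EFin \o f) by exact/measurable_EFinP.
have fE x : (0 <= (f x)%:E)%E by rewrite lee_fin.
have tr a b n : (\int[mu]_(x in `[a, b]) (f x)%:E =
    \int[mu]_(x in `[(a - T *+ n)%R, (b - T *+ n)%R]) (f x)%:E)%E.
  rewrite (@ge0_integral_translate _ (T *+ n) (EFin \o f) `[a, b])// itv_translate.
  by apply: eq_integral => x _ /=; rewrite (periodicn pf).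
have I n : (\int[mu]_(x in `[0%R, (T *+ n)%R]) (f x)%:E < +oo)%E.
  elim: n => [|n IH]; first by rewrite set_itv1 integral_set1.
  apply: (@le_lt_trans _ _ (\int[mu]_(x in `[0%R, T] `|` `]T, (T *+ n.+1)%R]) (f x)%:E)%E).
    apply: ge0_subset_integral => //.
    - exact: measurableU.
    - exact: measurable_funTS.
    - move=> x /=; rewrite !in_itv/= => /andP[x0 xn].
      by have [xT|xT] := leP x T; [left; rewrite andbT|right].
  rewrite ge0_integral_setU//; first last.
  - apply/disj_set2P; rewrite -subset0 => x /=; rewrite !in_itv/=.
    by move=> [/andP[_ xT] /andP[Tx _]]; move: Tx; rewrite ltNge xT.
  - exact: measurable_funTS.
  apply: lte_add_pinfty => //.
  apply: (@le_lt_trans _ _ (\int[mu]_(x in `[T, (T *+ n.+1)%R]) (f x)%:E)%E).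
    apply: ge0_subset_integral => //; first exact: measurable_funTS.
    by apply: subset_itvr; rewrite bnd_simp.
  by rewrite (tr _ _ 1%N) mulr1n subrr mulrSr addrK.
split => //; first exact: openT.
move=> K _ cK; have mK : measurable K by exact: compact_measurable.
have [M [Mr HM]] := compact_bounded cK.
have [n nM] : exists n, `|M| + 1 <= T *+ n.
  exists (Num.bound ((`|M| + 1) / T)).
  rewrite -mulr_natr -ler_pdivrMl// mulrC ltW//; apply: archi_boundP.
  by rewrite divr_ge0 ?(ltW T0)//; have := normr_ge0 M; lra.
apply: (@le_lt_trans _ _ (\int[mu]_(x in `[(- (T *+ n))%R, (T *+ n)%R]) (f x)%:E)%E).
  under eq_integral do rewrite ger0_norm//.
  apply: ge0_subset_integral => //; first exact: measurable_funTS.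
  move=> x Kx; rewrite /= in_itv/= -ler_norml; apply: le_trans nM.
  by apply: (HM (`|M| + 1)) => //; have := ler_norm M; lra.
have := tr 0 (T *+ n *+ 2) n; rewrite sub0r mulr2n addrK => <-.
by rewrite -mulrnDr.
Qed.

Lemma sqr_normc (y : R[i]) : Normc.normc y ^+ 2 = complex.Re y ^+ 2 + complex.Im y ^+ 2.
Proof.
by case: y => a b /=; rewrite /Normc.normc sqr_sqrtr// addr_ge0 ?sqr_ge0.
Qed.

Definition sqint f := [/\ periodic f tau, measurable_fun setT f &
  locally_integrable setT (fun x => f x ^+ 2)].

Lemma sqint_locint f : sqint f -> locally_integrable setT f.
Proof.
move=> [_ mf lf]; apply: (@locally_integrable_dominated f (fun x => 1 + f x ^+ 2)) => //.
  by apply: locally_integrable_add => //; exact: locally_integrable_cst.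
move=> x; rewrite -real_normK ?num_real//.
by have := sqr_ge0 (`|f x| - 1); have := sqr_ge0 (`|f x|); nra.
Qed.

Lemma sqintD f g : sqint f -> sqint g -> sqint (fun x => f x + g x).
Proof.
move=> [pf mf lf] [pg mg lg]; split; first by move=> x; rewrite pf pg.
  exact: measurable_funD.
apply: (@locally_integrable_dominated _ (fun x => 2 * f x ^+ 2 + 2 * g x ^+ 2)).
- by apply: measurable_funX; exact: measurable_funD.
- by apply: locally_integrable_add => //; exact: locally_integrableZ.
- move=> x; rewrite ger0_norm ?sqr_ge0//; have := sqr_ge0 (f x - g x); nra.
Qed.

Lemma sqintZ c f : sqint f -> sqint (fun x => c * f x).
Proof.
move=> [pf mf lf]; split; first by move=> x; rewrite pf.
  exact: measurable_funM.
under eq_fun do rewrite exprMn; exact: locally_integrableZ.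
Qed.

Lemma sqint_cper (u : cper R) : sqint u.
Proof.
split; first exact: cper_periodic.
  by apply: continuous_measurable_fun; exact: cper_continuous.
exact: (cper_locint (cmul u u)).
Qed.

Let normc_sq_locint u : cmeasurable u -> measurable_fun setT
  (fun x => complex.Re (u x) ^+ 2 + complex.Im (u x) ^+ 2).
Proof. by move=> [m1 m2]; apply: measurable_funD; exact: measurable_funX. Qed.

Let int_normc D u : (\int[mu]_(z in D) (Normc.normc (u z) ^+ 2)%:E =
  \int[mu]_(z in D) `|(complex.Re (u z) ^+ 2 + complex.Im (u z) ^+ 2)%:E|)%E.
Proof.
apply: eq_integral => z _; rewrite sqr_normc gee0_abs// lee_fin.
by rewrite addr_ge0 ?sqr_ge0.
Qed.

Lemma L2_perE u : L2_per u <->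
  sqint (fun z => complex.Re (u z)) /\ sqint (fun z => complex.Im (u z)).
Proof.
split=> [[pu mu_ iu]|[[p1 m1 l1] [p2 m2 l2]]].
  have m := normc_sq_locint mu_; have [m1 m2] := mu_.
  have l : locally_integrable setT
      (fun x => complex.Re (u x) ^+ 2 + complex.Im (u x) ^+ 2).
    apply: (locally_integrable_periodic (tau_gt0 R)) => //.
    - by move=> x; rewrite addr_ge0 ?sqr_ge0.
    - by move=> x; rewrite pu.
    - move: iu; rewrite int_normc; under eq_integral do
        rewrite gee0_abs ?lee_fin ?addr_ge0 ?sqr_ge0//.
      by [].
  split; split=> //; try (by move=> x; rewrite pu);
    apply: locally_integrable_dominated l _; try exact: measurable_funX.
    by move=> x; rewrite ger0_norm ?sqr_ge0// lerDl sqr_ge0.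
  by move=> x; rewrite ger0_norm ?sqr_ge0// lerDr sqr_ge0.
split => //.
  by move=> z; have := p1 z; have := p2 z; case: (u z) (u (z + _)) => [a b] [c d] /= -> ->.
have [_ _ H] := locally_integrable_add l1 l2.
by rewrite int_normc; exact: (H _ (@subsetT _ _) (@segment_compact R 0 tau)).
Qed.

Lemma L2_loc_of_sqint u : sqint (fun z => complex.Re (u z)) ->
  sqint (fun z => complex.Im (u z)) -> L2_loc u.
Proof.
move=> [p1 m1 l1] [p2 m2 l2]; split => // K cK.
have [_ _ H] := locally_integrable_add l1 l2.
by rewrite int_normc; exact: (H _ (@subsetT _ _) cK).
Qed.

Definition sqint0 f := sqint f /\ oint 0 tau f = 0.

Lemma L2_0E u : L2_0 u <->
  sqint0 (fun z => complex.Re (u z)) /\ sqint0 (fun z => complex.Im (u z)).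
Proof.
rewrite /L2_0 L2_perE /cintegral -!oint_le ?(ltW (tau_gt0 R))//.
split=> [[[s1 s2] /eqP]|[[s1 i1] [s2 i2]]]; last by rewrite i1 i2.
by rewrite eq_complex /= => /andP[/eqP i1 /eqP i2].
Qed.

Lemma L2normE u : L2norm u =
  Num.sqrt (oint 0 tau (fun z => complex.Re (u z) ^+ 2 + complex.Im (u z) ^+ 2)).
Proof.
rewrite /L2norm oint_le ?(ltW (tau_gt0 R))//; congr Num.sqrt.
by apply: eq_Rintegral => z _; rewrite sqr_normc.
Qed.

Lemma ae_equalE u v : ae_equal u v <->
  {ae mu, forall z, complex.Re (u z) = complex.Re (v z)} /\
  {ae mu, forall z, complex.Im (u z) = complex.Im (v z)}.
Proof.
split=> [H|[H1 H2]].
  by split; apply: filterS H; try exact: (ae_filter_ringOfSetsType mu); move=> z ->.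
apply: filterS2 H1 H2; first exact: (ae_filter_ringOfSetsType mu).
by move=> z; case: (u z) (v z) => [a b] [c d] /= -> ->.
Qed.

Lemma oint_ae a b f g : locally_integrable setT f -> locally_integrable setT g ->
  {ae mu, forall z, f z = g z} -> oint a b f = oint a b g.
Proof.
move=> [mf _ _] [mg _ _] fg.
have E D : measurable D -> \int[mu]_(z in D) f z = \int[mu]_(z in D) g z.
  move=> mD; congr fine; apply: ae_eq_integral => //.
  - by apply/measurable_EFinP; exact: measurable_funTS.
  - by apply/measurable_EFinP; exact: measurable_funTS.
  - apply: filterS fg; first exact: (ae_filter_ringOfSetsType mu).
    by move=> z /= -> _.
by rewrite /oint !E.
Qed.

(** The primitives coincide, and each function is the derivative of its primitive. *)
Lemma ae_eq_continuous f g : continuous f -> continuous g ->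
  {ae mu, forall z, f z = g z} -> forall z, f z = g z.
Proof.
move=> cf cg fg z.
have E x : prim f x = prim g x.
  by apply: oint_ae => //; exact: continuous_locally_integrable.
have D1 := is_derive_prim z cf; have D2 := is_derive_prim z cg.
have -> : f z = 'D_1 (prim f) z by case: D1.
by rewrite (_ : prim f = prim g); [case: D2|apply/funext].
Qed.

Lemma weak_derivE n u v : weak_deriv n u v <->
  weak_derivative n (fun z => complex.Re (u z)) (fun z => complex.Re (v z)) /\
  weak_derivative n (fun z => complex.Im (u z)) (fun z => complex.Im (v z)).
Proof.
have reM (c : R) (y : R[i]) : complex.Re (c%:C * y) = c * complex.Re y.
  by case: y => a b /=; rewrite mul0r subr0.
have imM (c : R) (y : R[i]) : complex.Im (c%:C * y) = c * complex.Im y.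
  by case: y => a b /=; rewrite mul0r addr0.
have sgn : ((-1) ^+ n : R[i]) = ((-1) ^+ n)%:C by rewrite rmorphXn rmorphN1.
have cM (phi : R -> R) w : cintegral setT (fun z => (phi z)%:C * w z) =
    (\int[mu]_z (phi z * complex.Re (w z))) +i* (\int[mu]_z (phi z * complex.Im (w z))).
  by congr (_ +i* _); apply: eq_Rintegral => z _; rewrite ?reM ?imM.
split=> [[[lu1 lu2] [lv1 lv2] H]|[[lu1 lv1 H1] [lu2 lv2 H2]]]; last first.
  split => // phi tphi; rewrite !cM (H1 _ tphi) (H2 _ tphi) sgn; apply/eqP.
  by rewrite eq_complex reM imM !eqxx.
by split; split => // phi tphi; have /eqP := H _ tphi;
  rewrite !cM sgn eq_complex reM imM => /andP[/eqP e1 /eqP e2].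
Qed.

End SquareIntegrable.

(** * The graph of the operator and the resolvent equation, in real components *)

Section RealComponents.
Context {R : realType}.
Notation mu := (@lebesgue_measure R).
Local Notation tau := (pi *+ 2 : R).
Local Notation V := (cper R).
Implicit Types (f g u v w q : R -> R) (a b c z : R).

(* [Fper f] is the mean-free primitive of [f]; it is meaningful when [prim f] is
   periodic, i.e. when [f] is periodic with zero mean. *)
Definition Fper f : V := center (insubd 0 (prim f)).

Lemma prim_lin a f g z : locally_integrable setT f -> locally_integrable setT g ->
  prim (fun z => a * f z + g z) z = a * prim f z + prim g z.
Proof.
by move=> lf lg; rewrite /prim ointD ?ointZ//; exact: locally_integrableZ.
Qed.

Lemma Fper_unique f (G : V) c : (forall z, prim f z = G z + c) ->
  Fper f = center G.
Proof.
move=> H; have E : prim f = cper_val (G + ccst c) by apply/funext => z; rewrite H.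
rewrite /Fper; have -> : insubd 0 (prim f) = G + ccst c.
  by rewrite E; exact: (valKd (0 : V)).
by rewrite linearD /= center_cst addr0.
Qed.

Lemma Fper_prim f : sqint0 f -> exists c, forall z, Fper f z = prim f z + c.
Proof.
move=> [sf f0]; have lf := sqint_locint sf; have [pf _ _] := sf.
have pp : periodic (prim f) tau.
  by move=> z; apply/eqP; rewrite -subr_eq0 -oint_prim// oint_periodic// f0.
pose G : V := mkcper (locally_integrable_prim_continuous lf) pp.
rewrite (@Fper_unique f G 0); last by move=> z; rewrite addr0.
by exists (- mean G) => z; rewrite /center cperB ccstE.
Qed.

Lemma itau_Fper f : itau (Fper f) = 0.
Proof. exact: itau_center. Qed.

Lemma Fper_lin a f g : sqint0 f -> sqint0 g ->
  Fper (fun z => a * f z + g z) = a *: Fper f + Fper g.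
Proof.
move=> sf sg; have [c Hc] := Fper_prim sf; have [d Hd] := Fper_prim sg.
rewrite -[RHS]center_id; last by rewrite linearD linearZ /= !itau_Fper mulr0 addr0.
apply: (@Fper_unique _ _ (- (a * c) - d)) => z.
rewrite (prim_lin _ _ (sqint_locint sf.1) (sqint_locint sg.1)).
by rewrite cperD cperZ Hc Hd; ring.
Qed.

Lemma sqint0_lin a f g : sqint0 f -> sqint0 g -> sqint0 (fun z => a * f z + g z).
Proof.
move=> [sf f0] [sg g0]; split; first by apply: sqintD => //; exact: sqintZ.
have lf := sqint_locint sf; have lg := sqint_locint sg.
by rewrite ointD ?ointZ ?f0 ?g0 ?mulr0 ?addr0//; exact: locally_integrableZ.
Qed.

Lemma Fper_ae f g : locally_integrable setT f -> locally_integrable setT g ->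
  {ae mu, forall z, f z = g z} -> Fper f = Fper g.
Proof.
move=> lf lg fg; rewrite /Fper; congr (center (insubd 0 _)).
by apply/funext => z; exact: oint_ae.
Qed.

Lemma Fper_Kop f (u : V) : locally_integrable setT f -> itau u = 0 ->
  {ae mu, forall z, f z = u z} -> Fper f = Kop u.
Proof.
move=> lf u0 fu; rewrite (Fper_ae lf (cper_locint u) fu).
have D z := Kop_derive u z; rewrite (center_id u0) in D.
rewrite -[RHS]center_id ?itau_Kop//; apply: (@Fper_unique _ _ (- Kop u 0)) => z.
by rewrite (prim_derive z (@cper_continuous _ u) D).
Qed.

Lemma weak_derivative_C1 (F f : R -> R) : continuous f ->
  (forall z, is_derive z 1 F (f z)) -> weak_derivative 1 F f.
Proof.
move=> cf dF; have -> : F = fun z => F 0 + prim f z.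
  by apply/funext => z; rewrite (prim_derive z cf dF) addrC subrK.
exact/weak_derivative_cst_prim/continuous_locally_integrable.
Qed.

(** Bootstrap step: a continuous representative of the weak derivative gives a C^1 representative of
    the function. *)
Lemma weak_derivative_regular u v (v' : R -> R) : weak_derivative 1 u v ->
  continuous v' -> {ae mu, forall z, v z = v' z} -> exists2 u' : R -> R,
  {ae mu, forall z, u z = u' z} & forall z, is_derive z 1 u' (v' z).
Proof.
move=> H cv' vv'; have [_ lv _] := H; have [c uc] := weak_derivative_prim H.
exists (fun z => c + prim v' z).
  apply: filterS uc; first exact: (ae_filter_ringOfSetsType mu).
  by move=> z ->; rewrite /prim (oint_ae _ _ lv (continuous_locally_integrable cv') vv').
move=> z; rewrite -[v' z]add0r; have D := is_derive_prim z cv'.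
exact: is_deriveD.
Qed.

Lemma is_derive_periodic (F f : R -> R) T : (forall z, is_derive z 1 F (f z)) ->
  periodic F T -> periodic f T.
Proof.
move=> dF pF; rewrite -(derive1_is_derive dF); exact: derive1_periodic.
Qed.

Context (p : R -> R) (k x : R) (pc : V).
Hypothesis wave : periodic_wave p k.
Hypothesis pcE : cper_val pc = p.
Let bc := wave_coef k pc.

(** Here r = u'. The regularity climbs from [u3] down to a C^2 representative of [u]; integrating
    the equation once shows that the primitive of [g] is u'' + b u + x Kop^2 u up to a constant, and
    [Kop] of this is the claim. *)
Lemma real_resolvent_of_graph u v1 v2 u3 q w g : sqint0 u ->
  weak_derivative 1 u v1 -> weak_derivative 2 u v2 -> weak_derivative 3 u u3 ->
  weak_derivative 1 (fun z => (1 + p z) * u z) q ->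
  sqint0 w -> weak_derivative 1 w u -> sqint0 g ->
  {ae mu, forall z, g z = u3 z + (k ^+ 2)^-1 * q z + x * w z} ->
  exists r : V, [/\ {ae mu, forall z, u z = Kop r z}, itau r = 0,
    Fper u = Kop (Kop r) &
    r = Kop (Fper g - cmul bc (Kop r) - x *: Kop (Kop (Kop r)))].
Proof.
move=> su H1 H2 H3 Hq sw Hw sg gE.
have H12 : weak_derivative 1 v1 v2 := weak_derivative_shift H1 H2.
have H23 : weak_derivative 1 v2 u3.
  by apply: weak_derivative_shift H12 _; exact: weak_derivative_shift H1 H3.
have [_ lu3 _] := H3; have [_ lq _] := Hq; have [lw lu _] := Hw.
have lg := sqint_locint sg.1.
have [c3 v2E] := weak_derivative_prim H23.
have cV2 : continuous (fun z => c3 + prim u3 z).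
  by move=> z; apply: cvgD; [exact: cvg_cst|exact: locally_integrable_prim_continuous].
have [V1 v1E dV1] := weak_derivative_regular H12 cV2 v2E.
have cV1 := is_derive_continuous dV1.
have [U uE dU] := weak_derivative_regular H1 cV1 v1E.
have cU := is_derive_continuous dU.
have lU := continuous_locally_integrable cU.
have primU : prim u = prim U by apply/funext => z; exact: oint_ae.
have [c0 Fu] := Fper_prim su.
(* Almost everywhere equality does not carry periodicity over to [U] pointwise; it is recovered
   since [U] is the derivative of this periodic primitive. *)
have pprim : periodic (prim u) tau.
  by move=> z; have := cper_periodic (Fper u) z; rewrite !Fu => /addIr.
have pU : periodic U tau.
  apply: is_derive_periodic pprim; rewrite primU => z; exact: is_derive_prim.
have pV1 := is_derive_periodic dU pU; have pV2 := is_derive_periodic dV1 pV1.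
have [Uc UcE] : exists Uc : V, cper_val Uc = U by exists (mkcper cU pU).
have [r rE] : exists r : V, cper_val r = V1 by exists (mkcper cV1 pV1).
have [Vc VcE] : exists Vc : V, cper_val Vc = fun z => c3 + prim u3 z.
  by exists (mkcper cV2 pV2).
have dUc z : is_derive z (1 : R) Uc (r z) by rewrite UcE rE.
have dr z : is_derive z (1 : R) r (Vc z) by rewrite rE VcE.
have uUc : {ae mu, forall z, u z = Uc z} by rewrite UcE.
have U0 : itau Uc = 0.
  by rewrite itauE -(oint_ae _ _ lu (cper_locint Uc) uUc) su.2.
have KrU : Kop r = Uc by rewrite (Kop_unique dUc) center_id.
have r0 : itau r = 0 := itau_derive dUc.
have KVr : Kop Vc = r by rewrite (Kop_unique dr) center_id.
(* [w] and [Kop Uc] have the same derivative, and the constant between them is 0 because both have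
   mean zero. *)
have wE : {ae mu, forall z, w z = Kop Uc z}.
  have [W wW dW] := weak_derivative_regular Hw (@cper_continuous _ Uc) uUc.
  have dK z := Kop_derive Uc z; rewrite (center_id U0) in dK.
  have WE z : W z = (Kop Uc + ccst (W 0 - Kop Uc 0)) z.
    rewrite cperD ccstE.
    have := prim_derive z (@cper_continuous _ Uc) dW.
    by rewrite (prim_derive z (@cper_continuous _ Uc) dK); lra.
  have wW' : {ae mu, forall z, w z = (Kop Uc + ccst (W 0 - Kop Uc 0)) z}.
    apply: filterS wW; first exact: (ae_filter_ringOfSetsType mu).
    by move=> z ->; exact: WE.
  have := oint_ae 0 tau lw (cper_locint _) wW'.
  rewrite sw.2 -itauE linearD /= itau_Kop itau_cst add0r => /esym/eqP.
  rewrite mulf_eq0 (negbTE (tau_neq0 R)) orbF => /eqP c0'.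
  apply: filterS wW'; first exact: (ae_filter_ringOfSetsType mu).
  by move=> z ->; rewrite cperD ccstE c0' addr0.
have [c5 qE] := weak_derivative_prim Hq.
have qE' z : (1 + p z) * U z = c5 + prim q z.
  apply: (@ae_eq_continuous _ (fun z => (1 + p z) * U z)
    (fun z => c5 + prim q z)) => {z}.
  - move=> z; apply: cvgM; last exact: cU.
    by rewrite -pcE; apply: cvgD; [exact: cvg_cst|exact: cper_continuous].
  - by move=> z; apply: cvgD; [exact: cvg_cst|exact: locally_integrable_prim_continuous].
  - apply: filterS2 uE qE; first exact: (ae_filter_ringOfSetsType mu).
    by move=> z <-.
have [c6 Fw] := Fper_prim sw.
have FwE : Fper w = Kop (Kop Uc) by apply: Fper_Kop => //; exact: itau_Kop.
have primg z : prim g z = prim u3 z + (k ^+ 2)^-1 * prim q z + x * prim w z.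
  have l1 := locally_integrableZ (k ^+ 2)^-1 lq; have l2 := locally_integrableZ x lw.
  rewrite /prim (oint_ae _ _ lg (locally_integrable_add (locally_integrable_add lu3 l1) l2) gE).
  by rewrite (ointD _ _ (locally_integrable_add lu3 l1) l2) (ointD _ _ lu3 l1) !ointZ.
have Fg : Fper g = center (Vc + cmul bc Uc + x *: Kop (Kop Uc)).
  apply: (@Fper_unique _ _ (- c3 - (k ^+ 2)^-1 * c5 - x * c6)) => z.
  rewrite !cperD cperZ cmulE -FwE Fw VcE primg /bc /wave_coef cperZ cperD ccstE.
  by rewrite UcE pcE; have := qE' z; move: (prim q z) => y Ey; rewrite -mulrA Ey; ring.
exists r; rewrite KrU; split => //.
  exact: Fper_Kop.
have KB (s t : V) : Kop (s - t) = Kop s - Kop t by rewrite linearB.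
have KD (s t : V) : Kop (s + t) = Kop s + Kop t by rewrite linearD.
rewrite (KB (Fper g - _)) (KB (Fper g)) Fg Kop_center (KD (_ + _)) (KD Vc) KVr.
by apply: cperP => z; rewrite !cperE; ring.
Qed.

(** The equation makes [r] continuously differentiable; the third derivative, merely square
    integrable like [g], is read off as u3 = g - q / k^2 - x Kop^2 r. *)
Lemma real_graph_of_resolvent (r : V) g : sqint0 g ->
  r = Kop (Fper g - cmul bc (Kop r) - x *: Kop (Kop (Kop r))) ->
  exists v2 u3 q, [/\ weak_derivative 1 (Kop r) r,
    weak_derivative 2 (Kop r) v2, weak_derivative 3 (Kop r) u3,
    weak_derivative 1 (fun z => (1 + p z) * Kop r z) q &
    [/\ sqint v2, sqint u3, weak_derivative 1 (Kop (Kop r)) (Kop r) &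
    forall z, g z = u3 z + (k ^+ 2)^-1 * q z + x * Kop (Kop r) z]].
Proof.
move=> sg rV.
set Vc := Fper g - _ - _ in rV.
have [rho [_ drho _]] := wave_derivative wave pcE.
have r0 : itau r = 0 by rewrite rV itau_Kop.
have dU z := Kop_derive r z; rewrite (center_id r0) in dU.
have dW z := Kop_derive (Kop r) z; rewrite (center_id (itau_Kop r)) in dW.
have dr z : is_derive z (1 : R) r (center Vc z).
  by have := Kop_derive Vc z; rewrite -rV.
pose q : V := cmul rho (Kop r) + cmul (ccst 1 + pc) r.
have dq z : is_derive z (1 : R) (cmul (ccst 1 + pc) (Kop r)) (q z).
  have D1 : is_derive z (1 : R) (ccst 1 + pc) (rho z).
    by rewrite -[rho z]add0r; apply: is_deriveD; exact: is_derive_cst.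
  apply: is_derive_eq (is_deriveM D1 (dU z)) _.
  by rewrite /q !cperD !cmulE !cperD /GRing.scale/=; ring.
have [c1 Fg] := Fper_prim sg.
have lg := sqint_locint sg.1.
pose u3 z := g z + (- (k ^+ 2)^-1) * q z + (- x) * Kop (Kop r) z.
have su3 : sqint u3.
  by apply: sqintD; [apply: sqintD => //; [exact: sg.1|]|]; apply: sqintZ;
    exact: sqint_cper.
have w3 : weak_derivative 1 (center Vc) u3.
  have cq := @cper_continuous _ q; have cW := @cper_continuous _ (Kop (Kop r)).
  have lq := continuous_locally_integrable cq.
  have lW := continuous_locally_integrable cW.
  have dKW z := Kop_derive (Kop (Kop r)) z.
  rewrite (center_id (itau_Kop (Kop r))) in dKW.
  have pu z : prim u3 z = prim g z + (- (k ^+ 2)^-1) * prim q z +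
      (- x) * prim (Kop (Kop r)) z.
    rewrite /prim.
    rewrite (ointD _ _ (locally_integrable_add lg (locally_integrableZ _ lq))
      (locally_integrableZ _ lW)) (ointD _ _ lg (locally_integrableZ _ lq)).
    by rewrite (ointZ _ _ _ lq) (ointZ _ _ _ lW).
  have -> : cper_val (center Vc) = fun z => center Vc 0 + prim u3 z.
    apply/funext => z; rewrite pu.
    rewrite (prim_derive z cq dq) (prim_derive z cW dKW).
    have cE t : center Vc t = Vc t - mean Vc by [].
    have VE t : Vc t = Fper g t - bc t * Kop r t - x * Kop (Kop (Kop r)) t by [].
    rewrite !cE !VE !Fg !cmulE !cperD !ccstE prim0.
    by rewrite /bc /wave_coef !cperZ !cperD !ccstE; ring.
  exact/weak_derivative_cst_prim/sqint_locint.
have w1 : weak_derivative 1 (Kop r) r by apply: weak_derivative_C1 => //; exact: cper_continuous.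
have w2 : weak_derivative 1 r (center Vc).
  by apply: weak_derivative_C1 => //; exact: cper_continuous.
exists (center Vc), u3, q; split => //.
- exact: weak_derivative_trans w1 w2.
- exact: weak_derivative_trans w1 (weak_derivative_trans w2 w3).
- have -> : (fun z => (1 + p z) * Kop r z) = cmul (ccst 1 + pc) (Kop r).
    by apply/funext => z; rewrite cmulE cperD ccstE pcE.
  by apply: weak_derivative_C1 => //; exact: cper_continuous.
- split => //.
  + exact: sqint_cper.
  + by apply: weak_derivative_C1 => //; exact: cper_continuous.
  + by move=> z; rewrite /u3; ring.
Qed.

End RealComponents.

(** * Complex functions as pairs of real ones *)

Section ComplexOperator.
Context {R : realType}.
Notation mu := (@lebesgue_measure R).
Local Notation tau := (pi *+ 2 : R).
Local Notation V := (cper R).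
Local Notation VV := (cper R * cper R)%type.
Implicit Types (f g h : R -> R) (u v w : R -> R[i]) (r s F : VV) (al be a b c z : R).

Local Notation re u := (fun z => complex.Re (u z)).
Local Notation im u := (fun z => complex.Im (u z)).

Lemma complex_ReM (c d : R[i]) : complex.Re (c * d) =
  complex.Re c * complex.Re d - complex.Im c * complex.Im d.
Proof. by case: c d => [a b] [c d]. Qed.

Lemma complex_ImM (c d : R[i]) : complex.Im (c * d) =
  complex.Re c * complex.Im d + complex.Im c * complex.Re d.
Proof. by case: c d => [a b] [c d]. Qed.

Lemma complex_ReB (c d : R[i]) : complex.Re (c - d) = complex.Re c - complex.Re d.
Proof. by case: c d => [a b] [c d]. Qed.

Lemma complex_ImB (c d : R[i]) : complex.Im (c - d) = complex.Im c - complex.Im d.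
Proof. by case: c d => [a b] [c d]. Qed.

Lemma complex_ReD (c d : R[i]) : complex.Re (c + d) = complex.Re c + complex.Re d.
Proof. by case: c d => [a b] [c d]. Qed.

Lemma complex_ImD (c d : R[i]) : complex.Im (c + d) = complex.Im c + complex.Im d.
Proof. by case: c d => [a b] [c d]. Qed.

Definition Fper2 u : VV := (Fper (re u), Fper (im u)).

Definition Kop2 r z : R[i] := Kop r.1 z +i* Kop r.2 z.

Lemma sqint0_lin3 a b f g h : sqint0 f -> sqint0 g -> sqint0 h ->
  sqint0 (fun z => a * f z + b * g z - h z).
Proof.
(* [- h] is written as -2 h + h to fit the shape of [sqint0_lin]. *)
move=> sf sg sh; have := sqint0_lin a sf (sqint0_lin b sg (sqint0_lin (-2) sh sh)).
by congr sqint0; apply/funext => z; ring.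
Qed.

Lemma Fper_lin3 a b f g h : sqint0 f -> sqint0 g -> sqint0 h ->
  Fper (fun z => a * f z + b * g z - h z) = a *: Fper f + b *: Fper g - Fper h.
Proof.
move=> sf sg sh; have s1 := sqint0_lin (-2) sh sh; have s2 := sqint0_lin b sg s1.
have -> : (fun z => a * f z + b * g z - h z) =
    fun z => a * f z + (b * g z + (-2 * h z + h z)) by apply/funext => z; ring.
rewrite (Fper_lin a sf s2) (Fper_lin b sg s1) (Fper_lin _ sh sh).
by move: (Fper f) (Fper g) (Fper h) => A B C; apply: cperP => z; rewrite !cperE; ring.
Qed.

Lemma sqint0_Kop (r : V) : sqint0 (Kop r).
Proof. by split; [exact: sqint_cper|rewrite -itauE itau_Kop]. Qed.

Lemma L2norm_Kop2 u r : L2_0 u -> ae_equal u (Kop2 r) -> L2norm u <= nrm2 r.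
Proof.
move=> /L2_0E[[[_ m1 l1] _] [[_ m2 l2] _]] /ae_equalE[E1 E2].
pose G : V := cmul (Kop r.1) (Kop r.1) + cmul (Kop r.2) (Kop r.2).
have I : oint 0 tau (fun z => complex.Re (u z) ^+ 2 + complex.Im (u z) ^+ 2) = itau G.
  rewrite itauE; apply: oint_ae; [exact: locally_integrable_add|exact: cper_locint|].
  apply: filterS2 E1 E2; first exact: (ae_filter_ringOfSetsType mu).
  by move=> z -> ->; rewrite /G cperD !cmulE !expr2.
have GE : itau G = nrm (Kop r.1) ^+ 2 + nrm (Kop r.2) ^+ 2.
  by rewrite linearD /= !nrm_sqr.
have n1 := nrm_Kop r.1; have n2 := nrm_Kop r.2.
have h1 := nrm_ge0 (Kop r.1); have h2 := nrm_ge0 (Kop r.2).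
rewrite L2normE I GE; apply: le_trans (_ : nrm (Kop r.1) + nrm (Kop r.2) <= _); last exact: lerD.
rewrite -[leRHS]ger0_norm ?addr_ge0// -sqrtr_sqr ler_sqrt ?sqr_ge0//.
by rewrite sqrrD lerD2r lerDl mulrn_wge0// mulr_ge0.
Qed.

(** Young's inequality |f| <= c / 2 + f^2 / (2 c) with c = N + d, integrated over a period; the
    slack [d] allows N = 0 and is removed at the end. *)
Let norm_bound f (N : R) : sqint f -> 0 <= N ->
  oint 0 tau (fun z => f z ^+ 2) <= N ^+ 2 ->
  oint 0 tau (fun z => `|f z|) <= (tau + 1) / 2 * N.
Proof.
move=> sf N0 fN; have lf := sqint_locint sf; have [_ _ lf2] := sf.
have tau0 := tau_gt0 R.
apply/ler_addgt0Pr => e e0; pose d := 2 / (tau + 1) * e.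
have d0 : 0 < d by rewrite mulr_gt0// divr_gt0//; lra.
have Nd : 0 < N + d by lra.
apply: (@le_trans _ _ (oint 0 tau (fun z => (N + d) / 2 + (2 * (N + d))^-1 * f z ^+ 2))).
  apply: ler_oint; [exact: locally_integrable_norm| |exact: ltW|].
    by apply: locally_integrable_add; [exact: locally_integrable_cst|exact: locally_integrableZ].
  move=> z _; rewrite -[f z ^+ 2]real_normK ?num_real//.
  move: (`|f z|) (N + d) Nd => y c c0; rewrite -subr_ge0.
  have -> : c / 2 + (2 * c)^-1 * y ^+ 2 - y = (2 * c)^-1 * (c - y) ^+ 2.
    by field; rewrite gt_eqF.
  by rewrite mulr_ge0 ?sqr_ge0// invr_ge0 mulr_ge0 ?ltW.
rewrite (ointD _ _ (locally_integrable_cst _) (locally_integrableZ _ lf2)).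
rewrite oint_cst (ointZ _ _ _ lf2) subr0.
have H : (2 * (N + d))^-1 * oint 0 tau (fun z => f z ^+ 2) <= (N + d) / 2.
  rewrite mulrC ler_pdivrMr ?mulr_gt0//; apply: le_trans fN _.
  have -> : (N + d) / 2 * (2 * (N + d)) = (N + d) ^+ 2 by field.
  by rewrite lerXn2r ?nnegrE//; lra.
have -> : (tau + 1) / 2 * N + e = (tau + 1) / 2 * (N + d).
  by rewrite /d; move: (pi *+ 2 : R) tau0 => t t0; field; apply: lt0r_neq0; lra.
by apply: le_trans (lerD (lexx _) H) _; lra.
Qed.

Let nrm_Fper f (N : R) : sqint0 f -> 0 <= N ->
  oint 0 tau (fun z => f z ^+ 2) <= N ^+ 2 ->
  nrm (Fper f) <= (tau + 1) / 2 * N * Num.sqrt tau.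
Proof.
move=> sf N0 fN; apply: nrm_le_sup => z; apply: le_trans (norm_bound sf.1 N0 fN).
have [c Fc] := Fper_prim sf; have [pf _ _] := sf.1.
apply: zero_mean_bound => //; first exact: sqint_locint sf.1.
  by move=> y x; rewrite !Fc (oint_prim _ _ (sqint_locint sf.1)); ring.
exact: itau_Fper.
Qed.

Lemma nrm2_Fper2 : exists C : R, forall u, L2_0 u -> nrm2 (Fper2 u) <= C * L2norm u.
Proof.
exists ((tau + 1) * Num.sqrt tau) => u /L2_0E[su1 su2].
have [[_ _ l1] _] := su1; have [[_ _ l2] _] := su2.
have N0 : 0 <= L2norm u by rewrite L2normE sqrtr_ge0.
have l0 : locally_integrable setT (fun _ : R => 0 : R) := locally_integrable_cst 0.
have t0 := ltW (tau_gt0 R).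
have p1 : 0 <= oint 0 tau (fun z => complex.Re (u z) ^+ 2).
  by rewrite oint_le// Rintegral_ge0// => z _; rewrite sqr_ge0.
have p2 : 0 <= oint 0 tau (fun z => complex.Im (u z) ^+ 2).
  by rewrite oint_le// Rintegral_ge0// => z _; rewrite sqr_ge0.
have N2 : L2norm u ^+ 2 = oint 0 tau (fun z => complex.Re (u z) ^+ 2) +
    oint 0 tau (fun z => complex.Im (u z) ^+ 2).
  by rewrite L2normE ointD// sqr_sqrtr// addr_ge0.
have H1 : nrm (Fper (re u)) <= (tau + 1) / 2 * L2norm u * Num.sqrt tau.
  by apply: nrm_Fper => //; rewrite N2 lerDl.
have H2 : nrm (Fper (im u)) <= (tau + 1) / 2 * L2norm u * Num.sqrt tau.
  by apply: nrm_Fper => //; rewrite N2 lerDr.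
apply: le_trans (lerD H1 H2) _.
by rewrite le_eqVlt; apply/orP; left; apply/eqP; field.
Qed.

Context (p : R -> R) (k l : R) (pc : V).
Hypothesis wave : periodic_wave p k.
Hypothesis pcE : cper_val pc = p.
Let bc := wave_coef k pc.

(** [r] is the derivative of [u], so a single [r] serves every [lam]. *)
Lemma resolvent_of_graph u (g : R -> R[i]) : KP_operator p k l u g -> exists r,
  [/\ ae_equal u (Kop2 r), itau r.1 = 0, itau r.2 = 0 & forall al be,
  resolvent_eq bc (l ^+ 2) al be r (Fper2 (fun z => (al +i* be) * u z - g z))].
Proof.
move=> [[pu [_ Hu]] /L2_0E[su1 su2] /L2_0E[sg1 sg2] [u3 [q [w [H3 Hq]]]]].
move=> [_ _ /L2_0E[sw1 sw2] Hw] /ae_equalE[gE1 gE2].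
have [v1 _ /weak_derivE[H11 H12]] := Hu 1%N isT.
have [v2 _ /weak_derivE[H21 H22]] := Hu 2%N isT.
move: H3 Hw => /weak_derivE[H31 H32] /weak_derivE[Hw1 Hw2].
have {Hq} [Hq1 Hq2] : weak_derivative 1 (fun z => (1 + p z) * complex.Re (u z)) (re q)
    /\ weak_derivative 1 (fun z => (1 + p z) * complex.Im (u z)) (im q).
  move/weak_derivE : Hq => [Hq1 Hq2]; split.
    by move: Hq1; congr weak_derivative; apply/funext => z;
      rewrite complex_ReM /= mul0r subr0.
  by move: Hq2; congr weak_derivative; apply/funext => z;
    rewrite complex_ImM /= mul0r addr0.
have E1 : {ae mu, forall z, complex.Re (g z) = complex.Re (u3 z) +
    (k ^+ 2)^-1 * complex.Re (q z) + l ^+ 2 * complex.Re (w z)}.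
  apply: filterS gE1; first exact: (ae_filter_ringOfSetsType mu).
  by move=> z ->; rewrite !complex_ReD !complex_ReM /= !mul0r !subr0.
have E2 : {ae mu, forall z, complex.Im (g z) = complex.Im (u3 z) +
    (k ^+ 2)^-1 * complex.Im (q z) + l ^+ 2 * complex.Im (w z)}.
  apply: filterS gE2; first exact: (ae_filter_ringOfSetsType mu).
  by move=> z ->; rewrite !complex_ImD !complex_ImM /= !mul0r !addr0.
have [r1 [ur1 r10 Fu1 R1]] :=
  real_resolvent_of_graph pcE su1 H11 H21 H31 Hq1 sw1 Hw1 sg1 E1.
have [r2 [ur2 r20 Fu2 R2]] :=
  real_resolvent_of_graph pcE su2 H12 H22 H32 Hq2 sw2 Hw2 sg2 E2.
exists (r1, r2); split => //; first exact/ae_equalE.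
move=> al be; have S1 : re (fun z => (al +i* be) * u z - g z) =
    fun z => al * complex.Re (u z) + (- be) * complex.Im (u z) - complex.Re (g z).
  by apply/funext => z; rewrite complex_ReB complex_ReM /= mulNr.
have S2 : im (fun z => (al +i* be) * u z - g z) =
    fun z => al * complex.Im (u z) + be * complex.Re (u z) - complex.Im (g z).
  by apply/funext => z; rewrite complex_ImB complex_ImM /=.
rewrite /resolvent_eq /Fper2 S1 S2 (Fper_lin3 _ _ su1 su2 sg1) (Fper_lin3 _ _ su2 su1 sg2).
rewrite Fu1 Fu2 /=; split.
  rewrite {1}R1; congr Kop; apply: cperP => z; rewrite /Bop !cperE; ring.
rewrite {1}R2; congr Kop; apply: cperP => z; rewrite /Bop !cperE; ring.
Qed.

Lemma graph_of_resolvent r (f : R -> R[i]) al be : L2_0 f ->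
  resolvent_eq bc (l ^+ 2) al be r (Fper2 f) ->
  KP_operator p k l (Kop2 r) (fun z => (al +i* be) * Kop2 r z - f z).
Proof.
move=> /L2_0E[sf1 sf2] [/= R1 R2].
pose g1 z := al * Kop r.1 z + (- be) * Kop r.2 z - complex.Re (f z).
pose g2 z := al * Kop r.2 z + be * Kop r.1 z - complex.Im (f z).
have gE : (fun z => (al +i* be) * Kop2 r z - f z) = fun z => g1 z +i* g2 z.
  apply/funext => z; apply/eqP; rewrite eq_complex complex_ReB complex_ImB complex_ReM
    complex_ImM /= /g1 /g2 mulNr; apply/andP; split; apply/eqP; ring.
have sg1 : sqint0 g1 by apply: sqint0_lin3 => //; exact: sqint0_Kop.
have sg2 : sqint0 g2 by apply: sqint0_lin3 => //; exact: sqint0_Kop.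
have FK (t : V) : Fper (Kop t) = Kop (Kop t).
  by apply: Fper_Kop; [exact: cper_locint|exact: itau_Kop|exact: aeW].
have K1 := @real_graph_of_resolvent R p k (l ^+ 2) pc wave pcE r.1 g1 sg1.
have K2 := @real_graph_of_resolvent R p k (l ^+ 2) pc wave pcE r.2 g2 sg2.
have [|v2 [u3 [q [W1 W2 W3 Wq [sv2 su3 Ww Eg]]]]] := K1.
  rewrite {1}R1; congr Kop; rewrite (Fper_lin3 _ _ (sqint0_Kop _) (sqint0_Kop _) sf1) !FK.
  by apply: cperP => z; rewrite /Bop !cperE; ring.
have [|v2' [u3' [q' [W1' W2' W3' Wq' [sv2' su3' Ww' Eg']]]]] := K2.
  rewrite {1}R2; congr Kop; rewrite (Fper_lin3 _ _ (sqint0_Kop _) (sqint0_Kop _) sf2) !FK.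
  by apply: cperP => z; rewrite /Bop !cperE; ring.
rewrite gE.
have pK (t t' : V) : periodic (fun z => t z +i* t' z) tau.
  by move=> z; rewrite !cper_periodic.
have hu : L2_0 (Kop2 r) by apply/L2_0E; split; exact: sqint0_Kop.
have L2l (a b : R -> R) : sqint a -> sqint b -> L2_loc (fun z => a z +i* b z).
  by move=> sa sb; exact: L2_loc_of_sqint.
split => //.
- split; [exact: pK|split; first by apply: L2l; exact: sqint_cper].
  case=> [|[|[|[|j]]]]// _.
  + exists (fun z => r.1 z +i* r.2 z); first by apply: L2l; exact: sqint_cper.
    exact/weak_derivE.
  + by exists (fun z => v2 z +i* v2' z); [exact: L2l|exact/weak_derivE].
  + by exists (fun z => u3 z +i* u3' z); [exact: L2l|exact/weak_derivE].
- exact/L2_0E.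
- exists (fun z => u3 z +i* u3' z), (fun z => q z +i* q' z),
    (fun z => Kop (Kop r.1) z +i* Kop (Kop r.2) z); split.
  + exact/weak_derivE.
  + apply/weak_derivE; split.
      move: Wq; congr weak_derivative; apply/funext => z.
      by rewrite complex_ReM /= mul0r subr0.
    move: Wq'; congr weak_derivative; apply/funext => z.
    by rewrite complex_ImM /= mul0r addr0.
  + split => //.
    * split; [exact: pK|split; first by apply: L2l; exact: sqint_cper].
      case=> [|[|j]]// _; exists (Kop2 r); first by apply: L2l; exact: sqint_cper.
      exact/weak_derivE.
    * by apply/L2_0E; split; exact: sqint0_Kop.
    * exact/weak_derivE.
  + apply: aeW => z; rewrite Eg Eg'; apply/eqP.
    by rewrite eq_complex !complex_ReD !complex_ImD !complex_ReM !complex_ImM /=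
      !mul0r !subr0 !addr0 !eqxx.
Qed.

End ComplexOperator.

(** * The spectrum and the simplicity of eigenvalues *)

Section Spectrum.
Context {R : realType}.
Notation mu := (@lebesgue_measure R).
Local Notation tau := (pi *+ 2 : R).
Local Notation V := (cper R).
Local Notation VV := (cper R * cper R)%type.
Implicit Types (u v g f : R -> R[i]) (r s F : VV) (q : V) (al be a b c z : R).

Lemma Fper2_ae0 f : L2_0 f -> ae_equal f (fun=> 0) -> Fper2 f = 0.
Proof.
move=> /L2_0E[s1 s2] /ae_equalE[e1 e2].
have H h : sqint0 h -> {ae mu, forall z, h z = 0} -> Fper h = 0.
  move=> sh h0; have -> : Fper h = Kop (0 : V).
    by apply: Fper_Kop => //; [exact: sqint_locint sh.1|rewrite linear0].
  exact: linear0.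
by rewrite /Fper2 (H _ s1 e1) (H _ s2 e2).
Qed.

Lemma L2_0_sub al be u g : L2_0 u -> L2_0 g ->
  L2_0 (fun z => (al +i* be) * u z - g z).
Proof.
move=> /L2_0E[u1 u2] /L2_0E[g1 g2]; apply/L2_0E; split.
  have := sqint0_lin3 al (- be) u1 u2 g1; congr sqint0; apply/funext => z.
  by rewrite complex_ReB complex_ReM /= mulNr.
have := sqint0_lin3 al be u2 u1 g2; congr sqint0; apply/funext => z.
by rewrite complex_ImB complex_ImM.
Qed.

Lemma L2_0_0 : L2_0 (fun=> 0 : R[i]).
Proof.
have s0 : sqint0 (fun=> 0 : R).
  by have := sqint0_Kop (0 : V); rewrite linear0.
exact/L2_0E.
Qed.

Lemma resolvent_eqB (b : V) x al be r s F : resolvent_eq b x al be r F ->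
  resolvent_eq b x al be s F -> resolvent_eq b x al be (r - s) 0.
Proof.
have K (c d e : V) : Kop (c - e) - Kop (d - e) = Kop (c - d - 0).
  by rewrite -linearB opprB addrA subrK subr0.
have BB : Bop2 b x al be (r - s) = Bop2 b x al be r - Bop2 b x al be s.
  by rewrite linearB.
move=> [r1 r2] [s1 s2]; rewrite /resolvent_eq BB; split.
  by rewrite -[LHS]/(r.1 - s.1) {1}r1 {1}s1; exact: K.
by rewrite -[LHS]/(r.2 - s.2) {1}r2 {1}s2; exact: K.
Qed.

Context (p : R -> R) (k l Mb : R) (pc : V).
Hypothesis wave : periodic_wave p k.
Hypothesis pcE : cper_val pc = p.
Let b := wave_coef k pc.
Hypothesis bM : forall z, `|b z| <= Mb.
Let x := l ^+ 2.
Let A := KP_operator p k l.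

Lemma in_resolvent_set_of_kernel al be :
  (forall r, kernel_eq b x al be r -> r = 0) -> in_resolvent_set A (al +i* be).
Proof.
move=> ker.
have U r : resolvent_eq b x al be r 0 -> r = 0.
  by move=> /kernel_resolvent; exact: ker.
have [M HM] := resolvent_exists bM U; split.
- move=> f f0; have [r rE _] := HM (Fper2 f).
  exists (Kop2 r), (fun z => (al +i* be) * Kop2 r z - f z); split.
    exact: (graph_of_resolvent wave pcE f0 rE).
  by apply: aeW => z; rewrite opprB addrC subrK.
- move=> u g Aug ug0; have [r [ur _ _ rE]] := resolvent_of_graph pcE Aug.
  have [_ u0 g0 _] := Aug; have := rE al be.
  rewrite (Fper2_ae0 (L2_0_sub al be u0 g0) ug0) => /U r0.
  move: ur; rewrite r0; have -> : Kop2 (0 : VV) = fun=> 0 => //.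
  by apply/funext => z; rewrite /Kop2 /= linear0.
- have [C HC] := @nrm2_Fper2 R.
  exists (`|M| * C) => u g Aug; have [r [ur _ _ rE]] := resolvent_of_graph pcE Aug.
  have [_ u0 g0 _] := Aug.
  (* The bound concerns some solution [s]; uniqueness identifies it with the [r] that represents
     [u]. *)
  have [s sE sM] := HM (Fper2 (fun z => (al +i* be) * u z - g z)).
  have rs : r = s.
    by apply/eqP; rewrite -subr_eq0; apply/eqP/U; exact: resolvent_eqB (rE al be) sE.
  apply: le_trans (L2norm_Kop2 u0 ur) _; rewrite rs; apply: le_trans sM _.
  apply: le_trans (_ : `|M| * nrm2 (Fper2 (fun z => (al +i* be) * u z - g z)) <= _).
    by rewrite ler_wpM2r ?nrm2_ge0// ler_norm.
  rewrite -mulrA ler_wpM2l//; apply: HC; exact: L2_0_sub.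
Qed.

Lemma spectrum_imaginary :
  (forall q, itau q = 0 -> form b 0 x q q = 0 ->
    forall q', itau q' = 0 -> form b 0 x q q' = 0) ->
  spectrum A `<=` imaginary_axis.
Proof.
move=> pos [al be] /= nres; apply/eqP/negPn/negP => al0; apply: nres.
by apply: in_resolvent_set_of_kernel => r; exact: kernel_nonneg.
Qed.

Hypothesis index1 : forall q, itau q = 0 -> dot q (sinn 1) = 0 ->
  form b 0 x q q <= 0 -> q = 0.

(** Induction on the order: if (A - lam) v = c u, the real and imaginary parts of [c] each yield a
    real Jordan chain. So c = 0, both parts of [v] are real eigenvectors, and these are multiples of
    [e]. *)
Lemma eigenvector_simple (lam : R) (e : V) : lam != 0 -> e != 0 ->
  eigenvector b x lam e -> simple_eigenvalue A lam%:C.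
Proof.
move=> lam0 e0 eig; have [ie He] := eig.
have E : resolvent_eq b x lam 0 (e, 0) 0.
  split; apply: strong_of_weak => //=; rewrite ?linear0// => q iq.
    have := He q iq; rewrite (formE b lam) dot0l => h.
    by move: h; rewrite -/b; lra.
  by rewrite kapC linear0 form0C linear0 dot0l; ring.
have Ke0 : ~ ae_equal (Kop2 (e, 0)) (fun=> 0).
  move=> /ae_equalE[/= H _]; move/eqP : e0; apply; apply: Kop_inj (ie).
  apply: cperP => z; apply: (ae_eq_continuous _ _ H); first exact: cper_continuous.
  by move=> t; exact: cvg_cst.
exists (Kop2 (e, 0)); split => //.
  have F0 : Fper2 (fun=> 0 : R[i]) = 0 by apply: Fper2_ae0; [exact: L2_0_0|exact: aeW].
  rewrite -F0 in E; have := graph_of_resolvent wave pcE L2_0_0 E.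
  by congr KP_operator; apply/funext => z; rewrite subr0.
elim=> [|n IH] v /=; first by move=> v0; exists 0; apply: filterS v0 => [|z ->];
  [exact: (ae_filter_ringOfSetsType mu)|rewrite mul0r].
move=> [g Avg /IH[c Hc]].
have [r [vr ir1 ir2 rE]] := resolvent_of_graph pcE Avg.
have [_ v0 g0 _] := Avg.
have sF := L2_0_sub lam 0 v0 g0.
have Hc' : ae_equal (fun z => (lam +i* 0) * v z - g z)
    (fun z => (- complex.Re c * Kop e z) +i* (- complex.Im c * Kop e z)).
  apply: filterS Hc; first exact: (ae_filter_ringOfSetsType mu).
  move=> z Hz; rewrite -opprB Hz; apply/eqP; rewrite eq_complex.
  by case: (c) => c1 c2 /=; rewrite linear0 /= !mulr0 ?subr0 ?add0r !mulNr ?eqxx.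
have HF : resolvent_eq b x lam 0 r
    (Kop (- complex.Re c *: Kop e), Kop (- complex.Im c *: Kop e)).
  have K0 (t : R) : itau (t *: Kop e) = 0 by rewrite linearZ /= itau_Kop mulr0.
  have := rE lam 0; congr (resolvent_eq _ _ _ _ _ (_, _)).
    move/L2_0E : sF => [[s1 _] _]; move/ae_equalE : Hc' => [h1 _].
    by apply: Fper_Kop => //; exact: sqint_locint s1.
  move/L2_0E : sF => [_ [s1 _]]; move/ae_equalE : Hc' => [_ h1].
  by apply: Fper_Kop => //; exact: sqint_locint s1.
have step (d : R) (t t' : V) : itau t = 0 ->
    t = Kop (Bop b x lam 0 t t' - Kop (- d *: Kop e)) -> exists d', t = d' *: e.
  move=> it tE; have [_ Ht] := weak_of_strong tE.
  have Hf q : form b lam x t q = - d * kap e q.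
    rewrite (formE b lam) Ht linearZ /= dotZl /kap; ring.
  have d0 : d = 0 by apply: (jordan_chain_trivial index1 lam0 e0 eig it) => q _.
  have lam2 : lam + lam != 0 by rewrite -mulr2n mulrn_eq0.
  apply: (eigenvector_dependent index1 lam2 e0 eig); split => // q _.
  by rewrite Hf d0 oppr0 mul0r.
have [E1 E2] := HF.
have [t1 rt1] := step (complex.Re c) r.1 r.2 ir1 E1.
have [t2 rt2] : exists d', r.2 = d' *: e.
  by apply: (step (complex.Im c) r.2 r.1 ir2); rewrite {1}E2 /= oppr0.
exists (t1 +i* t2); apply: filterS vr; first exact: (ae_filter_ringOfSetsType mu).
move=> z ->; apply/eqP; rewrite eq_complex complex_ReM complex_ImM /=.
have KZ d : Kop (d *: e) z = d * Kop e z by rewrite linearZ.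
have K0 : Kop (0 : V) z = 0 by rewrite linear0.
by rewrite rt1 rt2 !KZ K0 !mulr0 subr0 add0r !eqxx.
Qed.

(** Off both axes [kernel_eq_complex] applies. On the real axis the two components are real
    eigenvectors, and eigenvalues of the same sign coincide. *)
Lemma spectrum_two_real (lam1 lam2 : R) (e1 e2 : V) : lam1 < 0 -> 0 < lam2 ->
  e1 != 0 -> e2 != 0 -> eigenvector b x lam1 e1 -> eigenvector b x lam2 e2 ->
  spectrum A `\` [set lam1%:C; lam2%:C] `<=` imaginary_axis.
Proof.
move=> l1 l2 n1 n2 eig1 eig2 [al be] /= [nres nlam].
apply/eqP/negPn/negP => al0; apply: nres.
apply: in_resolvent_set_of_kernel => r ker.
have [be0|be0] := eqVneq be 0; last exact: kernel_eq_complex ker.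
rewrite be0 in ker nlam.
have H (s : V) : eigenvector b x al s -> s = 0.
  move=> es; apply/eqP/negPn/negP => s0; apply: nlam.
  have [alp|aln] := ltP 0 al.
    right; rewrite (eigenvector_unique index1 _ s0 n2 es eig2)//.
    by rewrite gt_eqF// addr_gt0.
  left; rewrite (eigenvector_unique index1 _ s0 n1 es eig1)//.
  by rewrite lt_eqF//; lra.
have [i1 i2 W] := ker.
have E1 : r.1 = 0.
  apply: H; split=> // q iq; have [h _] := W q iq.
  by rewrite (formE b al) h mul0r addr0 mulNr addNr.
have E2 : r.2 = 0.
  apply: H; split=> // q iq; have [_ h] := W q iq.
  by rewrite (formE b al) h oppr0 mul0r sub0r addNr.
by rewrite [r]surjective_pairing E1 E2.
Qed.

End Spectrum.

Theorem theorem1 (R : realType) (P : R -> R -> R) (k : R -> R)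
    (hPk : small_periodic_waves P k) :
  exists la : R -> R,
    (fun a : R => la a ^+ 2) =
      (fun a : R => 12^-1 * a ^+ 2) +O_ (0 : R) (fun a : R => a ^+ 4) /\
    \forall a \near (0 : R), forall l : R, l != 0 ->
      (la a ^+ 2 <= l ^+ 2 ->
         spectrum (KP_operator (P a) (k a) l) `<=` imaginary_axis) /\
      (l ^+ 2 < la a ^+ 2 ->
         exists lam1 lam2 : R,
           [/\ lam1 < 0 < lam2,
               simple_eigenvalue (KP_operator (P a) (k a) l) lam1%:C,
               simple_eigenvalue (KP_operator (P a) (k a) l) lam2%:C &
               spectrum (KP_operator (P a) (k a) l) `\` [set lam1%:C; lam2%:C]
                 `<=` imaginary_axis]).
Proof.
have [C dich] := wave_dichotomy hPk.
pose Q a x0 := [/\ 0 <= x0 /\ `|x0 - 12^-1 * a ^+ 2| <= C * `|a| ^+ 4,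
  forall x p, 0 < x -> itau p = 0 -> dot p (sinn 1) = 0 ->
    form (bc P k a) 0 x p p <= 0 -> p = 0,
  forall x, x0 <= x -> 0 < x ->
    forall q, itau q = 0 -> form (bc P k a) 0 x q q = 0 ->
    forall r, itau r = 0 -> form (bc P k a) 0 x q r = 0 &
  forall x sg, 0 < x < x0 -> `|sg| = 1 ->
    exists lam p, [/\ 0 < lam, p != 0 & eigenvector (bc P k a) x (sg * lam) p]].
(* The threshold is chosen for each [a]; as it is nonnegative near 0, its square root serves as
   [la a]. *)
pose x0 a := xget 0 (Q a).
have Qx0 : \forall a \near (0 : R), Q a (x0 a).
  by apply: filterS dich => a; exact: xgetPex.
have sq : \forall a \near (0 : R), Num.sqrt (x0 a) ^+ 2 = x0 a.
  by apply: filterS Qx0 => a [[x00 _] _ _ _]; rewrite sqr_sqrtr.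
exists (fun a => Num.sqrt (x0 a)); split.
  apply/landau_bigO; exists C; apply: filterS2 sq Qx0 => a -> [[_ H] _ _ _].
  exact: H.
apply: filterS2 (filterI sq (wave_near hPk)) (filterI (bc_bound hPk) Qx0).
move=> a [-> [wave pcE _]] [bM [_ idx pos ev]] l l0.
have l2 : 0 < l ^+ 2 by rewrite exprn_even_gt0.
have idx2 q := idx (l ^+ 2) q l2.
split=> [ll|ll].
  by apply: (spectrum_imaginary wave pcE bM); exact: pos.
have ll2 : 0 < l ^+ 2 < x0 a by rewrite l2.
have [lam2 [e2 [lam20 e20 eig2]]] := ev _ 1 ll2 (normr1 _).
have [lam1 [e1 [lam10 e10 eig1]]] := ev _ (-1) ll2 (normrN1 _).
rewrite mul1r in eig2; rewrite mulN1r in eig1.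
have lam1n : - lam1 < 0 by rewrite oppr_lt0.
exists (- lam1), lam2; split.
- by rewrite lam1n.
- by apply: (eigenvector_simple wave pcE idx2 _ e10 eig1); rewrite oppr_eq0 gt_eqF.
- by apply: (eigenvector_simple wave pcE idx2 _ e20 eig2); rewrite gt_eqF.
- exact: (spectrum_two_real wave pcE bM idx2 lam1n lam20 e10 e20 eig1 eig2).
Qed.
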